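(* Let $m\in\tfrac12\mathbb{Z}_{>0}$. (a) If $s,s_1\in\mathbb{Z}$ and $s',s_1'\in\tfrac12+\mathbb{Z}$, then $\tilde\Phi^{+[m;s]}(-\tfrac1\tau,\tfrac{z_1}{\tau},\tfrac{z_2}{\tau})=\tau e^{\frac{2\pi i m}{\tau}z_1z_2}\tilde\Phi^{+[m;s_1]}(\tau,z_1,z_2)$, $\tilde\Phi^{-[m;s]}(-\tfrac1\tau,\tfrac{z_1}{\tau},\tfrac{z_2}{\tau})=\tau e^{\frac{2\pi i m}{\tau}z_1z_2}\tilde\Phi^{+[m;s']}(\tau,z_1,z_2)$, $\tilde\Phi^{+[m;s']}(-\tfrac1\tau,\tfrac{z_1}{\tau},\tfrac{z_2}{\tau})=\tau e^{\frac{2\pi i m}{\tau}z_1z_2}\tilde\Phi^{-[m;s]}(\tau,z_1,z_2)$, $\tilde\Phi^{-[m;s']}(-\tfrac1\tau,\tfrac{z_1}{\tau},\tfrac{z_2}{\tau})=\tau e^{\frac{2\pi i m}{\tau}z_1z_2}\tilde\Phi^{-[m;s_1']}(\tau,z_1,z_2)$. (b) If $s,s'\in\tfrac12\mathbb{Z}$ satisfy $m+s\in\mathbb{Z}$ and $m+s'\in\tfrac12+\mathbb{Z}$, then $\tilde\Phi^{\pm[m;s]}(\tau+1,z_1,z_2)=\tilde\Phi^{\pm[m;s]}(\tau,z_1,z_2)$ and $\tilde\Phi^{\pm[m;s']}(\tau+1,z_1,z_2)=\tilde\Phi^{\mp[m;s']}(\tau,z_1,z_2)$. (c) If $s\in\tfrac12\mathbb{Z}$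 and either $a,b\in\mathbb{Z}$ have the same parity, or $m\in\mathbb{Z}_{>0}$ and $a,b\in\mathbb{Z}$, then $\tilde\Phi^{\pm[m;s]}(\tau,z_1+a\tau,z_2+b\tau)=(\pm1)^a e^{-2\pi i m(bz_1+az_2)}q^{-mab}\tilde\Phi^{\pm[m;s]}(\tau,z_1,z_2)$ and $\tilde\Phi^{\pm[m;s]}(\tau,z_1+a,z_2+b)=e^{2\pi i sa}\tilde\Phi^{\pm[m;s]}(\tau,z_1,z_2)$. (d) If $m\notin\mathbb{Z}$, $s\in\tfrac12\mathbb{Z}$ and $a,b\in\mathbb{Z}$ have different parity, then $\tilde\Phi^{\pm[m;s]}(\tau,z_1+a\tau,z_2+b\tau)=(\pm1)^a e^{-2\pi i m(bz_1+az_2)}q^{-mab}\tilde\Phi^{\pm[m;s+\frac12]}(\tau,z_1,z_2)$ and $\tilde\Phi^{\pm[m;s]}(\tau,z_1+a,z_2+b)=e^{2\pi i sa}\tilde\Phi^{\mp[m;s]}(\tau,z_1,z_2)$.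
   Context: Throughout, $\operatorname{Im}\tau>0$, $q=e^{2\pi i\tau}$, $z_1,z_2\in\mathbb{C}$, and in each formula the sign $\pm$ is the same on both sides (with $\mp$ meaning the opposite sign). For $m\in\tfrac12\mathbb{Z}_{>0}$, $s,j\in\tfrac12\mathbb{Z}$ define $$\Phi^{\pm[m;s]}(\tau,z_1,z_2)=\sum_{n\in\mathbb{Z}}(\pm1)^n\frac{e^{2\pi i mn(z_1+z_2)+2\pi i s z_1}q^{mn^2+sn}}{1-e^{2\pi i z_1}q^n},\qquad \Theta^{\pm}_{j,m}(\tau,z)=\sum_{n\in\mathbb{Z}}(\pm1)^ne^{2\pi i m z(n+\frac{j}{2m})}q^{m(n+\frac{j}{2m})^2},$$ $$R^{\pm}_{j,m}(\tau,z)=\sum_{n\in\frac12\mathbb{Z},\ n\equiv j\bmod 2m}(\pm1)^{\frac{n-j}{2m}}\Big\{\operatorname{sign}(n-\tfrac12-j+2m)-E\big(\psi_{m,n}(\tau,z)\big)\Big\}e^{-\frac{\pi i n^2}{2m}\tau+2\pi i n z},$$ where $E(x)=2\int_0^xe^{-\pi u^2}du$ and $\psi_{m,n}(\tau,z)=\big(n-2m\frac{\operatorname{Im}z}{\operatorname{Im}\tau}\big)\sqrt{\frac{\operatorname{Im}\tau}{m}}$. The modifier is $\Phi^{\pm[m;s]}_{\rm add}(\tau,z_1,z_2)=\sum_{j\in s+\mathbb{Z},\ s\le j<s+2m}R^{\pm}_{j,m}\big(\tau,\tfrac{z_1-z_2}2\big)\Theta^{\pm}_{j,m}(\tau,z_1+z_2)$,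 and the modified functions are $\tilde\Phi^{\pm[m;s]}=\Phi^{\pm[m;s]}-\tfrac12\Phi^{\pm[m;s]}_{\rm add}$. *)

(* Defs.v *)
From Stdlib Require Import Reals ZArith ClassicalEpsilon.
From Coquelicot Require Import Coquelicot.
Open Scope R_scope.

Definition cexp (z : C) : C :=
  (exp (Re z) * cos (Im z), exp (Re z) * sin (Im z)).

Definition twopii : C := (2 * PI * Ci)%C.

Definition qpow (tau : C) (x : R) : C := cexp (twopii * tau * RtoC x)%C.

(** Sum over Z of a two-sided series: sum_{n>=0} f n + sum_{n>=1} f (-n),
    both convergent (value chosen by epsilon; unique since C is Hausdorff). *)
Definition zsum_spec (f : Z -> C) (l : C) : Prop :=
  exists l1 l2 : C,
    is_series (fun n : nat => f (Z.of_nat n)) l1 /\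
    is_series (fun n : nat => f (- Z.of_nat n - 1)%Z) l2 /\
    l = (l1 + l2)%C.

Definition zsum (f : Z -> C) : C := epsilon (inhabits (RtoC 0)) (zsum_spec f).

Definition pmpow (pm : bool) (n : Z) : C :=
  if pm then RtoC 1 else if Z.even n then RtoC 1 else RtoC (-1).

Definition Phi (pm : bool) (m s : R) (tau z1 z2 : C) : C :=
  zsum (fun n : Z =>
    (pmpow pm n *
     cexp (twopii * RtoC (m * IZR n) * (z1 + z2) + twopii * RtoC s * z1)
     * qpow tau (m * IZR n ^ 2 + s * IZR n)
     / (RtoC 1 - cexp (twopii * z1) * qpow tau (IZR n)))%C).

Definition Theta (pm : bool) (j m : R) (tau z : C) : C :=
  zsum (fun n : Z =>
    (pmpow pm n * cexp (twopii * RtoC (m * (IZR n + j / (2 * m))) * z)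
     * qpow tau (m * (IZR n + j / (2 * m)) ^ 2))%C).

Definition Erf (x : R) : R := 2 * RInt (fun u => exp (- PI * u ^ 2)) 0 x.

Definition sgn (x : R) : R :=
  match Rlt_dec 0 x with
  | left _ => 1
  | right _ => match Rlt_dec x 0 with left _ => -1 | right _ => 0 end
  end.

Definition psi (m n : R) (tau z : C) : R :=
  (n - 2 * m * Im z / Im tau) * sqrt (Im tau / m).

(** R^{±}_{j,m}(tau,z): the sum over n in (1/2)Z with n = j mod 2m is
    written as n = j + 2 m k, k in Z, so that (n-j)/(2m) = k. *)
Definition Rfun (pm : bool) (j m : R) (tau z : C) : C :=
  zsum (fun k : Z =>
    let n := j + 2 * m * IZR k in
    (pmpow pm k * RtoC (sgn (n - /2 - j + 2 * m) - Erf (psi m n tau z))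
     * cexp (- (RtoC (PI * n ^ 2 / (2 * m)) * Ci * tau) + twopii * RtoC n * z))%C).

Fixpoint csum (N : nat) (f : nat -> C) : C :=
  match N with
  | O => RtoC 0
  | S N' => (csum N' f + f N')%C
  end.

(** Phi_add^{±[m;s]}: sum over j in s + Z with s <= j < s + 2m,
    i.e. j = s + k with k a natural number, k < 2m. *)
Definition Phi_add (pm : bool) (m s : R) (tau z1 z2 : C) : C :=
  csum (Z.to_nat (up (2 * m))) (fun k : nat =>
    match Rlt_dec (INR k) (2 * m) with
    | left _ =>
        (Rfun pm (s + INR k) m tau ((z1 - z2) / RtoC 2)
         * Theta pm (s + INR k) m tau (z1 + z2))%C
    | right _ => RtoC 0
    end).

Definition Phi_t (pm : bool) (m s : R) (tau z1 z2 : C) : C :=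
  (Phi pm m s tau z1 z2 - RtoC (/2) * Phi_add pm m s tau z1 z2)%C.

Definition is_int (x : R) : Prop := exists k : Z, x = IZR k.
Definition is_half_int (x : R) : Prop := exists k : Z, x = IZR k / 2.
Definition is_half_odd (x : R) : Prop := exists k : Z, x = IZR k + /2.

(* Main.v *)
(* Write v = Im tau, and run L = n tau + b over the lattice Z tau + Z.  The idea is that Phi_t is
   the Gaussian lattice sum
     - 1/(2 pi i) * sum_L (+-1)^n e^{-2 pi i (s + m n) b}
         exp((pi m / v) (- |z1 + L|^2 - 2 i (Im z2) z1 + L conj(z2) - conj(L) z2)) / (z1 + L),
   from which the four transformation laws follow termwise, by reindexing the lattice.

   Put w = z1 + n tau, t = v/m and al = m Im(z1 - z2)/v.  Regrouping the products R_j Theta_j by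
   n turns the claim, row by row, into the one-variable identity
     e^{2 pi i s w}/(1 - e^{2 pi i w}) - 1/2 sum_r (sgn(r >= s) - E((r - al) sqrt t)) e^{2 pi i r w}
       = - 1/(2 pi i) sum_b e^{-2 pi i s b + 2 pi i al (w + b) - pi (w + b)^2 / t}/(w + b),
   r in s + Z.  The al-derivative of the difference of the two sides vanishes by theta inversion,
   while al -> al + 1 multiplies it by e^{2 pi i w} <> 1; hence it is zero. *)

Require Import Defs.
From Stdlib Require Import Reals ZArith.
From Stdlib Require Import List Permutation Lra Lia Psatz Classical ClassicalEpsilon.
From Coquelicot Require Import Coquelicot.
Open Scope R_scope.

(** The sign and the parameter s enter a lattice term only through the character (n, b) -> exp(2 pi
    i (pmshift n - s b)), where pmshift is 0 or 1/2. Hence s matters only modulo 1, and tau ->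
    -1/tau, which acts by (n, b) -> (b, -n), exchanges the sign with the class of s modulo 1: this
    is the pattern of the four formulas in (a). That 2m is an integer enters through the phases 2 m
    n b and m n (n - 1), which become integers. The obstacle is rearrangement. The definitions use
    two one-sided series with a value chosen by [epsilon], whereas the argument regroups double sums
    and reindexes the lattice. Everything is therefore done with unconditional sums, and [zsum_hs]
    leads back to the definitions. The theta inversion rests on uniqueness of Fourier coefficients
    and is proved for real waves with a free phase; two values of the phase recover the real and the
    imaginary part of the complex statement. *)

(** * Unconditional sums *)

(** Classical decidable equality, so that [nodup] and [in_dec] apply to every index type. *)
Definition eqd {I : Type} (x y : I) : {x = y} + {x <> y} :=
  excluded_middle_informative (x = y).

Fixpoint lsum {I : Type} (f : I -> R) (s : list I) : R :=
  match s with nil => 0 | i :: s' => f i + lsum f s' end.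

Lemma lsum_ext {I} (f g : I -> R) s :
  (forall i, In i s -> f i = g i) -> lsum f s = lsum g s.
Proof.
  induction s as [|a s IH]; simpl; intros H; [reflexivity|].
  rewrite (H a), IH; auto.
Qed.

Lemma lsum_app {I} (f : I -> R) s t : lsum f (s ++ t) = lsum f s + lsum f t.
Proof. induction s; simpl; lra. Qed.

Lemma lsum_plus {I} (f g : I -> R) s :
  lsum (fun i => f i + g i) s = lsum f s + lsum g s.
Proof. induction s; simpl; lra. Qed.

Lemma lsum_scal {I} (c : R) (f : I -> R) s :
  lsum (fun i => c * f i) s = c * lsum f s.
Proof. induction s; simpl; lra. Qed.

Lemma lsum_map {I J} (h : J -> I) (f : I -> R) s :
  lsum f (map h s) = lsum (fun j => f (h j)) s.
Proof. induction s; simpl; congruence. Qed.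

Lemma lsum_perm {I} (f : I -> R) s t : Permutation s t -> lsum f s = lsum f t.
Proof. induction 1; simpl; lra. Qed.

Lemma lsum_le {I} (f g : I -> R) s :
  (forall i, In i s -> f i <= g i) -> lsum f s <= lsum g s.
Proof.
  induction s as [|a s IH]; simpl; intros H; [lra|].
  apply Rplus_le_compat; auto.
Qed.

Lemma lsum_zero {I} (f : I -> R) s : (forall i, In i s -> f i = 0) -> lsum f s = 0.
Proof.
  induction s as [|a s IH]; simpl; intros H; [lra|].
  rewrite (H a), IH; auto; lra.
Qed.

Lemma lsum_ge0 {I} (f : I -> R) s : (forall i, 0 <= f i) -> 0 <= lsum f s.
Proof. intros H; induction s as [|a s IH]; simpl; [lra|]. specialize (H a); lra. Qed.

Lemma lsum_abs {I} (f : I -> R) s : Rabs (lsum f s) <= lsum (fun i => Rabs (f i)) s.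
Proof.
  induction s as [|a s IH]; simpl; [rewrite Rabs_R0; lra|].
  eapply Rle_trans; [apply Rabs_triang|]; lra.
Qed.

Lemma incl_split {I} (s0 : list I) : forall s,
  NoDup s0 -> incl s0 s -> exists s1, Permutation s (s0 ++ s1).
Proof.
  induction s0 as [|a s0 IH]; intros s Hn Hi; [exists s; reflexivity|].
  inversion Hn as [|? ? Ha Hn0]; subst.
  destruct (in_split a s) as [l1 [l2 ->]]; [apply Hi; left; reflexivity|].
  destruct (IH (l1 ++ l2)) as [s1 Hs1]; [assumption| |].
  - intros x Hx.
    assert (Hx' : In x (l1 ++ a :: l2)) by (apply Hi; right; exact Hx).
    apply in_app_or in Hx'; apply in_or_app.
    destruct Hx' as [?|[?|?]]; auto; subst; contradiction.
  - exists s1; simpl. rewrite <- Permutation_middle.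
    apply perm_skip; exact Hs1.
Qed.

Lemma lsum_incl {I} (f : I -> R) s s' :
  (forall i, 0 <= f i) -> NoDup s -> incl s s' -> lsum f s <= lsum f s'.
Proof.
  intros Hf Hn Hi. destruct (incl_split s s' Hn Hi) as [s1 H1].
  rewrite (lsum_perm _ _ _ H1), lsum_app.
  pose proof (lsum_ge0 f s1 Hf); lra.
Qed.

Lemma lsum_filter {I} (f : I -> R) (p : I -> bool) s :
  lsum f s = lsum f (filter p s) + lsum f (filter (fun i => negb (p i)) s).
Proof. induction s as [|a s IH]; simpl; [lra|]. destruct (p a); simpl; lra. Qed.

(** Convergence along the directed set of finite duplicate-free lists. It refers to no order of the
    index set, so reindexing and regrouping are free. *)
Definition hsR {I : Type} (f : I -> R) (l : R) : Prop :=
  forall eps, 0 < eps -> exists s0 : list I, forall s,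
    NoDup s -> incl s0 s -> Rabs (lsum f s - l) <= eps.

Definition asum {I : Type} (f : I -> R) : Prop :=
  exists B, forall s, NoDup s -> lsum (fun i => Rabs (f i)) s <= B.

Lemma hsR_unique {I} (f : I -> R) l l' : hsR f l -> hsR f l' -> l = l'.
Proof.
  intros H H'. apply cond_eq. intros eps He.
  destruct (H (eps / 4)) as [s0 H0]; [lra|].
  destruct (H' (eps / 4)) as [s1 H1]; [lra|].
  specialize (H0 (nodup eqd (s0 ++ s1)) (NoDup_nodup _ _)).
  specialize (H1 (nodup eqd (s0 ++ s1)) (NoDup_nodup _ _)).
  assert (A : forall x, In x (s0 ++ s1) -> In x (nodup eqd (s0 ++ s1)))
    by (intros; apply nodup_In; assumption).
  assert (H0' := H0 (fun x Hx => A x (in_or_app _ _ _ (or_introl Hx)))).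
  assert (H1' := H1 (fun x Hx => A x (in_or_app _ _ _ (or_intror Hx)))).
  revert H0' H1'; unfold Rabs; repeat destruct Rcase_abs; intros; lra.
Qed.

Lemma hsR_ext {I} (f g : I -> R) l : (forall i, f i = g i) -> hsR f l -> hsR g l.
Proof.
  intros E H eps He. destruct (H eps He) as [s0 H0]. exists s0. intros s Hn Hi.
  rewrite <- (lsum_ext f g); auto.
Qed.

Lemma hsR_plus {I} (f g : I -> R) l l' :
  hsR f l -> hsR g l' -> hsR (fun i => f i + g i) (l + l').
Proof.
  intros H H' eps He.
  destruct (H (eps / 2)) as [s0 H0]; [lra|].
  destruct (H' (eps / 2)) as [s1 H1]; [lra|].
  exists (s0 ++ s1); intros s Hn Hi. rewrite lsum_plus.
  specialize (H0 s Hn (fun x Hx => Hi x (in_or_app _ _ _ (or_introl Hx)))).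
  specialize (H1 s Hn (fun x Hx => Hi x (in_or_app _ _ _ (or_intror Hx)))).
  replace (_ - _) with ((lsum f s - l) + (lsum g s - l')) by ring.
  eapply Rle_trans; [apply Rabs_triang|]; lra.
Qed.

Lemma hsR_scal {I} c (f : I -> R) l : hsR f l -> hsR (fun i => c * f i) (c * l).
Proof.
  intros H eps He. pose proof (Rabs_pos c) as Hc.
  destruct (H (eps / (Rabs c + 1))) as [s0 H0]; [apply Rdiv_lt_0_compat; lra|].
  exists s0; intros s Hn Hi. specialize (H0 s Hn Hi).
  rewrite lsum_scal, <- Rmult_minus_distr_l, Rabs_mult.
  apply Rle_trans with ((Rabs c + 1) * (eps / (Rabs c + 1))).
  - apply Rmult_le_compat; try apply Rabs_pos; lra.
  - right; field; lra.
Qed.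

Lemma hsR_supp {I} (f : I -> R) s0 :
  NoDup s0 -> (forall i, ~ In i s0 -> f i = 0) -> hsR f (lsum f s0).
Proof.
  intros Hn0 Hz eps He. exists s0; intros s Hn Hi.
  destruct (incl_split s0 s Hn0 Hi) as [s1 H1].
  rewrite (lsum_perm _ _ _ H1), lsum_app, (lsum_zero f s1).
  - rewrite Rplus_0_r, Rminus_diag_eq, Rabs_R0; [lra|reflexivity].
  - intros i Hi1. apply Hz. intro Hi0.
    assert (Hd : NoDup (s0 ++ s1)) by (eapply Permutation_NoDup; eassumption).
    apply NoDup_app_remove_l in Hd as Hd1.
    revert Hi0 Hi1 Hd. clear. induction s0 as [|a s0 IH]; simpl; [tauto|].
    intros [->|Hi0] Hi1 Hd; inversion Hd; subst; auto.
    apply H1; apply in_or_app; auto.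
Qed.

(** Entries of [s] outside the range of [h] contribute 0 and are dropped. The equivalence on
    membership lets [t] inherit the inclusions satisfied by [s]. *)
Lemma preimage_list {I J} (h : J -> I) (f : I -> R) :
  (forall j j', h j = h j' -> j = j') ->
  (forall i, (forall j, h j <> i) -> f i = 0) ->
  forall s, NoDup s -> exists t, NoDup t /\
    lsum f s = lsum (fun j => f (h j)) t /\ (forall j, In j t <-> In (h j) s).
Proof.
  intros Hinj Hz s; induction s as [|a s IH]; intros Hn.
  { exists nil; simpl; split; [constructor|]. tauto. }
  inversion Hn as [|? ? Ha Hn0]; subst.
  destruct (IH Hn0) as [t [Ht1 [Ht2 Ht3]]].
  destruct (classic (exists j, h j = a)) as [[j <-]|Hno].
  - exists (j :: t); simpl; split; [|split].
    + constructor; [|assumption]. rewrite Ht3; assumption.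
    + rewrite Ht2; reflexivity.
    + intros j'; rewrite Ht3. split; intros [H|H]; subst; auto.
  - exists t; simpl; split; [assumption|split].
    + rewrite (Hz a), Ht2; [lra|]. intros j Hj; apply Hno; exists j; exact Hj.
    + intros j; rewrite Ht3. split; [auto|]. intros [H|H]; [|assumption].
      exfalso; apply Hno; exists j; auto.
Qed.

Lemma hsR_inj {I J} (h : J -> I) (f : I -> R) l :
  (forall j j', h j = h j' -> j = j') ->
  (forall i, (forall j, h j <> i) -> f i = 0) ->
  hsR (fun j => f (h j)) l -> hsR f l.
Proof.
  intros Hinj Hz H eps He. destruct (H eps He) as [s0 H0].
  exists (map h s0); intros s Hn Hi.
  destruct (preimage_list h f Hinj Hz s Hn) as [t [Ht1 [Ht2 Ht3]]].
  rewrite Ht2. apply H0; [assumption|].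
  intros j Hj. apply Ht3. apply Hi. apply in_map; assumption.
Qed.

Lemma asum_le {I} (f g : I -> R) :
  (forall i, Rabs (f i) <= g i) -> asum g -> asum f.
Proof.
  intros H [B HB]. exists B; intros s Hn.
  eapply Rle_trans; [|apply HB; eassumption].
  apply lsum_le; intros i _. eapply Rle_trans; [apply H|apply Rle_abs].
Qed.

Lemma asum_scal {I} c (f : I -> R) : asum f -> asum (fun i => c * f i).
Proof.
  intros [B HB]. exists (Rabs c * B); intros s Hn.
  rewrite (lsum_ext _ (fun i => Rabs c * Rabs (f i))).
  - rewrite lsum_scal. apply Rmult_le_compat_l; [apply Rabs_pos|auto].
  - intros; apply Rabs_mult.
Qed.

Lemma asum_plus {I} (f g : I -> R) : asum f -> asum g -> asum (fun i => f i + g i).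
Proof.
  intros [B HB] [B' HB']. exists (B + B'); intros s Hn.
  apply Rle_trans with (lsum (fun i => Rabs (f i) + Rabs (g i)) s).
  - apply lsum_le; intros; apply Rabs_triang.
  - rewrite lsum_plus; apply Rplus_le_compat; auto.
Qed.

Lemma asum_inj {I J} (h : J -> I) (f : I -> R) :
  (forall j j', h j = h j' -> j = j') -> asum f -> asum (fun j => f (h j)).
Proof.
  intros Hinj [B HB]. exists B; intros s Hn.
  rewrite <- (lsum_map h (fun i => Rabs (f i))). apply HB.
  apply FinFun.Injective_map_NoDup; assumption.
Qed.

Lemma asum_prod {I J} (f : I -> R) (g : J -> R) :
  asum f -> asum g -> asum (fun p : I * J => f (fst p) * g (snd p)).
Proof.
  intros [B HB] [B' HB'].
  exists (B * B'); intros s Hn.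
  (* A finite set of pairs lies in the rectangle spanned by its two projections, on which the double
     sum factors. *)
  set (s1 := nodup eqd (map fst s)). set (s2 := nodup eqd (map snd s)).
  apply Rle_trans with
    (lsum (fun p => Rabs (f (fst p) * g (snd p))) (list_prod s1 s2)).
  - apply lsum_incl; [intros; apply Rabs_pos|assumption|].
    intros [i j] Hp. apply in_prod; apply nodup_In.
    + apply (in_map fst) in Hp; exact Hp.
    + apply (in_map snd) in Hp; exact Hp.
  - assert (E : forall t1 t2, lsum (fun p => Rabs (f (fst p) * g (snd p))) (list_prod t1 t2)
      = lsum (fun i => Rabs (f i)) t1 * lsum (fun j => Rabs (g j)) t2).
    { induction t1 as [|a t1 IH]; intros t2; simpl; [lra|].
      rewrite lsum_app, IH, lsum_map; simpl.
      rewrite (lsum_ext _ (fun j => Rabs (f a) * Rabs (g j))), lsum_scal; [lra|].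
      intros; apply Rabs_mult. }
    rewrite E.
    apply Rmult_le_compat; try (apply lsum_ge0; intros; apply Rabs_pos);
      [apply HB|apply HB']; apply NoDup_nodup.
Qed.

Lemma hsR_exists_pos {I} (f : I -> R) :
  (forall i, 0 <= f i) -> asum f -> exists l, hsR f l.
Proof.
  intros Hp [B HB].
  destruct (completeness (fun x => exists s, NoDup s /\ x = lsum f s)) as [l [Hu Hl]].
  - exists B. intros x [s [Hn ->]]. eapply Rle_trans; [|apply (HB s Hn)].
    right; apply lsum_ext; intros; rewrite Rabs_right; auto. apply Rle_ge; auto.
  - exists 0, nil; split; [constructor|reflexivity].
  - exists l; intros eps He.
    destruct (classic (exists s0, NoDup s0 /\ l - eps < lsum f s0)) as [[s0 [H0 H1]]|H].
    + exists s0; intros s Hn Hi.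
      pose proof (lsum_incl f s0 s Hp H0 Hi).
      assert (lsum f s <= l) by (apply Hu; exists s; auto).
      rewrite Rabs_left1; lra.
    + exfalso. assert (l <= l - eps); [|lra]. apply Hl.
      intros x [s [Hn ->]]. apply Rnot_lt_le; intro. apply H; exists s; auto.
Qed.

Lemma hsR_exists {I} (f : I -> R) : asum f -> exists l, hsR f l.
Proof.
  intros Ha.
  assert (Ha' : asum (fun i => Rabs (f i)))
    by (apply asum_le with (fun i => Rabs (f i)); [intros; rewrite Rabs_Rabsolu; lra|];
        destruct Ha as [B HB]; exists B; intros s Hn; erewrite lsum_ext; [apply (HB s Hn)|];
        intros; apply Rabs_Rabsolu).
  destruct (hsR_exists_pos (fun i => Rabs (f i))) as [l1 H1];
    [intros; apply Rabs_pos|assumption|].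
  (* f is the difference of the nonnegative families |f| + f and |f|. *)
  destruct (hsR_exists_pos (fun i => Rabs (f i) + f i)) as [l2 H2].
  - intros i. pose proof (Rle_abs (- f i)); rewrite Rabs_Ropp in *; lra.
  - apply asum_plus; assumption.
  - exists (l2 + -1 * l1).
    eapply hsR_ext; [|apply hsR_plus; [exact H2|apply (hsR_scal (-1)); exact H1]].
    intros; simpl; lra.
Qed.

Lemma NoDup_app_intro {I} (s t : list I) :
  NoDup s -> NoDup t -> (forall x, In x s -> ~ In x t) -> NoDup (s ++ t).
Proof.
  induction s as [|a s IH]; simpl; intros Hs Ht Hd; [assumption|].
  inversion Hs; subst. constructor.
  - rewrite in_app_iff. intros [?|?]; [contradiction|]. apply (Hd a); auto.
  - apply IH; auto.
Qed.

(* Past the finite set [s0], every disjoint partial sum is at most 2, in particular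
   the one over the positive and the one over the negative terms. *)
Lemma hsR_asum {I} (f : I -> R) l : hsR f l -> asum f.
Proof.
  intros H. destruct (H 1 Rlt_0_1) as [s00 H0].
  set (s0 := nodup eqd s00).
  assert (Hn0 : NoDup s0) by apply NoDup_nodup.
  assert (Hi0 : forall t, incl s00 (s0 ++ t)).
  { intros t x Hx. apply in_or_app; left. apply nodup_In; exact Hx. }
  set (p := fun i => if in_dec eqd i s0 then true else false).
  assert (D : forall t, NoDup t -> (forall x, In x t -> ~ In x s0) -> Rabs (lsum f t) <= 2).
  { intros t Ht Hd.
    assert (A1 := H0 (s0 ++ nil) ltac:(rewrite app_nil_r; assumption) (Hi0 _)).
    assert (A2 := H0 (s0 ++ t) ltac:(apply NoDup_app_intro; auto;
       intros x Hx Hx'; apply (Hd x); assumption) (Hi0 _)).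
    rewrite lsum_app in A1, A2; simpl in A1.
    revert A1 A2; unfold Rabs; repeat destruct Rcase_abs; intros; lra. }
  exists (lsum (fun i => Rabs (f i)) s0 + 4). intros s Hn.
  rewrite (lsum_filter _ p).
  set (s2 := filter (fun i => negb (p i)) s).
  assert (Hn2 : NoDup s2) by (apply NoDup_filter; assumption).
  assert (Hd2 : forall x, In x s2 -> ~ In x s0).
  { intros x Hx. apply filter_In in Hx. destruct Hx as [_ Hx].
    unfold p in Hx. destruct (in_dec eqd x s0); [discriminate|assumption]. }
  apply Rplus_le_compat.
  - apply lsum_incl; [intros; apply Rabs_pos|apply NoDup_filter; assumption|].
    intros x Hx. apply filter_In in Hx. destruct Hx as [_ Hx].
    unfold p in Hx. destruct (in_dec eqd x s0); [assumption|discriminate].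
  - set (q := fun i => if Rle_dec 0 (f i) then true else false).
    rewrite (lsum_filter _ q).
    rewrite (lsum_ext _ f (filter q s2)).
    + rewrite (lsum_ext _ (fun i => -1 * f i) (filter (fun i => negb (q i)) s2)).
      * rewrite lsum_scal.
        assert (A1 := D (filter q s2) ltac:(apply NoDup_filter; assumption)
          ltac:(intros x Hx; apply filter_In in Hx; apply Hd2; tauto)).
        assert (A2 := D (filter (fun i => negb (q i)) s2) ltac:(apply NoDup_filter; assumption)
          ltac:(intros x Hx; apply filter_In in Hx; apply Hd2; tauto)).
        revert A1 A2; unfold Rabs; repeat destruct Rcase_abs; intros; lra.
      * intros i Hi. apply filter_In in Hi. destruct Hi as [_ Hi]. unfold q in Hi.
        destruct (Rle_dec 0 (f i)); [discriminate|]. rewrite Rabs_left; lra.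
    + intros i Hi. apply filter_In in Hi. destruct Hi as [_ Hi]. unfold q in Hi.
      destruct (Rle_dec 0 (f i)); [|discriminate]. rewrite Rabs_right; lra.
Qed.

(** Each row sum is met by a finite list up to a small error. Gluing such lists over finitely many
    rows gives a finite set of pairs that contains the part of [s0] above those rows. *)
Lemma hsR_fubini {I J} (f : I * J -> R) (g : I -> R) L :
  hsR f L -> (forall i, hsR (fun j => f (i, j)) (g i)) -> hsR g L.
Proof.
  intros H Hr eps He. destruct (H (eps / 2)) as [s0 H0]; [lra|].
  assert (C : forall del, 0 < del -> forall s, NoDup s -> exists T, NoDup T /\
    (forall p, In p T -> In (fst p) s) /\
    (forall p, In p s0 -> In (fst p) s -> In p T) /\
    Rabs (lsum f T - lsum g s) <= del * INR (length s)).
  { intros del Hdel s; induction s as [|i s IH]; intros Hn.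
    - exists nil; simpl. split; [constructor|]. split; [tauto|]. split; [tauto|].
      rewrite Rminus_diag_eq, Rabs_R0; lra.
    - inversion Hn as [|? ? Hi Hn0]; subst.
      destruct (IH Hn0) as [T [T1 [T2 [T3 T4]]]].
      destruct (Hr i del Hdel) as [t0 Ht0].
      set (t := nodup eqd (t0 ++ map snd s0)).
      assert (A := Ht0 t (NoDup_nodup _ _) ltac:(intros x Hx; apply nodup_In;
        apply in_or_app; auto)).
      exists (map (fun j => (i, j)) t ++ T); split; [|split; [|split]].
      + apply NoDup_app_intro; [|assumption|].
        * apply FinFun.Injective_map_NoDup; [intros x y E; congruence|apply NoDup_nodup].
        * intros x Hx Hx'. apply in_map_iff in Hx. destruct Hx as [j [<- _]].
          apply T2 in Hx'; contradiction.
      + intros p Hp. apply in_app_or in Hp. destruct Hp as [Hp|Hp].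
        * apply in_map_iff in Hp. destruct Hp as [j [<- _]]; left; reflexivity.
        * right; auto.
      + intros [i' j'] Hp [Hi'|Hi']; apply in_or_app; [left|right; auto].
        simpl in Hi'; subst i'. apply in_map_iff. exists j'; split; [reflexivity|].
        apply nodup_In; apply in_or_app; right. apply (in_map snd) in Hp; exact Hp.
      + rewrite lsum_app, lsum_map. simpl length. rewrite S_INR. simpl.
        replace (_ - _) with ((lsum (fun j => f (i, j)) t - g i) + (lsum f T - lsum g s))
          by ring.
        eapply Rle_trans; [apply Rabs_triang|]; lra. }
  (* Every row touched by [s0] is included, so [T] contains [s0]. The error allowed per row adds up
     to at most eps / 2, and the [+ 1] in its denominator covers the empty list. *)
  exists (map fst s0). intros s Hn Hi.
  pose proof (pos_INR (length s)).
  destruct (C (eps / (2 * (INR (length s) + 1)))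
    ltac:(apply Rdiv_lt_0_compat; lra) s Hn) as [T [T1 [T2 [T3 T4]]]].
  assert (A := H0 T T1 ltac:(intros p Hp; apply T3; [assumption|];
    apply Hi; apply in_map; assumption)).
  assert (B : eps / (2 * (INR (length s) + 1)) * INR (length s) <= eps / 2).
  { apply Rmult_le_reg_r with (2 * (INR (length s) + 1)); [lra|].
    field_simplify; [|lra]. nra. }
  revert A T4; unfold Rabs; repeat destruct Rcase_abs; intros; lra.
Qed.

Lemma hsR_lim_nat (f : nat -> R) l : hsR f l -> is_series f l.
Proof.
  intros H. change (is_lim_seq (sum_n f) l). apply is_lim_seq_spec.
  intros eps. destruct (H (eps / 2)) as [s0 H0]; [destruct eps; simpl; lra|].
  assert (E : forall n, sum_n f n = lsum f (seq 0 (S n))).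
  { induction n as [|n IH].
    - rewrite sum_O; simpl; lra.
    - rewrite sum_Sn, IH, (seq_S (S n)), lsum_app. simpl. unfold plus; simpl. lra. }
  exists (list_max s0). intros n Hn. rewrite E.
  eapply Rle_lt_trans; [apply H0; [apply seq_NoDup|]|destruct eps; simpl; lra].
  intros x Hx. apply in_seq.
  assert (x <= list_max s0)%nat; [|lia].
  pose proof (proj1 (list_max_le s0 (list_max s0)) (le_n _)) as F.
  rewrite Forall_forall in F; auto.
Qed.

(** The cut is that of [zsum_spec]: [- n - 1] runs through the negative integers. Each half is
    extended by 0 to all of Z to be compared with the whole. *)
Lemma hsR_Z_split (f : Z -> R) l : hsR f l -> exists l1 l2,
  hsR (fun n : nat => f (Z.of_nat n)) l1 /\
  hsR (fun n : nat => f (- Z.of_nat n - 1)%Z) l2 /\ l = l1 + l2.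
Proof.
  intros H. pose proof (hsR_asum f l H) as Ha.
  destruct (hsR_exists (fun n : nat => f (Z.of_nat n))) as [l1 H1].
  { apply (asum_inj Z.of_nat); [intros; lia|assumption]. }
  destruct (hsR_exists (fun n : nat => f (- Z.of_nat n - 1)%Z)) as [l2 H2].
  { apply (asum_inj (fun n => - Z.of_nat n - 1)%Z); [intros; lia|assumption]. }
  exists l1, l2; split; [assumption|split; [assumption|]].
  apply (hsR_unique f); [assumption|].
  eapply hsR_ext; [|apply hsR_plus;
    [apply (hsR_inj Z.of_nat (fun n => if Z_lt_dec n 0 then 0 else f n) l1)
    |apply (hsR_inj (fun n => - Z.of_nat n - 1)%Z
              (fun n => if Z_lt_dec n 0 then f n else 0) l2)]].
  - intros n; simpl. destruct (Z_lt_dec n 0); lra.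
  - intros; lia.
  - intros n Hn. destruct (Z_lt_dec n 0); [reflexivity|].
    exfalso; apply (Hn (Z.to_nat n)); lia.
  - eapply hsR_ext; [|exact H1]. intros n; simpl.
    destruct (Z_lt_dec (Z.of_nat n) 0); [lia|reflexivity].
  - intros; lia.
  - intros n Hn. destruct (Z_lt_dec n 0); [|reflexivity].
    exfalso; apply (Hn (Z.to_nat (- n - 1))); lia.
  - eapply hsR_ext; [|exact H2]. intros n; simpl.
    destruct (Z_lt_dec (- Z.of_nat n - 1) 0); [reflexivity|lia].
Qed.

(** The common majorant: the Gaussian families below are compared with multiples of this one. *)
Lemma asum_expZ : asum (fun n : Z => exp (- Rabs (IZR n))).
Proof.
  set (r := exp (-1)).
  assert (Hr : 0 < r < 1).
  { split; [apply exp_pos|]. rewrite <- exp_0. apply exp_increasing; lra. }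
  assert (G : forall n, lsum (fun k => r ^ k) (seq 0 n) <= / (1 - r)).
  { assert (E : forall n, lsum (fun k => r ^ k) (seq 0 n) = (1 - r ^ n) / (1 - r)).
    { induction n as [|n IH]; [simpl; field; lra|].
      rewrite seq_S, lsum_app, IH. simpl. field; lra. }
    intros n. rewrite E. unfold Rdiv. rewrite <- (Rmult_1_l (/ (1 - r))) at 2.
    apply Rmult_le_compat_r; [apply Rlt_le, Rinv_0_lt_compat; lra|].
    pose proof (pow_le r n (Rlt_le _ _ (proj1 Hr))); lra. }
  assert (P : forall k : nat, exp (- INR k) = r ^ k).
  { induction k as [|k IH]; [simpl; rewrite Ropp_0; apply exp_0|].
    rewrite S_INR. simpl. rewrite <- IH. unfold r. rewrite <- exp_plus. f_equal; ring. }
  exists (2 * / (1 - r)). intros s Hn.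
  assert (HN : exists N : nat, forall x, In x s -> (Z.abs x < Z.of_nat N)%Z).
  { clear Hn; induction s as [|a s [N HN]]; [exists O; simpl; tauto|].
    exists (N + Z.to_nat (Z.abs a) + 1)%nat. intros x [<-|Hx]; [lia|].
    specialize (HN x Hx); lia. }
  destruct HN as [N HN].
  (* The enclosing list contains 0 twice, which only enlarges the upper bound. *)
  eapply Rle_trans; [apply (lsum_incl _ s
    (map Z.of_nat (seq 0 N) ++ map (fun k => - Z.of_nat k)%Z (seq 0 N)));
    [intros; apply Rabs_pos|assumption|]|].
  - intros x Hx. specialize (HN x Hx). apply in_or_app.
    destruct (Z_le_gt_dec 0 x).
    + left. apply in_map_iff. exists (Z.to_nat x). rewrite in_seq. lia.
    + right. apply in_map_iff. exists (Z.to_nat (- x)). rewrite in_seq. lia.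
  - rewrite lsum_app, !lsum_map.
    assert (E : forall n : nat, Rabs (exp (- Rabs (IZR (Z.of_nat n)))) = r ^ n).
    { intros n. rewrite Rabs_right by (left; apply exp_pos).
      rewrite <- INR_IZR_INZ, Rabs_right by (apply Rle_ge, pos_INR). apply P. }
    rewrite (lsum_ext _ (fun n => r ^ n)) by (intros; apply E).
    rewrite (lsum_ext (fun k => Rabs (exp (- Rabs (IZR (- Z.of_nat k))))) (fun n => r ^ n)).
    + specialize (G N); lra.
    + intros; rewrite opp_IZR, Rabs_Ropp; apply E.
Qed.

(** * The complex exponential *)

Lemma C_eq (z z' : C) : Re z = Re z' -> Im z = Im z' -> z = z'.
Proof. destruct z, z'; simpl; congruence. Qed.

Lemma cexp_plus (z w : C) : cexp (z + w) = (cexp z * cexp w)%C.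
Proof.
  destruct z as [a b], w as [c d]. unfold cexp; simpl.
  rewrite exp_plus, cos_plus, sin_plus. apply C_eq; simpl; ring.
Qed.

Lemma cexp_0 : cexp 0 = 1%C.
Proof. unfold cexp; simpl. rewrite exp_0, cos_0, sin_0. apply C_eq; simpl; ring. Qed.

Lemma Cmod_cexp (z : C) : Cmod (cexp z) = exp (Re z).
Proof.
  unfold cexp, Cmod; simpl.
  replace (_ + _) with (Rsqr (exp (Re z))).
  - apply sqrt_Rsqr. left; apply exp_pos.
  - pose proof (sin2_cos2 (Im z)) as H. unfold Rsqr in *.
    transitivity (exp (Re z) * exp (Re z) * (sin (Im z) * sin (Im z) + cos (Im z) * cos (Im z)));
      [rewrite H|]; ring.
Qed.

Lemma cos_2kpi (n : Z) : cos (2 * PI * IZR n) = 1.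
Proof.
  destruct (Z_le_gt_dec 0 n).
  - replace n with (Z.of_nat (Z.to_nat n)) by lia. rewrite <- INR_IZR_INZ.
    replace (2 * PI * _) with (0 + 2 * INR (Z.to_nat n) * PI) by ring.
    rewrite cos_period; apply cos_0.
  - rewrite <- cos_neg. replace (- (2 * PI * IZR n)) with (2 * PI * IZR (- n))
      by (rewrite opp_IZR; ring).
    replace (- n)%Z with (Z.of_nat (Z.to_nat (- n))) by lia. rewrite <- INR_IZR_INZ.
    replace (2 * PI * _) with (0 + 2 * INR (Z.to_nat (- n)) * PI) by ring.
    rewrite cos_period; apply cos_0.
Qed.

Lemma sin_2kpi (n : Z) : sin (2 * PI * IZR n) = 0.
Proof.
  pose proof (sin2_cos2 (2 * PI * IZR n)) as H. rewrite cos_2kpi in H.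
  apply Rsqr_0_uniq. unfold Rsqr in *; lra.
Qed.

Lemma twopii_eq : twopii = (0, 2 * PI).
Proof. unfold twopii. apply C_eq; simpl; ring. Qed.

Lemma cexp_twopii_int (n : Z) : cexp (twopii * RtoC (IZR n)) = 1%C.
Proof.
  rewrite twopii_eq. unfold cexp; simpl.
  replace (0 * 0 + 2 * PI * IZR n) with (2 * PI * IZR n) by ring.
  rewrite cos_2kpi, sin_2kpi.
  replace (0 * IZR n - 2 * PI * 0) with 0 by ring. rewrite exp_0. apply C_eq; simpl; ring.
Qed.

Lemma cexp_period (z w : C) (n : Z) :
  z = (w + twopii * RtoC (IZR n))%C -> cexp z = cexp w.
Proof. intros ->. rewrite cexp_plus, cexp_twopii_int. ring. Qed.

(** The modulus forces w to be real; then cos(2 pi x) = 1 gives sin(pi x) = 0 by the double angle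
    formula. *)
Lemma cexp_eq1 (w : C) :
  cexp (twopii * w) = 1%C -> exists n : Z, w = RtoC (IZR n).
Proof.
  destruct w as [x y]. rewrite twopii_eq. intros H.
  pose proof (Cmod_cexp ((0, 2 * PI) * (x, y))) as E. rewrite H, Cmod_1 in E.
  simpl in E. rewrite <- exp_0 in E. apply exp_inv in E.
  pose proof PI_RGT_0 as Hpi.
  assert (y = 0) by nra. subst y.
  apply (f_equal fst) in H. unfold cexp in H; simpl in H.
  replace (0 * x - 2 * PI * 0) with 0 in H by ring. rewrite exp_0 in H.
  replace (0 * 0 + 2 * PI * x) with (2 * (PI * x)) in H by ring.
  rewrite cos_2a_sin in H.
  assert (S : sin (PI * x) = 0) by nra.
  apply sin_eq_0_0 in S. destruct S as [k Hk].
  exists k. apply C_eq; simpl; [|reflexivity]. nra.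
Qed.

(** * Unconditional sums of complex families *)

Definition hs {I : Type} (f : I -> C) (l : C) : Prop :=
  hsR (fun i => Re (f i)) (Re l) /\ hsR (fun i => Im (f i)) (Im l).

Lemma hs_unique {I} (f : I -> C) l l' : hs f l -> hs f l' -> l = l'.
Proof.
  intros [H1 H2] [H1' H2']. apply C_eq.
  - apply (hsR_unique _ _ _ H1 H1').
  - apply (hsR_unique _ _ _ H2 H2').
Qed.

Lemma hs_ext {I} (f g : I -> C) l : (forall i, f i = g i) -> hs f l -> hs g l.
Proof.
  intros E [H1 H2]; split.
  - revert H1; apply hsR_ext; intros; rewrite E; reflexivity.
  - revert H2; apply hsR_ext; intros; rewrite E; reflexivity.
Qed.

Lemma hs_plus {I} (f g : I -> C) l l' :
  hs f l -> hs g l' -> hs (fun i => f i + g i)%C (l + l')%C.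
Proof. intros [H1 H2] [H1' H2']; split; simpl; apply hsR_plus; assumption. Qed.

Lemma hs_scal {I} (c : C) (f : I -> C) l :
  hs f l -> hs (fun i => c * f i)%C (c * l)%C.
Proof.
  intros [H1 H2]; destruct c as [a b]; split; simpl.
  - apply hsR_ext with (fun i => a * Re (f i) + (- b) * Im (f i)).
    { intros; unfold Re, Im; ring. }
    replace (_ - _) with (a * Re l + (- b) * Im l) by (unfold Re, Im; ring).
    apply hsR_plus; apply hsR_scal; assumption.
  - apply hsR_plus; apply hsR_scal; assumption.
Qed.

Lemma hs_inj {I J} (h : J -> I) (f : I -> C) l :
  (forall j j', h j = h j' -> j = j') ->
  (forall i, (forall j, h j <> i) -> f i = 0%C) ->
  hs (fun j => f (h j)) l -> hs f l.
Proof.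
  intros Hi Hz [H1 H2]; split.
  - apply (hsR_inj h); auto. intros i Hj; rewrite (Hz i Hj); reflexivity.
  - apply (hsR_inj h); auto. intros i Hj; rewrite (Hz i Hj); reflexivity.
Qed.

Lemma hs_bij {I J} (h : J -> I) (g : I -> J) (f : I -> C) l :
  (forall j, g (h j) = j) -> (forall i, h (g i) = i) ->
  hs f l -> hs (fun j => f (h j)) l.
Proof.
  intros Hgh Hhg H. apply (hs_inj g (fun j => f (h j))).
  - intros i i' E. rewrite <- (Hhg i), E, Hhg; reflexivity.
  - intros j Hj. exfalso; apply (Hj (h j)); apply Hgh.
  - revert H; apply hs_ext; intros; rewrite Hhg; reflexivity.
Qed.

Lemma hs_shift (a : Z) (f : Z -> C) l : hs f l -> hs (fun n => f (n + a)%Z) l.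
Proof. apply (hs_bij (fun n => n + a)%Z (fun n => n - a)%Z); intros; lia. Qed.

Lemma Rabs_Re_le (z : C) : Rabs (Re z) <= Cmod z.
Proof. apply (Rle_trans _ _ _ (Rmax_l _ _) (Rmax_Cmod z)). Qed.

Lemma Rabs_Im_le (z : C) : Rabs (Im z) <= Cmod z.
Proof. apply (Rle_trans _ _ _ (Rmax_r _ _) (Rmax_Cmod z)). Qed.

Lemma Cmod_le_abs (z : C) : Cmod z <= Rabs (Re z) + Rabs (Im z).
Proof.
  destruct z as [x y]; unfold Cmod; simpl.
  pose proof (Rabs_pos x); pose proof (Rabs_pos y).
  rewrite <- (sqrt_Rsqr (Rabs x + Rabs y)) by lra.
  apply sqrt_le_1_alt. unfold Rsqr.
  rewrite <- (pow2_abs x), <- (pow2_abs y) at 1.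
  replace (x * (x * 1)) with (Rabs x * Rabs x) by (rewrite <- Rabs_mult, Rabs_right; nra).
  replace (y * (y * 1)) with (Rabs y * Rabs y) by (rewrite <- Rabs_mult, Rabs_right; nra).
  nra.
Qed.

Lemma hs_exists {I} (f : I -> C) (g : I -> R) :
  (forall i, Cmod (f i) <= g i) -> asum g -> exists l, hs f l.
Proof.
  intros H Ha.
  destruct (hsR_exists (fun i => Re (f i))) as [a A].
  { apply asum_le with g; [|assumption]. intros i.
    eapply Rle_trans; [apply Rabs_Re_le|apply H]. }
  destruct (hsR_exists (fun i => Im (f i))) as [b B].
  { apply asum_le with g; [|assumption]. intros i.
    eapply Rle_trans; [apply Rabs_Im_le|apply H]. }
  exists (a, b); split; assumption.
Qed.

Lemma asum_abs {I} (f : I -> R) : asum f -> asum (fun i => Rabs (f i)).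
Proof.
  intros [B HB]; exists B; intros s Hn.
  erewrite lsum_ext; [apply (HB s Hn)|]. intros; apply Rabs_Rabsolu.
Qed.

Lemma hs_asum {I} (f : I -> C) l : hs f l -> asum (fun i => Cmod (f i)).
Proof.
  intros [H1 H2]. apply asum_le with (fun i => Rabs (Re (f i)) + Rabs (Im (f i))).
  - intros i. rewrite Rabs_right by (apply Rle_ge, Cmod_ge_0). apply Cmod_le_abs.
  - apply asum_plus; apply asum_abs; eapply hsR_asum; eassumption.
Qed.

Lemma hs_fubini {I J} (f : I * J -> C) (g : I -> C) L :
  hs f L -> (forall i, hs (fun j => f (i, j)) (g i)) -> hs g L.
Proof.
  intros [H1 H2] Hr; split.
  - apply (hsR_fubini (fun p => Re (f p))); [assumption|]. intros; apply Hr.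
  - apply (hsR_fubini (fun p => Im (f p))); [assumption|]. intros; apply Hr.
Qed.

(** Existence comes from absolute convergence; Fubini along the rows then identifies the value. *)
Lemma hs_prod {I J} (f : I -> C) (g : J -> C) a b :
  hs f a -> hs g b -> hs (fun p : I * J => f (fst p) * g (snd p))%C (a * b)%C.
Proof.
  intros Hf Hg.
  destruct (hs_exists (fun p : I * J => f (fst p) * g (snd p))%C
    (fun p => Cmod (f (fst p)) * Cmod (g (snd p)))) as [l Hl].
  - intros; rewrite Cmod_mult; apply Rle_refl.
  - apply (asum_prod (fun i => Cmod (f i)) (fun j => Cmod (g j)));
      eapply hs_asum; eassumption.
  - replace (a * b)%C with l; [assumption|].
    apply (hs_unique (fun i => f i * b)%C).
    + apply (hs_fubini _ _ _ Hl). intros i; simpl. apply hs_scal; assumption.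
    + apply hs_ext with (fun i => b * f i)%C; [intros; ring|].
      replace (a * b)%C with (b * a)%C by ring. apply hs_scal; assumption.
Qed.

(** * Comparison with the two-sided series [zsum] *)

Lemma sum_n_C (f : nat -> C) n :
  sum_n f n = (sum_n (fun k => Re (f k)) n, sum_n (fun k => Im (f k)) n).
Proof.
  induction n as [|n IH].
  - rewrite !sum_O. destruct (f O); reflexivity.
  - rewrite !sum_Sn, IH. destruct (f (S n)); reflexivity.
Qed.

Lemma is_series_C (f : nat -> C) (l : C) :
  is_series (fun n => Re (f n)) (Re l) -> is_series (fun n => Im (f n)) (Im l) ->
  is_series f l.
Proof.
  intros H1 H2.
  change (is_lim_seq (sum_n (fun n => Re (f n))) (Re l)) in H1.
  change (is_lim_seq (sum_n (fun n => Im (f n))) (Im l)) in H2.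
  apply is_lim_seq_spec in H1; apply is_lim_seq_spec in H2.
  apply filterlim_locally_ball_norm. intros eps.
  assert (He : 0 < eps / 2) by (destruct eps; simpl; lra).
  destruct (H1 (mkposreal _ He)) as [N1 E1]. destruct (H2 (mkposreal _ He)) as [N2 E2].
  exists (N1 + N2)%nat. intros n Hn.
  assert (A1 := E1 n ltac:(lia)). assert (A2 := E2 n ltac:(lia)).
  simpl in A1, A2. rewrite sum_n_C. unfold ball_norm, norm, minus; simpl.
  eapply Rle_lt_trans; [apply Cmod_le_abs|]. simpl.
  unfold Rminus in *. unfold Re, Im in *. lra.
Qed.

Lemma hs_series_nat (f : nat -> C) l : hs f l -> is_series f l.
Proof. intros [H1 H2]; apply is_series_C; apply hsR_lim_nat; assumption. Qed.

Lemma is_series_C_unique (f : nat -> C) (l l' : C) :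
  @is_series C_AbsRing C_NormedModule f l -> @is_series C_AbsRing C_NormedModule f l' -> l = l'.
Proof.
  intros H H'.
  exact (@filterlim_locally_unique nat C_AbsRing C_NormedModule eventually
    (Proper_StrongProper _ eventually_filter) (sum_n f) l l' H H').
Qed.

(** Both halves of an unconditional sum converge as series, so [zsum_spec] is inhabited, and
    uniqueness of limits pins down the value picked by [epsilon]. *)
Lemma zsum_hs (f : Z -> C) (l : C) : hs f l -> zsum f = l.
Proof.
  intros [H1 H2].
  assert (S : zsum_spec f l).
  { destruct (hsR_Z_split _ _ H1) as [a1 [a2 [A1 [A2 A3]]]].
    destruct (hsR_Z_split _ _ H2) as [b1 [b2 [B1 [B2 B3]]]].
    exists (a1, b1), (a2, b2); split; [|split].
    - apply hs_series_nat; split; assumption.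
    - apply hs_series_nat; split; assumption.
    - apply C_eq; assumption. }
  pose proof (epsilon_spec (inhabits (RtoC 0)) (zsum_spec f) (ex_intro _ l S)) as S'.
  fold (zsum f) in S'. destruct S as [l1 [l2 [L1 [L2 ->]]]].
  destruct S' as [l1' [l2' [L1' [L2' ->]]]].
  f_equal; eapply is_series_C_unique; eassumption.
Qed.

(** * Exchange of sums and integrals, uniqueness of Fourier coefficients *)

Definition sumR {I : Type} (f : I -> R) : R := epsilon (inhabits 0) (hsR f).

Lemma sumR_spec {I} (f : I -> R) : asum f -> hsR f (sumR f).
Proof. intros H. unfold sumR. apply epsilon_spec. apply hsR_exists; assumption. Qed.

Lemma sumR_eq {I} (f : I -> R) l : hsR f l -> sumR f = l.
Proof.
  intros H. apply (hsR_unique f); [|assumption].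
  apply sumR_spec. eapply hsR_asum; eassumption.
Qed.

(** The hypotheses of the Weierstrass test: a summable majorant on every bounded interval. *)
Definition normal_family {I : Type} (f : I -> R -> R) : Prop :=
  (forall i x, continuous (f i) x) /\
  (forall A, exists M, asum M /\ forall i x, Rabs x <= A -> Rabs (f i x) <= M i).

Lemma normal_family_hsR {I} (f : I -> R -> R) x :
  normal_family f -> hsR (fun i => f i x) (sumR (fun i => f i x)).
Proof.
  intros [_ H]. apply sumR_spec. destruct (H (Rabs x)) as [M [HM HB]].
  apply asum_le with M; [|assumption]. intros; apply HB; apply Rle_refl.
Qed.

Lemma normal_family_mult {I} (f : I -> R -> R) (g : R -> R) :
  normal_family f -> (forall x, continuous g x) -> (forall x, Rabs (g x) <= 1) ->
  normal_family (fun i x => f i x * g x).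
Proof.
  intros [H1 H2] Hg Hb. split.
  - intros i x. apply (continuous_mult (f i) g); auto.
  - intros A. destruct (H2 A) as [M [HM HB]]. exists M; split; [assumption|].
    intros i x Hx. rewrite Rabs_mult. rewrite <- (Rmult_1_r (M i)).
    apply Rmult_le_compat; auto using Rabs_pos.
Qed.

Lemma normal_family_unif {I} (f : I -> R -> R) A eps :
  normal_family f -> 0 < eps ->
  exists s0, forall s, NoDup s -> incl s0 s -> forall x, Rabs x <= A ->
    Rabs (lsum (fun i => f i x) s - sumR (fun i => f i x)) <= eps.
Proof.
  intros Hf He. destruct (proj2 Hf A) as [M [HM HB]].
  destruct (hsR_exists (fun i => Rabs (M i)) (asum_abs _ HM)) as [l Hl].
  destruct (Hl (eps / 4)) as [s0 H0]; [lra|].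
  exists s0. intros s Hn Hi0 x Hx.
  (* [s1] depends on [x], whereas [s0] does not. The terms that [s1] adds to [s] are controlled by
     the majorant, whose partial sums over [s] and [s'] both lie within eps / 4 of its total. *)
  destruct (normal_family_hsR f x Hf (eps / 2)) as [s1 H1]; [lra|].
  set (s' := nodup eqd (s ++ s1)).
  assert (Hi : incl s s').
  { intros y Hy. apply nodup_In. apply in_or_app; auto. }
  assert (Hn' : NoDup s') by apply NoDup_nodup.
  destruct (incl_split s s' Hn Hi) as [r Hr].
  assert (B1 := H1 s' Hn' ltac:(intros y Hy; apply nodup_In; apply in_or_app; auto)).
  assert (B2 := H0 s' Hn' ltac:(intros y Hy; auto)).
  assert (B3 := H0 s Hn Hi0).
  rewrite (lsum_perm _ _ _ Hr), lsum_app in B1.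
  rewrite (lsum_perm _ _ _ Hr), lsum_app in B2.
  assert (B4 : Rabs (lsum (fun i => f i x) r) <= lsum (fun i => Rabs (M i)) r).
  { eapply Rle_trans; [apply lsum_abs|]. apply lsum_le; intros i _.
    eapply Rle_trans; [apply HB; assumption|apply Rle_abs]. }
  revert B1 B2 B3 B4.
  generalize (lsum (fun i => Rabs (M i)) r) (lsum (fun i => Rabs (M i)) s).
  intros u v B1 B2 B3 B4. unfold Rabs in B1, B2, B3, B4 |- *.
  repeat destruct Rcase_abs; lra.
Qed.

Lemma continuous_lsum {I} (f : I -> R -> R) s x :
  (forall i, continuous (f i) x) -> continuous (fun y => lsum (fun i => f i y) s) x.
Proof.
  intros H. induction s as [|a s IH]; simpl; [apply continuous_const|].
  apply (continuous_plus (f a)); auto.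
Qed.

Lemma normal_family_continuous {I} (f : I -> R -> R) x :
  normal_family f -> continuous (fun y => sumR (fun i => f i y)) x.
Proof.
  intros Hf. apply filterlim_locally. intros eps.
  assert (He : 0 < eps / 4) by (destruct eps; simpl; lra).
  destruct (normal_family_unif f (Rabs x + 1) (eps / 4) Hf He) as [s0 Hs0].
  set (s := nodup eqd s0).
  assert (Hs := Hs0 s (NoDup_nodup _ _) ltac:(intros y Hy; apply nodup_In; auto)).
  assert (Hc := continuous_lsum f s x (fun i => proj1 Hf i x)).
  apply (proj1 (filterlim_locally _ _)) with (eps := mkposreal _ He) in Hc.
  destruct Hc as [d Hd].
  assert (Hm : 0 < Rmin d 1) by (apply Rmin_pos; [destruct d; auto|lra]).
  exists (mkposreal _ Hm). intros y Hy.
  assert (Hy1 : Rabs (y - x) < Rmin d 1) by exact Hy.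
  assert (A1 : Rabs (lsum (fun i => f i y) s - lsum (fun i => f i x) s) < eps / 4).
  { apply Hd. change (Rabs (y - x) < d).
    apply Rlt_le_trans with (1 := Hy1). apply Rmin_l. }
  assert (A2 := Hs x ltac:(lra)).
  assert (A3 := Hs y ltac:(pose proof (Rmin_r d 1);
    replace y with (x + (y - x)) by ring; eapply Rle_trans; [apply Rabs_triang|]; lra)).
  change (Rabs (sumR (fun i => f i y) - sumR (fun i => f i x)) < eps).
  pose proof (cond_pos eps).
  revert A1 A2 A3. unfold Rabs. repeat destruct Rcase_abs; intros; lra.
Qed.

Lemma is_RInt_lsum {I} (f : I -> R -> R) s a b :
  (forall i x, continuous (f i) x) ->
  is_RInt (fun x => lsum (fun i => f i x) s) a b (lsum (fun i => RInt (f i) a b) s).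
Proof.
  intros H. induction s as [|i s IH]; simpl.
  - assert (P : is_RInt (fun _ : R => 0) a b ((b - a) * 0))
      by exact (is_RInt_const (V := R_NormedModule) a b 0).
    rewrite Rmult_0_r in P. exact P.
  - apply (is_RInt_plus (f i)); [|assumption].
    apply (@RInt_correct R_CompleteNormedModule). apply (@ex_RInt_continuous R_CompleteNormedModule); auto.
Qed.

Lemma normal_family_RInt {I} (f : I -> R -> R) a b :
  a <= b -> normal_family f ->
  hsR (fun i => RInt (f i) a b) (RInt (fun x => sumR (fun i => f i x)) a b).
Proof.
  intros Hab Hf.
  assert (E : asum (fun i => RInt (f i) a b)).
  { destruct (proj2 Hf (Rabs a + Rabs b)) as [M [HM HB]].
    apply asum_le with (fun i => (b - a) * M i); [|apply asum_scal; assumption].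
    intros i. apply abs_RInt_le_const; [assumption| |].
    - apply (@ex_RInt_continuous R_CompleteNormedModule); intros; apply Hf.
    - intros t Ht. apply HB. unfold Rabs; repeat destruct Rcase_abs; lra. }
  destruct (hsR_exists _ E) as [L HL].
  replace (RInt _ a b) with L; [assumption|].
  apply cond_eq. intros eps He.
  (* The [+ 1] keeps the denominator positive when a = b. *)
  set (e1 := eps / (4 * (b - a + 1))).
  assert (He1 : 0 < e1) by (apply Rdiv_lt_0_compat; lra).
  destruct (normal_family_unif f (Rabs a + Rabs b) e1 Hf He1) as [s0 H0].
  destruct (HL (eps / 4)) as [s1 H1]; [lra|].
  set (s := nodup eqd (s0 ++ s1)).
  assert (Hn : NoDup s) by apply NoDup_nodup.
  assert (B1 := H1 s Hn ltac:(intros y Hy; apply nodup_In; apply in_or_app; auto)).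
  assert (U : forall x, a <= x <= b ->
    Rabs (lsum (fun i => f i x) s - sumR (fun i => f i x)) <= e1).
  { intros x Hx. apply H0; [assumption| |].
    - intros y Hy; apply nodup_In; apply in_or_app; auto.
    - unfold Rabs; repeat destruct Rcase_abs; lra. }
  assert (V : Rabs (lsum (fun i => RInt (f i) a b) s
      - RInt (fun x => sumR (fun i => f i x)) a b) <= (b - a) * e1).
  { assert (P := is_RInt_lsum f s a b (proj1 Hf)).
    assert (Q : ex_RInt (fun x => sumR (fun i => f i x)) a b).
    { apply (@ex_RInt_continuous R_CompleteNormedModule). intros; apply normal_family_continuous; assumption. }
    rewrite <- (is_RInt_unique _ _ _ _ P).
    assert (Q' : ex_RInt (fun x => lsum (fun i => f i x) s) a b) by (eexists; exact P).
    change (Rabs (minus (RInt (fun x => lsum (fun i => f i x) s) a b)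
      (RInt (fun x => sumR (fun i => f i x)) a b)) <= (b - a) * e1).
    rewrite <- (RInt_minus (V := R_CompleteNormedModule)) by assumption.
    apply abs_RInt_le_const; [assumption| |exact U].
    apply (ex_RInt_minus (V := R_NormedModule)); assumption. }
  assert (W : (b - a) * e1 <= eps / 2).
  { unfold e1. apply Rmult_le_reg_r with (4 * (b - a + 1)); [lra|].
    field_simplify; [|lra]. nra. }
  revert B1 V; unfold Rabs; repeat destruct Rcase_abs; intros; lra.
Qed.

(** * Uniqueness of Fourier coefficients *)

Ltac cont := apply (ex_derive_continuous (K := R_AbsRing) (V := R_NormedModule)); auto_derive; auto.

Lemma cos_mult_phase (x y : R) : cos x * cos y = / 2 * (cos (x + y) + cos (x - y)).
Proof. rewrite cos_plus, cos_minus; field. Qed.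

Lemma RInt_ex_cont (f : R -> R) a b : (forall x, continuous f x) -> ex_RInt f a b.
Proof. intros; apply (@ex_RInt_continuous R_CompleteNormedModule); auto. Qed.

(** The free phase [phi] covers the cosine and sine coefficients at once and avoids complex
    integrals. *)
Definition fourier_null (D : R -> R) : Prop :=
  forall (j : Z) (phi : R),
    RInt (fun x => D x * cos (2 * PI * IZR j * x + phi)) (- / 2) (/ 2) = 0.

(** Multiplication by cos(2 pi x) only moves the frequency j to j + 1 and j - 1, so vanishing
    coefficients still vanish. *)
Lemma fourier_null_mult (D : R -> R) c :
  (forall x, continuous D x) -> fourier_null D ->
  fourier_null (fun x => D x * (c + cos (2 * PI * x))).
Proof.
  intros Hc Hz j phi.
  assert (A : forall k psi, is_RInt (fun x => D x * cos (2 * PI * IZR k * x + psi))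
     (- / 2) (/ 2) 0).
  { intros k psi. rewrite <- (Hz k psi). apply (@RInt_correct R_CompleteNormedModule).
    apply RInt_ex_cont. intros x. apply (continuous_mult D); [auto|cont]. }
  apply is_RInt_unique.
  apply is_RInt_ext with (fun x => plus (scal c (D x * cos (2 * PI * IZR j * x + phi)))
    (scal (/ 2) (plus (D x * cos (2 * PI * IZR (j + 1) * x + phi))
                      (D x * cos (2 * PI * IZR (j - 1) * x + phi))))).
  - intros x _. unfold plus, scal; simpl. unfold mult; simpl.
    rewrite plus_IZR, minus_IZR.
    replace (2 * PI * (IZR j + 1) * x + phi)
      with ((2 * PI * IZR j * x + phi) + 2 * PI * x) by ring.
    replace (2 * PI * (IZR j - 1) * x + phi)
      with ((2 * PI * IZR j * x + phi) - 2 * PI * x) by ring.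
    rewrite (cos_plus _ (2 * PI * x)), (cos_minus _ (2 * PI * x)). field.
  - replace 0 with (plus (scal c 0) (scal (/ 2) (plus 0 0)))
      by (unfold plus, scal; simpl; unfold mult; simpl; ring).
    apply (is_RInt_plus (V := R_NormedModule)); [apply (is_RInt_scal (V := R_NormedModule)); apply A|].
    apply (is_RInt_scal (V := R_NormedModule)).
    apply (is_RInt_plus (V := R_NormedModule)); apply A.
Qed.

Lemma fourier_null_pow (D : R -> R) c N :
  (forall x, continuous D x) -> fourier_null D ->
  (forall x, continuous (fun x => D x * (c + cos (2 * PI * x)) ^ N) x) /\
  fourier_null (fun x => D x * (c + cos (2 * PI * x)) ^ N).
Proof.
  intros Hc Hz. induction N as [|N [IH1 IH2]].
  - split.
    + intros x. apply (continuous_mult D); [auto|cont].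
    + intros j phi. rewrite <- (Hz j phi). apply RInt_ext. intros; simpl; ring.
  - split.
    + intros x. apply (continuous_mult D); [auto|cont].
    + intros j phi.
      rewrite <- (fourier_null_mult _ c IH1 IH2 j phi). apply RInt_ext. intros; simpl; ring.
Qed.

(* The kernel [1 + cos(2 pi x) - cos(2 pi d)] is at most 1 in modulus for [|x| >= d] and
   exceeds 1 near 0, so its powers concentrate at 0. *)
Lemma fourier_null_nonpos (D : R -> R) :
  (forall x, continuous D x) -> fourier_null D -> D 0 <= 0.
Proof.
  intros Hc Hz. apply Rnot_lt_le. intros Hpos.
  assert (L := proj1 (filterlim_locally _ _) (Hc 0)).
  assert (He : 0 < D 0 / 2) by lra.
  destruct (L (mkposreal _ He)) as [d0 Hd0].
  set (d := Rmin (d0 / 2) (/ 4)).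
  assert (Hd : 0 < d <= / 4).
  { split; [apply Rmin_pos; [destruct d0; simpl; lra|lra]|apply Rmin_r]. }
  assert (HD : forall x, Rabs x <= d -> D 0 / 2 <= D x).
  { intros x Hx. assert (A : Rabs (D x - D 0) < D 0 / 2).
    { apply Hd0. change (Rabs (x - 0) < d0). rewrite Rminus_0_r.
      pose proof (Rmin_l (d0 / 2) (/ 4)). unfold d in Hx. destruct d0; simpl in *; lra. }
    revert A; unfold Rabs; destruct Rcase_abs; lra. }
  pose proof PI_RGT_0 as Hpi.
  set (c := 1 - cos (2 * PI * d)).
  set (p := fun x => c + cos (2 * PI * x)).
  assert (Cmono : forall x y, 0 <= x -> x <= y -> y <= / 2 -> cos (2 * PI * y) <= cos (2 * PI * x)).
  { intros x y H1 H2 H3. apply cos_decr_1; nra. }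
  assert (Psym : forall x, p x = p (Rabs x)).
  { intros x. unfold p. f_equal. unfold Rabs; destruct Rcase_abs; [|reflexivity].
    rewrite <- cos_neg. f_equal; ring. }
  assert (P1 : forall x, Rabs x <= d -> 1 <= p x).
  { intros x Hx. rewrite Psym. unfold p, c.
    pose proof (Cmono (Rabs x) d (Rabs_pos _) Hx ltac:(lra)). lra. }
  assert (P2 : forall x, d <= Rabs x <= / 2 -> Rabs (p x) <= 1).
  { intros x Hx. rewrite Psym. unfold p, c.
    pose proof (Cmono d (Rabs x) ltac:(lra) ltac:(lra) ltac:(lra)).
    pose proof (COS_bound (2 * PI * Rabs x)). pose proof (COS_bound (2 * PI * d)).
    assert (0 <= cos (2 * PI * d)) by (apply cos_ge_0; nra).
    unfold Rabs at 1; destruct Rcase_abs; lra. }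
  set (eta := cos (2 * PI * (d / 2)) - cos (2 * PI * d)).
  assert (Heta : 0 < eta).
  { unfold eta. assert (cos (2 * PI * d) < cos (2 * PI * (d / 2))); [|lra].
    apply cos_decreasing_1; nra. }
  assert (P3 : forall x, Rabs x <= d / 2 -> 1 + eta <= p x).
  { intros x Hx. rewrite Psym. unfold p, c, eta.
    pose proof (Cmono (Rabs x) (d / 2) (Rabs_pos _) Hx ltac:(lra)). lra. }
  set (F := fun N x => D x * p x ^ N).
  assert (FC : forall N x, continuous (F N) x) by (intros N; apply (fourier_null_pow D c N Hc Hz)).
  assert (FZ : forall N, RInt (F N) (- / 2) (/ 2) = 0).
  { intros N. etransitivity; [|exact (proj2 (fourier_null_pow D c N Hc Hz) 0%Z 0)].
    apply RInt_ext. intros x _. unfold F, p.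
    replace (2 * PI * 0 * x + 0) with 0 by ring. rewrite cos_0, Rmult_1_r. reflexivity. }
  assert (AC : forall x, continuous (fun y => - Rabs (D y)) x).
  { intros x. apply (continuous_opp (K := R_AbsRing) (V := R_NormedModule) (fun y => Rabs (D y))).
    apply continuous_comp; [auto|]. apply continuous_Rabs. }
  (* For |x| <= d the product is nonnegative, elsewhere the kernel has modulus at most 1; either way
     the lower bound is independent of [N]. *)
  assert (LB : forall N x, - / 2 <= x <= / 2 -> - Rabs (D x) <= F N x).
  { intros N x Hx. unfold F. destruct (Rle_dec (Rabs x) d) as [h|h].
    - assert (0 <= p x ^ N) by (apply pow_le; pose proof (P1 x h); lra).
      pose proof (HD x h). rewrite Rabs_right by lra. nra.
    - assert (Hp : Rabs (p x ^ N) <= 1).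
      { rewrite <- RPow_abs. rewrite <- (pow1 N). apply pow_incr. split; [apply Rabs_pos|].
        apply P2. split; [lra|]. unfold Rabs; destruct Rcase_abs; lra. }
      assert (Q : Rabs (D x * p x ^ N) <= Rabs (D x)).
      { rewrite Rabs_mult. pose proof (Rabs_pos (D x)). nra. }
      pose proof (Rle_abs (- (D x * p x ^ N))) as Q'. rewrite Rabs_Ropp in Q'. lra. }
  set (B1 := RInt (fun y => - Rabs (D y)) (- / 2) (- (d / 2))).
  set (B2 := RInt (fun y => - Rabs (D y)) (d / 2) (/ 2)).
  (* By Bernoulli's inequality the middle part grows at least linearly in [N], against two fixed
     bounds for the outer parts; the vanishing integral cannot allow this for all [N]. *)
  assert (K : forall N, B1 + B2 + d * (D 0 / 2 * (1 + INR N * eta)) <= 0).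
  { intros N. apply Rle_trans with (RInt (F N) (- / 2) (/ 2)); [|right; apply FZ].
    rewrite <- (RInt_Chasles (F N) (- / 2) (- (d / 2)) (/ 2)) by (apply RInt_ex_cont; apply FC).
    rewrite <- (RInt_Chasles (F N) (- (d / 2)) (d / 2) (/ 2)) by (apply RInt_ex_cont; apply FC).
    unfold plus; simpl.
    assert (I1 : B1 <= RInt (F N) (- / 2) (- (d / 2))).
    { apply RInt_le; [lra|apply RInt_ex_cont; apply AC|apply RInt_ex_cont; apply FC|].
      intros x Hx; apply LB; lra. }
    assert (I2 : B2 <= RInt (F N) (d / 2) (/ 2)).
    { apply RInt_le; [lra|apply RInt_ex_cont; apply AC|apply RInt_ex_cont; apply FC|].
      intros x Hx; apply LB; lra. }
    assert (I3 : d * (D 0 / 2 * (1 + INR N * eta)) <= RInt (F N) (- (d / 2)) (d / 2)).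
    { replace (d * (D 0 / 2 * (1 + INR N * eta)))
        with (RInt (fun _ => D 0 / 2 * (1 + INR N * eta)) (- (d / 2)) (d / 2)).
      - apply RInt_le; [lra|apply ex_RInt_const|apply RInt_ex_cont; apply FC|].
        intros x Hx. unfold F.
        assert (Hx' : Rabs x <= d / 2) by (unfold Rabs; destruct Rcase_abs; lra).
        pose proof (HD x ltac:(lra)).
        assert (1 + INR N * eta <= p x ^ N).
        { eapply Rle_trans; [apply poly; exact Heta|]. apply pow_incr.
          split; [lra|apply P3; assumption]. }
        pose proof (pos_INR N).
        apply Rmult_le_compat; try lra. nra.
      - rewrite RInt_const. unfold scal; simpl; unfold mult; simpl. field. }
    lra. }
  destruct (INR_unbounded (- (B1 + B2) / (d * (D 0 / 2) * eta))) as [N HN].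
  specialize (K N).
  apply (Rmult_lt_compat_r (d * (D 0 / 2) * eta)) in HN;
    [|apply Rmult_lt_0_compat; [apply Rmult_lt_0_compat|]; lra].
  unfold Rdiv in HN at 1. rewrite Rmult_assoc, Rinv_l in HN; [nra|].
  apply Rgt_not_eq. apply Rmult_lt_0_compat; [apply Rmult_lt_0_compat|]; lra.
Qed.

Lemma fourier_null_zero (D : R -> R) :
  (forall x, continuous D x) -> fourier_null D -> D 0 = 0.
Proof.
  intros Hc Hz. apply Rle_antisym; [apply fourier_null_nonpos; assumption|].
  assert (A : (fun x => - D x) 0 <= 0); [|simpl in A; lra].
  apply (fourier_null_nonpos (fun x => - D x)).
  - intros x. apply (continuous_opp (K := R_AbsRing) (V := R_NormedModule)); auto.
  - intros j phi.
    transitivity (opp (RInt (fun x => D x * cos (2 * PI * IZR j * x + phi)) (- / 2) (/ 2))).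
    + rewrite <- (RInt_opp (V := R_CompleteNormedModule)).
      * apply RInt_ext. intros; unfold opp; simpl; ring.
      * apply RInt_ex_cont. intros x. apply (continuous_mult D); [auto|cont].
    + rewrite Hz. unfold opp; simpl; ring.
Qed.

Lemma RInt_cos_int (n : Z) (a : R) :
  RInt (fun x => cos (2 * PI * IZR n * x + a)) (- / 2) (/ 2)
  = if Z.eq_dec n 0 then cos a else 0.
Proof.
  pose proof PI_RGT_0 as Hpi.
  destruct (Z.eq_dec n 0) as [->|Hn].
  - rewrite (RInt_ext _ (fun _ => cos a)); [|intros; f_equal; ring].
    rewrite RInt_const. unfold scal; simpl; unfold mult; simpl. field.
  - assert (Hn' : IZR n <> 0) by (intro E; apply Hn; apply eq_IZR; exact E).
    apply is_RInt_unique.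
    replace 0 with (minus (sin (2 * PI * IZR n * (/ 2) + a) / (2 * PI * IZR n))
                          (sin (2 * PI * IZR n * (- / 2) + a) / (2 * PI * IZR n))).
    + apply (is_RInt_derive (fun x => sin (2 * PI * IZR n * x + a) / (2 * PI * IZR n))).
      * intros x _. auto_derive; [auto|]. field. split; lra.
      * intros x _. cont.
    + unfold minus, plus, opp; simpl.
      replace (2 * PI * IZR n * / 2 + a)
        with (2 * PI * IZR n * - / 2 + a + 2 * PI * IZR n) by field.
      rewrite (sin_plus _ (2 * PI * IZR n)), cos_2kpi, sin_2kpi. field. split; lra.
Qed.

(** * The error function and the Gaussian Fourier transform *)

Lemma exp_le (x y : R) : x <= y -> exp x <= exp y.
Proof. intros [H| ->]; [left; apply exp_increasing; exact H|right; reflexivity]. Qed.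

Lemma gauss_lin_le_exp (c d A : R) : 0 < c -> exists C, 0 < C /\
  forall (b : Z) x, Rabs x <= A ->
    exp (- c * (x + IZR b) ^ 2 + d * IZR b) <= C * exp (- Rabs (IZR b)).
Proof.
  intros Hc. set (e := Rabs d + 1). assert (He : 1 <= e) by (pose proof (Rabs_pos d); unfold e; lra).
  (* As |d| = e - 1, one unit of e is left for the decay exp(-|b|). The term e^2 / (4c) is the
     maximum of e y - c y^2, and e A pays for passing from |x + b| to |b|. *)
  exists (exp (e * A + e ^ 2 / (4 * c))). split; [apply exp_pos|]. intros b x Hx.
  rewrite <- exp_plus. apply exp_le.
  assert (H1 : Rabs (IZR b) <= Rabs (x + IZR b) + A).
  { replace (IZR b) with ((x + IZR b) + - x) at 1 by ring.
    eapply Rle_trans; [apply Rabs_triang|]. rewrite Rabs_Ropp. lra. }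
  assert (H3 : d * IZR b <= (e - 1) * Rabs (IZR b)).
  { unfold e. replace (Rabs d + 1 - 1) with (Rabs d) by ring.
    rewrite <- Rabs_mult. apply Rle_abs. }
  rewrite <- (pow2_abs (x + IZR b)). set (y := Rabs (x + IZR b)) in *.
  assert (H2 : 0 <= c * (y - e / (2 * c)) ^ 2) by (apply Rmult_le_pos; [lra|apply pow2_ge_0]).
  replace (c * (y - e / (2 * c)) ^ 2) with (c * y ^ 2 - e * y + e ^ 2 / (4 * c)) in H2 by (field; lra).
  assert (H4 : e * Rabs (IZR b) <= e * (y + A)) by (apply Rmult_le_compat_l; lra).
  lra.
Qed.

Lemma gauss_le_exp (c A : R) : 0 < c -> exists C, 0 < C /\
  forall (b : Z) x, Rabs x <= A -> exp (- c * (x + IZR b) ^ 2) <= C * exp (- Rabs (IZR b)).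
Proof.
  intros Hc. destruct (gauss_lin_le_exp c 0 A Hc) as [C [HC H]]. exists C; split; [assumption|].
  intros b x Hx. specialize (H b x Hx). rewrite Rmult_0_l, Rplus_0_r in H. exact H.
Qed.

Lemma Erf_derive x : is_derive Erf x (2 * exp (- PI * x ^ 2)).
Proof.
  unfold Erf.
  apply (is_derive_scal (fun x => RInt (fun u => exp (- PI * u ^ 2)) 0 x)).
  apply (is_derive_RInt (fun u => exp (- PI * u ^ 2)) _ 0).
  - exists (mkposreal 1 Rlt_0_1). intros y _. apply (@RInt_correct R_CompleteNormedModule).
    apply RInt_ex_cont. intros; cont.
  - cont.
Qed.

Lemma Erf_diff a b : is_RInt (fun u => 2 * exp (- PI * u ^ 2)) a b (Erf b - Erf a).
Proof.
  apply (is_RInt_derive Erf); intros x _; [apply Erf_derive|cont].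
Qed.

Lemma Erf_0 : Erf 0 = 0.
Proof. unfold Erf. rewrite RInt_point. unfold zero; simpl. ring. Qed.

Lemma Erf_le a b : a <= b -> Erf a <= Erf b.
Proof.
  intros H. pose proof (is_RInt_ge_0 _ a b _ H (Erf_diff a b)) as P.
  assert (0 <= Erf b - Erf a); [|lra].
  apply P. intros x _. pose proof (exp_pos (- PI * x ^ 2)); lra.
Qed.

Lemma Erf_opp x : Erf (- x) = - Erf x.
Proof.
  assert (A : is_RInt (fun u => 2 * exp (- PI * u ^ 2)) 0 x (- (Erf (- x) - Erf 0))).
  { apply is_RInt_ext with (fun u => opp (opp (2 * exp (- PI * (- u) ^ 2)))).
    - intros u _. unfold opp; simpl. rewrite Ropp_involutive. do 2 f_equal. ring.
    - apply (is_RInt_opp (V := R_NormedModule)).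
      apply (is_RInt_comp_opp (V := R_NormedModule) (fun u => 2 * exp (- PI * u ^ 2))).
      rewrite Ropp_0. apply Erf_diff. }
  assert (B := Erf_diff 0 x).
  apply (is_RInt_unique (V := R_CompleteNormedModule)) in A; apply (is_RInt_unique (V := R_CompleteNormedModule)) in B. rewrite A, Erf_0 in B. lra.
Qed.

Lemma Erf_bounded x : Erf x <= 2 * exp 1.
Proof.
  destruct (Rle_dec 0 x) as [h|h].
  (* The crude majorant 2 exp(1 - u) is enough to get a finite limit; its value is found later. *)
  - assert (P : is_RInt (fun u => 2 * exp (1 - u)) 0 x (- 2 * exp (1 - x) - - 2 * exp (1 - 0))).
    { apply (is_RInt_derive (fun u => - 2 * exp (1 - u))); intros u _; [|cont].
      auto_derive; [auto|unfold Rminus; ring]. }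
    assert (Q := is_RInt_le _ _ 0 x _ _ h (Erf_diff 0 x) P).
    rewrite Erf_0, Rminus_0_r, Rminus_0_r in Q.
    pose proof (exp_pos (1 - x)).
    assert (Erf x <= -2 * exp (1 - x) - -2 * exp 1); [|lra].
    apply Q. intros u Hu. apply Rmult_le_compat_l; [lra|]. apply exp_le.
    pose proof PI2_1. unfold PI2 in *.
    pose proof (pow2_ge_0 (u - / 2)). nra.
  - pose proof (Erf_le x 0 ltac:(lra)). rewrite Erf_0 in *. pose proof (exp_pos 1). lra.
Qed.

(** [K] is the normalisation of the Gaussian integral, carried as an unknown until [Erf_lim]
    determines it. *)
Definition ErfLim (K : R) : Prop := (forall x, Erf x <= K) /\
  forall eps, 0 < eps -> exists X, forall x, X <= x -> K - eps <= Erf x.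

Lemma Erf_lim_ex : exists K, ErfLim K.
Proof.
  destruct (completeness (fun y => exists x, y = Erf x)) as [K [Hu Hl]].
  - exists (2 * exp 1). intros y [x ->]. apply Erf_bounded.
  - exists (Erf 0), 0; reflexivity.
  - exists K; split; [intros x; apply Hu; exists x; reflexivity|].
    intros eps He. destruct (classic (exists X, K - eps < Erf X)) as [[X HX]|H].
    + exists X. intros x Hx. pose proof (Erf_le X x Hx). lra.
    + exfalso. assert (K <= K - eps); [|lra]. apply Hl. intros y [x ->].
      apply Rnot_lt_le. intro. apply H; exists x; assumption.
Qed.

(** The real part of exp(- pi u^2 / t + 2 pi i xi u + i th). The phases 0 and - pi / 2 will give
    real and imaginary parts. *)
Definition gwave (t xi th u : R) : R := exp (- PI * u ^ 2 / t) * cos (2 * PI * xi * u + th).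

Lemma gwave_cont t xi th u : 0 < t -> continuous (gwave t xi th) u.
Proof. intros; unfold gwave; cont. Qed.

(** Differentiation under the integral brings out - 2 pi u exp(- pi u^2 / t), which is t times a
    derivative in u. Integration by parts then gives the linear differential equation of the
    Gaussian transform, with boundary terms because the interval is finite. *)
Lemma gwave_RInt_derive (t th A B xi : R) : 0 < t ->
  is_derive (fun xi => RInt (gwave t xi th) A B) xi
    (t * (exp (- PI * B ^ 2 / t) * sin (2 * PI * xi * B + th)
        - exp (- PI * A ^ 2 / t) * sin (2 * PI * xi * A + th))
     - 2 * PI * t * xi * RInt (gwave t xi th) A B).
Proof.
  intros Ht.
  set (dg := fun xi u => - 2 * PI * u * exp (- PI * u ^ 2 / t) * sin (2 * PI * xi * u + th)).
  assert (E : forall x u, is_derive (fun z => gwave t z th u) x (dg x u)).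
  { intros x u. unfold gwave, dg. auto_derive; [auto|]. simpl; ring. }
  assert (J : RInt (dg xi) A B = t * (exp (- PI * B ^ 2 / t) * sin (2 * PI * xi * B + th)
        - exp (- PI * A ^ 2 / t) * sin (2 * PI * xi * A + th))
     - 2 * PI * t * xi * RInt (gwave t xi th) A B).
  { assert (P := is_RInt_derive (V := R_CompleteNormedModule)
      (fun u => t * exp (- PI * u ^ 2 / t) * sin (2 * PI * xi * u + th))
      (fun u => dg xi u + 2 * PI * t * xi * gwave t xi th u) A B).
    assert (Q : is_RInt (fun u => dg xi u + 2 * PI * t * xi * gwave t xi th u) A B
       (t * exp (- PI * B ^ 2 / t) * sin (2 * PI * xi * B + th)
        - t * exp (- PI * A ^ 2 / t) * sin (2 * PI * xi * A + th))).
    { apply P.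
      - intros u _. unfold dg, gwave. auto_derive; [auto|]. simpl. unfold Rdiv. field. lra.
      - intros u _. unfold dg, gwave. cont. }
    assert (Q1 : is_RInt (dg xi) A B (RInt (dg xi) A B)).
    { apply (@RInt_correct R_CompleteNormedModule). apply RInt_ex_cont. intros; unfold dg; cont. }
    assert (Q2 : is_RInt (fun u => 2 * PI * t * xi * gwave t xi th u) A B
       (2 * PI * t * xi * RInt (gwave t xi th) A B)).
    { apply (is_RInt_scal (V := R_NormedModule)). apply (@RInt_correct R_CompleteNormedModule).
      apply RInt_ex_cont. intros; apply gwave_cont; assumption. }
    assert (Q3 := is_RInt_plus (V := R_NormedModule) _ _ _ _ _ _ Q1 Q2).
    apply (is_RInt_unique (V := R_CompleteNormedModule)) in Q. apply (is_RInt_unique (V := R_CompleteNormedModule)) in Q3. unfold plus in Q3; simpl in Q3.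
    rewrite Q3 in Q. lra. }
  rewrite <- J.
  replace (RInt (dg xi) A B) with (RInt (fun u => Derive (fun z => gwave t z th u) xi) A B).
  2: { apply RInt_ext. intros u _. apply is_derive_unique. apply E. }
  apply (is_derive_RInt_param (fun xi u => gwave t xi th u)).
  - exists (mkposreal 1 Rlt_0_1). intros y _ u _. eexists; apply E.
  - intros u _. apply continuity_2d_pt_ext with dg.
    { intros x v. symmetry. apply is_derive_unique. apply E. }
    apply (continuity_2d_pt_mult (fun _ v => - 2 * PI * v * exp (- PI * v ^ 2 / t))
      (fun x v => sin (2 * PI * x * v + th))).
    + apply (continuity_1d_2d_pt_comp (fun v => - 2 * PI * v * exp (- PI * v ^ 2 / t)) (fun _ v => v)).
      * apply continuity_pt_filterlim.
        change (continuous (fun v => - 2 * PI * v * exp (- PI * v ^ 2 / t)) u). cont.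
      * apply continuity_2d_pt_id2.
    + apply (continuity_1d_2d_pt_comp sin (fun x v => 2 * PI * x * v + th)).
      * apply continuity_sin.
      * apply continuity_2d_pt_plus; [|apply continuity_2d_pt_const].
        apply continuity_2d_pt_mult; [|apply continuity_2d_pt_id2].
        apply continuity_2d_pt_mult; [apply continuity_2d_pt_const|apply continuity_2d_pt_id1].
  - exists (mkposreal 1 Rlt_0_1). intros y _. apply RInt_ex_cont.
    intros; apply gwave_cont; assumption.
Qed.

(** The integrating factor exp(pi t xi^2) removes the linear term from the derivative in xi. Only
    the boundary terms remain, and the mean value theorem bounds their effect. *)
Lemma gwave_RInt_bound (t th A B xi : R) : 0 < t ->
  Rabs (RInt (gwave t xi th) A B * exp (PI * t * xi ^ 2) - RInt (gwave t 0 th) A B)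
  <= t * (exp (- PI * B ^ 2 / t) + exp (- PI * A ^ 2 / t)) * exp (PI * t * xi ^ 2) * Rabs xi.
Proof.
  intros Ht.
  set (S := fun x => exp (- PI * B ^ 2 / t) * sin (2 * PI * x * B + th)
        - exp (- PI * A ^ 2 / t) * sin (2 * PI * x * A + th)).
  set (h := fun x => RInt (gwave t x th) A B * exp (PI * t * x ^ 2)).
  assert (D : forall x, is_derive h x (t * S x * exp (PI * t * x ^ 2))).
  { intros x. unfold h.
    replace (t * S x * exp (PI * t * x ^ 2)) with
      ((t * S x - 2 * PI * t * x * RInt (gwave t x th) A B) * exp (PI * t * x ^ 2)
        + RInt (gwave t x th) A B * (2 * PI * t * x * exp (PI * t * x ^ 2))) by ring.
    apply (is_derive_mult (fun x => RInt (gwave t x th) A B) (fun x => exp (PI * t * x ^ 2))).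
    - apply gwave_RInt_derive; assumption.
    - auto_derive; [auto|simpl; ring].
    - intros; apply Rmult_comm. }
  destruct (MVT_gen h 0 xi (fun x => t * S x * exp (PI * t * x ^ 2))) as [c [Hc E]].
  - intros x _; apply D.
  - intros x _. apply continuity_pt_filterlim.
    apply (ex_derive_continuous (K := R_AbsRing) (V := R_NormedModule)). eexists; apply D.
  - replace (RInt (gwave t 0 th) A B) with (h 0).
    + fold (h xi). rewrite E, Rminus_0_r, !Rabs_mult.
      apply Rmult_le_compat_r; [apply Rabs_pos|].
      rewrite (Rabs_right t) by lra. rewrite (Rabs_right (exp _)) by (left; apply exp_pos).
      apply Rmult_le_compat.
      * apply Rmult_le_pos; [lra|apply Rabs_pos].
      * left; apply exp_pos.
      * apply Rmult_le_compat_l; [lra|]. unfold S.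
        pose proof (exp_pos (- PI * B ^ 2 / t)). pose proof (exp_pos (- PI * A ^ 2 / t)).
        pose proof (SIN_bound (2 * PI * c * B + th)). pose proof (SIN_bound (2 * PI * c * A + th)).
        apply Rabs_le. nra.
      * apply exp_le. apply Rmult_le_compat_l; [pose proof PI_RGT_0; nra|].
        revert Hc. unfold Rmin, Rmax. destruct Rle_dec; nra.
    + unfold h. rewrite (pow_i 2) by lia. rewrite Rmult_0_r, exp_0. ring.
Qed.

Lemma gwave_RInt_0 (t th A B : R) : 0 < t ->
  RInt (gwave t 0 th) A B = cos th * (sqrt t / 2) * (Erf (B / sqrt t) - Erf (A / sqrt t)).
Proof.
  intros Ht. assert (Hs : 0 < sqrt t) by (apply sqrt_lt_R0; assumption).
  apply is_RInt_unique.
  apply (is_RInt_ext (fun u => scal (cos th * sqrt t / 2)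
    (scal (/ sqrt t) (2 * exp (- PI * (/ sqrt t * u + 0) ^ 2))))).
  - intros u _. unfold scal; simpl; unfold mult; simpl. unfold gwave.
    replace (- PI * ((/ sqrt t * u + 0) * ((/ sqrt t * u + 0) * 1))) with (- PI * (u * (u * 1)) / t).
    + replace (2 * PI * 0 * u + th) with th by ring. simpl. field. lra.
    + rewrite <- (sqrt_sqrt t) at 1 by lra. field. lra.
  - replace (cos th * (sqrt t / 2) * (Erf (B / sqrt t) - Erf (A / sqrt t))) with
      (scal (cos th * sqrt t / 2) (Erf (B / sqrt t) - Erf (A / sqrt t)))
      by (unfold scal; simpl; unfold mult; simpl; field).
    apply (is_RInt_scal (V := R_NormedModule)).
    apply (is_RInt_comp_lin (V := R_NormedModule) (fun u => 2 * exp (- PI * u ^ 2))).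
    replace (/ sqrt t * A + 0) with (A / sqrt t) by (field; lra).
    replace (/ sqrt t * B + 0) with (B / sqrt t) by (field; lra).
    apply Erf_diff.
Qed.

Lemma gwave_RInt_lim (K t xi th : R) : ErfLim K -> 0 < t ->
  forall eps, 0 < eps -> exists X, forall A B, A <= - X -> X <= B ->
  Rabs (RInt (gwave t xi th) A B - K * sqrt t * exp (- PI * t * xi ^ 2) * cos th) <= eps.
Proof.
  intros [HK1 HK2] Ht eps He.
  assert (Hs : 0 < sqrt t) by (apply sqrt_lt_R0; assumption).
  destruct (HK2 (eps / (2 * sqrt t))) as [X1 HX1]; [apply Rdiv_lt_0_compat; lra|].
  set (Q := t * exp (PI * t * xi ^ 2) * Rabs xi).
  assert (HQ : 0 <= Q).
  { apply Rmult_le_pos; [|apply Rabs_pos]. apply Rmult_le_pos; [lra|left; apply exp_pos]. }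
  (* The first threshold brings [Erf] close to its limits at both ends; the other two make the
     boundary Gaussians small through exp y >= 1 + y. *)
  exists (Rmax (sqrt t * X1) (Rmax 1 (4 * t * (Q + 1) / eps))). intros A B HA HB.
  set (X2 := 4 * t * (Q + 1) / eps) in *.
  pose proof (Rmax_l (sqrt t * X1) (Rmax 1 X2)). pose proof (Rmax_r (sqrt t * X1) (Rmax 1 X2)).
  pose proof (Rmax_l 1 X2). pose proof (Rmax_r 1 X2).
  assert (T : forall Y, 1 <= Y -> X2 <= Y -> exp (- PI * Y ^ 2 / t) <= eps / (4 * (Q + 1))).
  { intros Y H1Y H2Y. pose proof PI2_1. unfold PI2 in *.
    replace (- PI * Y ^ 2 / t) with (- (PI * Y ^ 2 / t)) by (field; lra).
    assert (P1 : Y / t <= PI * Y ^ 2 / t).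
    { apply Rmult_le_compat_r; [left; apply Rinv_0_lt_compat; lra|nra]. }
    assert (P2 : 4 * (Q + 1) / eps <= Y / t).
    { apply Rmult_le_reg_r with t; [lra|]. unfold Rdiv at 2. rewrite Rmult_assoc, Rinv_l by lra.
      unfold X2 in H2Y. lra. }
    pose proof (exp_ineq1_le (PI * Y ^ 2 / t)).
    rewrite exp_Ropp.
    replace (eps / (4 * (Q + 1))) with (/ (4 * (Q + 1) / eps)) by (field; lra).
    apply Rinv_le_contravar; [apply Rdiv_lt_0_compat; lra|lra]. }
  assert (TB := T B ltac:(lra) ltac:(lra)).
  assert (TA := T (- A) ltac:(lra) ltac:(lra)).
  replace ((- A) ^ 2) with (A ^ 2) in TA by ring.
  pose proof (gwave_RInt_bound t th A B xi Ht) as G.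
  rewrite (gwave_RInt_0 t th A B Ht) in G.
  assert (EB := HX1 (B / sqrt t) ltac:(apply Rmult_le_reg_r with (sqrt t); [lra|];
    unfold Rdiv; rewrite Rmult_assoc, Rinv_l by lra; lra)).
  assert (EA := HX1 (- A / sqrt t) ltac:(apply Rmult_le_reg_r with (sqrt t); [lra|];
    unfold Rdiv; rewrite Rmult_assoc, Rinv_l by lra; lra)).
  replace (- A / sqrt t) with (- (A / sqrt t)) in EA by (field; lra).
  rewrite Erf_opp in EA.
  pose proof (HK1 (B / sqrt t)). pose proof (HK1 (- (A / sqrt t))) as HKA. rewrite Erf_opp in HKA.
  set (W := RInt (gwave t xi th) A B) in *.
  set (V := cos th * (sqrt t / 2) * (Erf (B / sqrt t) - Erf (A / sqrt t))) in *.
  assert (H5 : Rabs (V - K * sqrt t * cos th) <= eps / 2).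
  { replace (V - K * sqrt t * cos th) with
      (cos th * ((sqrt t / 2) * (Erf (B / sqrt t) - Erf (A / sqrt t) - 2 * K)))
      by (unfold V; field).
    rewrite Rabs_mult.
    apply Rle_trans with (1 * (eps / 2)); [|lra].
    apply Rmult_le_compat; try apply Rabs_pos.
    - apply Rabs_le; apply COS_bound.
    - rewrite Rabs_mult, (Rabs_right (sqrt t / 2)) by lra. rewrite Rabs_left1 by lra.
      apply Rle_trans with (sqrt t / 2 * (2 * (eps / (2 * sqrt t)))).
      + apply Rmult_le_compat_l; lra.
      + right; field; lra. }
  assert (H6 : Rabs (W * exp (PI * t * xi ^ 2) - V) <= eps / 2).
  { eapply Rle_trans; [exact G|].
    apply Rle_trans with (Q * (2 * (eps / (4 * (Q + 1))))).
    - replace (t * (exp (- PI * B ^ 2 / t) + exp (- PI * A ^ 2 / t)) * exp (PI * t * xi ^ 2) * Rabs xi)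
        with (Q * (exp (- PI * B ^ 2 / t) + exp (- PI * A ^ 2 / t))) by (unfold Q; ring).
      apply Rmult_le_compat_l; lra.
    - apply Rmult_le_reg_r with (4 * (Q + 1)); [lra|]. field_simplify; [|lra]. nra. }
  assert (H7 : exp (- PI * t * xi ^ 2) * exp (PI * t * xi ^ 2) = 1).
  { rewrite <- exp_plus. replace (_ + _) with 0 by ring. apply exp_0. }
  assert (H8 : exp (- PI * t * xi ^ 2) <= 1).
  { rewrite <- exp_0. apply exp_le. pose proof PI_RGT_0. pose proof (pow2_ge_0 xi).
    assert (0 <= PI * t * xi ^ 2) by (apply Rmult_le_pos; [apply Rmult_le_pos|]; lra). lra. }
  pose proof (exp_pos (- PI * t * xi ^ 2)).
  replace (W - _) with (exp (- PI * t * xi ^ 2) *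
    ((W * exp (PI * t * xi ^ 2) - V) + (V - K * sqrt t * cos th))).
  - rewrite Rabs_mult, (Rabs_right (exp _)) by lra.
    apply Rle_trans with (1 * eps); [|lra].
    apply Rmult_le_compat; try apply Rabs_pos; try lra.
    eapply Rle_trans; [apply Rabs_triang|]. lra.
  - transitivity (W * (exp (- PI * t * xi ^ 2) * exp (PI * t * xi ^ 2))
      - K * sqrt t * exp (- PI * t * xi ^ 2) * cos th); [ring|]. rewrite H7; ring.
Qed.

Fixpoint zrange (n : nat) : list Z :=
  match n with
  | O => (0 :: nil)%Z
  | S n' => (Z.of_nat n :: (- Z.of_nat n)%Z :: zrange n')
  end.

Lemma in_zrange n x : In x (zrange n) <-> (Z.abs x <= Z.of_nat n)%Z.
Proof. induction n as [|n IH]; simpl In; [lia|]. rewrite IH. lia. Qed.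

Lemma NoDup_zrange n : NoDup (zrange n).
Proof.
  induction n as [|n IH]; simpl zrange.
  - repeat constructor. intros [].
  - constructor; [|constructor; [|assumption]].
    + intros [H|H]; [lia|]. apply in_zrange in H; lia.
    + intros H; apply in_zrange in H; lia.
Qed.

(** The unit intervals tile the line, so symmetric partial sums collapse to one integral over a
    growing interval. Summability is proved first, so these particular partial sums determine the
    value. *)
Lemma gwave_sum_RInt (K t xi th x0 : R) : ErfLim K -> 0 < t ->
  hsR (fun b : Z => RInt (gwave t xi th) (x0 + IZR b - / 2) (x0 + IZR b + / 2))
    (K * sqrt t * exp (- PI * t * xi ^ 2) * cos th).
Proof.
  intros HK Ht.
  assert (Hc : forall a b, ex_RInt (gwave t xi th) a b).
  { intros; apply RInt_ex_cont; intros; apply gwave_cont; assumption. }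
  assert (E : asum (fun b : Z => RInt (gwave t xi th) (x0 + IZR b - / 2) (x0 + IZR b + / 2))).
  { pose proof PI_RGT_0.
    destruct (gauss_le_exp (PI / t) (Rabs x0 + 1)) as [C [HC1 HC2]];
      [apply Rdiv_lt_0_compat; lra|].
    apply asum_le with (fun b => C * exp (- Rabs (IZR b)));
      [|apply asum_scal, asum_expZ].
    intros b. rewrite <- (Rmult_1_l (C * _)).
    replace 1 with ((x0 + IZR b + / 2) - (x0 + IZR b - / 2)) by field.
    apply abs_RInt_le_const; [lra|apply Hc|].
    intros u Hu. unfold gwave. rewrite Rabs_mult, (Rabs_right (exp _)) by (left; apply exp_pos).
    pose proof (exp_pos (- PI * u ^ 2 / t)).
    apply Rle_trans with (exp (- PI * u ^ 2 / t) * 1).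
    - apply Rmult_le_compat_l; [lra|]. apply Rabs_le, COS_bound.
    - rewrite Rmult_1_r.
      specialize (HC2 b (u - IZR b)).
      replace (- (PI / t) * (u - IZR b + IZR b) ^ 2) with (- PI * u ^ 2 / t) in HC2 by (field; lra).
      apply HC2. unfold Rabs; repeat destruct Rcase_abs; lra. }
  destruct (hsR_exists _ E) as [L HL].
  replace (K * _ * _ * _) with L; [assumption|].
  apply cond_eq. intros eps He.
  destruct (HL (eps / 4)) as [s0 Hs0]; [lra|].
  destruct (gwave_RInt_lim K t xi th HK Ht (eps / 4)) as [X HX]; [lra|].
  assert (N0 : exists N : nat, incl s0 (zrange N)).
  { clear. induction s0 as [|a s [N HN]]; [exists O; intros x []|].
    exists (N + Z.to_nat (Z.abs a))%nat. intros x [<-|Hx]; apply in_zrange; [lia|].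
    apply HN in Hx. apply in_zrange in Hx. lia. }
  destruct N0 as [N1 HN1]. destruct (INR_unbounded (Rabs x0 + Rabs X)) as [N2 HN2].
  set (N := (N1 + N2)%nat).
  assert (A1 := Hs0 (zrange N) (NoDup_zrange N)
    ltac:(intros x Hx; apply HN1 in Hx; apply in_zrange in Hx; apply in_zrange; unfold N; lia)).
  assert (S : forall n, lsum (fun b : Z => RInt (gwave t xi th) (x0 + IZR b - / 2) (x0 + IZR b + / 2))
      (zrange n) = RInt (gwave t xi th) (x0 - INR n - / 2) (x0 + INR n + / 2)).
  { induction n as [|n IH].
    - simpl. rewrite Rplus_0_r. f_equal; ring.
    - change (zrange (S n)) with (Z.of_nat (S n) :: (- Z.of_nat (S n))%Z :: zrange n).
      cbn [lsum]. rewrite IH, opp_IZR, <- INR_IZR_INZ.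
      rewrite <- (RInt_Chasles _ (x0 - INR (S n) - / 2) (x0 - INR n - / 2) (x0 + INR (S n) + / 2)) by auto.
      rewrite <- (RInt_Chasles _ (x0 - INR n - / 2) (x0 + INR n + / 2) (x0 + INR (S n) + / 2)) by auto.
      unfold plus; simpl plus.
      replace (x0 + INR (S n) - / 2) with (x0 + INR n + / 2) by (rewrite S_INR; field).
      replace (x0 + - INR (S n) + / 2) with (x0 - INR n - / 2) by (rewrite S_INR; field).
      replace (x0 + - INR (S n) - / 2) with (x0 - INR (S n) - / 2) by ring.
      simpl. ring. }
  rewrite S in A1.
  assert (HN : INR N1 + INR N2 = INR N) by (unfold N; rewrite plus_INR; reflexivity).
  pose proof (pos_INR N1).
  assert (A2 := HX (x0 - INR N - / 2) (x0 + INR N + / 2)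
    ltac:(revert HN2; unfold Rabs; repeat destruct Rcase_abs; lra)
    ltac:(revert HN2; unfold Rabs; repeat destruct Rcase_abs; lra)).
  revert A1 A2. unfold Rabs; repeat destruct Rcase_abs; intros; lra.
Qed.

(** * Theta inversion *)

Lemma normal_family_gwave (t al th x0 : R) : 0 < t ->
  normal_family (fun (b : Z) x => gwave t al th (x0 + x + IZR b)).
Proof.
  intros Ht. split.
  - intros b x. unfold gwave. cont.
  - intros A. destruct (gauss_le_exp (PI / t) (Rabs x0 + A)) as [C [HC1 HC2]].
    { apply Rdiv_lt_0_compat; [apply PI_RGT_0|assumption]. }
    exists (fun b => C * exp (- Rabs (IZR b))). split; [apply asum_scal, asum_expZ|].
    intros b x Hx. eapply Rle_trans; [|apply (HC2 b (x0 + x));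
      eapply Rle_trans; [apply Rabs_triang|lra]].
    unfold gwave. rewrite Rabs_mult, (Rabs_right (exp _)) by (left; apply exp_pos).
    replace (- PI * (x0 + x + IZR b) ^ 2 / t) with (- (PI / t) * (x0 + x + IZR b) ^ 2)
      by (field; lra).
    rewrite <- (Rmult_1_r (exp _)) at 2.
    apply Rmult_le_compat_l; [left; apply exp_pos|]. apply Rabs_le, COS_bound.
Qed.

(** Up to the factor K, term k of the Fourier series of the periodised [gwave t al th]: the
    transform of the Gaussian at the frequency al - k. *)
Definition fwave (t al th : R) (k : Z) (x : R) : R :=
  sqrt t * exp (- PI * t * (IZR k - al) ^ 2) * cos (2 * PI * IZR k * x + th).

Lemma normal_family_fwave (t al th x0 : R) : 0 < t ->
  normal_family (fun (k : Z) x => fwave t al th k (x0 + x)).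
Proof.
  intros Ht. split.
  - intros k x. unfold fwave. cont.
  - intros A. destruct (gauss_le_exp (PI * t) (Rabs al)) as [C [HC1 HC2]].
    { apply Rmult_lt_0_compat; [apply PI_RGT_0|assumption]. }
    exists (fun b => sqrt t * (C * exp (- Rabs (IZR b)))).
    split; [apply asum_scal, asum_scal, asum_expZ|].
    intros k x Hx. unfold fwave. rewrite !Rabs_mult, (Rabs_right (exp _)) by (left; apply exp_pos).
    rewrite (Rabs_right (sqrt t)) by (apply Rle_ge, sqrt_pos).
    rewrite Rmult_assoc. apply Rmult_le_compat_l; [apply sqrt_pos|].
    eapply Rle_trans; [|apply (HC2 k (- al)); rewrite Rabs_Ropp; lra].
    replace (- PI * t * (IZR k - al) ^ 2) with (- (PI * t) * (- al + IZR k) ^ 2) by ring.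
    rewrite <- (Rmult_1_r (exp _)) at 2.
    apply Rmult_le_compat_l; [left; apply exp_pos|]. apply Rabs_le, COS_bound.
Qed.

(** Unfolding: integrating the periodisation over one period is integrating the wave over the line,
    and the product of two cosines splits into the frequencies al + j and al - j. *)
Lemma gwave_fourier_coef (K t al th x0 phi : R) (j : Z) : ErfLim K -> 0 < t ->
  RInt (fun x => sumR (fun b : Z => gwave t al th (x0 + x + IZR b))
                 * cos (2 * PI * IZR j * x + phi)) (- / 2) (/ 2)
  = K * (sqrt t * / 2 *
    (exp (- PI * t * (al + IZR j) ^ 2) * cos (th + (phi - 2 * PI * IZR j * x0))
     + exp (- PI * t * (al - IZR j) ^ 2) * cos (th - (phi - 2 * PI * IZR j * x0)))).
Proof.
  intros HK Ht. set (phi' := phi - 2 * PI * IZR j * x0).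
  set (f := fun (b : Z) x => gwave t al th (x0 + x + IZR b) * cos (2 * PI * IZR j * x + phi)).
  assert (Hf : normal_family f).
  { apply (normal_family_mult (fun b x => gwave t al th (x0 + x + IZR b))
      (fun x => cos (2 * PI * IZR j * x + phi))).
    - apply normal_family_gwave; assumption.
    - intros; cont.
    - intros; apply Rabs_le, COS_bound. }
  assert (E : forall x, sumR (fun b : Z => gwave t al th (x0 + x + IZR b))
                 * cos (2 * PI * IZR j * x + phi) = sumR (fun b => f b x)).
  { intros x. symmetry. apply sumR_eq. unfold f.
    rewrite (Rmult_comm (sumR _)). eapply hsR_ext; [|apply hsR_scal;
      apply (normal_family_hsR (fun b y => gwave t al th (x0 + y + IZR b)) x);
      apply normal_family_gwave; assumption].
    intros; simpl; ring. }
  rewrite (RInt_ext _ (fun x => sumR (fun b => f b x))) by (intros; apply E).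
  apply (hsR_unique (fun b => RInt (f b) (- / 2) (/ 2))).
  { apply normal_family_RInt; [lra|assumption]. }
  replace (K * _) with (/ 2 * (K * sqrt t * exp (- PI * t * (al + IZR j) ^ 2) * cos (th + phi')
     + K * sqrt t * exp (- PI * t * (al - IZR j) ^ 2) * cos (th - phi'))) by ring.
  eapply hsR_ext; [|apply hsR_scal, hsR_plus; apply (gwave_sum_RInt K t _ _ x0 HK Ht)].
  intros b. cbv beta.
  set (g := fun u => / 2 * (gwave t (al + IZR j) (th + phi') u + gwave t (al - IZR j) (th - phi') u)).
  assert (Hg : forall A B, is_RInt g A B (/ 2 * (RInt (gwave t (al + IZR j) (th + phi')) A B
     + RInt (gwave t (al - IZR j) (th - phi')) A B))).
  { intros A B. apply (is_RInt_scal (V := R_NormedModule)).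
    apply (is_RInt_plus (V := R_NormedModule)); apply (@RInt_correct R_CompleteNormedModule);
    apply RInt_ex_cont; intros; apply gwave_cont; assumption. }
  symmetry. apply is_RInt_unique.
  apply (is_RInt_ext (fun x => scal 1 (g (1 * x + (x0 + IZR b))))).
  - intros x _. unfold scal; simpl; unfold mult; simpl. rewrite !Rmult_1_l. unfold g, f, gwave.
    replace (x + (x0 + IZR b)) with (x0 + x + IZR b) by ring.
    set (u := x0 + x + IZR b).
    replace (2 * PI * (al + IZR j) * u + (th + phi')) with
      ((2 * PI * al * u + th) + (2 * PI * IZR j * u + phi')) by ring.
    replace (2 * PI * (al - IZR j) * u + (th - phi')) with
      ((2 * PI * al * u + th) - (2 * PI * IZR j * u + phi')) by ring.
    replace (cos (2 * PI * IZR j * x + phi)) with (cos (2 * PI * IZR j * u + phi')).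
    + pose proof (cos_mult_phase (2 * PI * al * u + th) (2 * PI * IZR j * u + phi')) as Q.
      transitivity (exp (- PI * u ^ 2 / t) *
        (cos (2 * PI * al * u + th) * cos (2 * PI * IZR j * u + phi'))); [rewrite Q; ring|ring].
    + replace (2 * PI * IZR j * u + phi') with (2 * PI * IZR j * x + phi + 2 * PI * IZR (j * b)).
      * rewrite (cos_plus _ (2 * PI * IZR (j * b))), cos_2kpi, sin_2kpi. ring.
      * unfold u, phi'. rewrite mult_IZR. ring.
  - apply (is_RInt_comp_lin (V := R_NormedModule) g).
    replace (1 * - / 2 + (x0 + IZR b)) with (x0 + IZR b - / 2) by ring.
    replace (1 * / 2 + (x0 + IZR b)) with (x0 + IZR b + / 2) by ring.
    apply Hg.
Qed.

Lemma hsR_single {I} (i0 : I) (f : I -> R) (v : R) :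
  (forall i, f i = if eqd i i0 then v else 0) -> hsR f v.
Proof.
  intros H. replace v with (lsum f (i0 :: nil)).
  - apply hsR_supp; [repeat constructor; intros []|].
    intros i Hi. rewrite H. destruct (eqd i i0); [|reflexivity].
    subst; exfalso; apply Hi; left; reflexivity.
  - simpl. rewrite H. destruct (eqd i0 i0); [ring|congruence].
Qed.

Lemma fwave_fourier_coef (t al th x0 phi : R) (j : Z) : 0 < t ->
  RInt (fun x => sumR (fun k : Z => fwave t al th k (x0 + x))
                 * cos (2 * PI * IZR j * x + phi)) (- / 2) (/ 2)
  = sqrt t * / 2 *
    (exp (- PI * t * (al + IZR j) ^ 2) * cos (th + (phi - 2 * PI * IZR j * x0))
     + exp (- PI * t * (al - IZR j) ^ 2) * cos (th - (phi - 2 * PI * IZR j * x0))).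
Proof.
  intros Ht.
  set (f := fun (k : Z) x => fwave t al th k (x0 + x) * cos (2 * PI * IZR j * x + phi)).
  assert (Hf : normal_family f).
  { apply (normal_family_mult (fun k x => fwave t al th k (x0 + x))
      (fun x => cos (2 * PI * IZR j * x + phi))).
    - apply normal_family_fwave; assumption.
    - intros; cont.
    - intros; apply Rabs_le, COS_bound. }
  assert (E : forall x, sumR (fun k : Z => fwave t al th k (x0 + x))
                 * cos (2 * PI * IZR j * x + phi) = sumR (fun b => f b x)).
  { intros x. symmetry. apply sumR_eq. unfold f.
    rewrite (Rmult_comm (sumR _)). eapply hsR_ext; [|apply hsR_scal;
      apply (normal_family_hsR (fun k y => fwave t al th k (x0 + y)) x);
      apply normal_family_fwave; assumption].
    intros; simpl; ring. }
  rewrite (RInt_ext _ (fun x => sumR (fun b => f b x))) by (intros; apply E).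
  apply (hsR_unique (fun b => RInt (f b) (- / 2) (/ 2))).
  { apply normal_family_RInt; [lra|assumption]. }
  rewrite Rmult_plus_distr_l.
  set (v1 := sqrt t * / 2 * _). set (v2 := sqrt t * / 2 * (exp (- PI * t * (al - IZR j) ^ 2) * _)).
  (* By orthogonality only k = j and k = - j survive. Two separate indicators stay correct when j =
     0 and the two coincide. *)
  apply hsR_ext with (fun k : Z => (if eqd k (- j)%Z then v1 else 0) + (if eqd k j then v2 else 0)).
  2: { apply hsR_plus; eapply hsR_single; intros; reflexivity. }
  intros k. symmetry.
  set (c := sqrt t * exp (- PI * t * (IZR k - al) ^ 2) * / 2).
  assert (P : is_RInt (f k) (- / 2) (/ 2) (c *
    ((if Z.eq_dec (k + j) 0 then cos (2 * PI * IZR k * x0 + th + phi) else 0)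
     + (if Z.eq_dec (k - j) 0 then cos (2 * PI * IZR k * x0 + th - phi) else 0)))).
  { apply (is_RInt_ext (fun x => scal c (plus
      (cos (2 * PI * IZR (k + j) * x + (2 * PI * IZR k * x0 + th + phi)))
      (cos (2 * PI * IZR (k - j) * x + (2 * PI * IZR k * x0 + th - phi)))))).
    - intros x _. unfold scal, plus; simpl; unfold mult; simpl. unfold f, fwave.
      rewrite plus_IZR, minus_IZR.
      replace (2 * PI * (IZR k + IZR j) * x + (2 * PI * IZR k * x0 + th + phi)) with
        (2 * PI * IZR k * (x0 + x) + th + (2 * PI * IZR j * x + phi)) by ring.
      replace (2 * PI * (IZR k - IZR j) * x + (2 * PI * IZR k * x0 + th - phi)) with
        (2 * PI * IZR k * (x0 + x) + th - (2 * PI * IZR j * x + phi)) by ring.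
      pose proof (cos_mult_phase (2 * PI * IZR k * (x0 + x) + th) (2 * PI * IZR j * x + phi)) as Q.
      rewrite (Rmult_assoc (sqrt t * _)), Q. unfold c. ring.
    - apply (is_RInt_scal (V := R_NormedModule)). apply (is_RInt_plus (V := R_NormedModule)).
      + rewrite <- RInt_cos_int. apply (@RInt_correct R_CompleteNormedModule).
        apply RInt_ex_cont. intros; cont.
      + rewrite <- RInt_cos_int. apply (@RInt_correct R_CompleteNormedModule).
        apply RInt_ex_cont. intros; cont. }
  rewrite (is_RInt_unique (V := R_CompleteNormedModule) _ _ _ _ P). unfold c.
  rewrite Rmult_plus_distr_l. f_equal.
  - destruct (Z.eq_dec (k + j) 0) as [h|h], (eqd k (- j)%Z) as [h'|h']; try lia; [|ring].
    unfold v1. subst k. rewrite opp_IZR.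
    replace (2 * PI * - IZR j * x0 + th + phi) with (th + (phi - 2 * PI * IZR j * x0)) by ring.
    replace ((- IZR j - al) ^ 2) with ((al + IZR j) ^ 2) by ring. ring.
  - destruct (Z.eq_dec (k - j) 0) as [h|h], (eqd k j) as [h'|h']; try lia; [|ring].
    unfold v2. subst k.
    replace (2 * PI * IZR j * x0 + th - phi) with (th - (phi - 2 * PI * IZR j * x0)) by ring.
    replace ((IZR j - al) ^ 2) with ((al - IZR j) ^ 2) by ring. ring.
Qed.

(** Both families carry the base point [x], so it is enough that the difference, all of whose
    Fourier coefficients vanish, is 0 at the origin. *)
Lemma theta_inversion_K (K t al th x : R) : ErfLim K -> 0 < t ->
  sumR (fun b : Z => gwave t al th (x + IZR b)) = K * sumR (fun k : Z => fwave t al th k x).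
Proof.
  intros HK Ht.
  set (G := fun y => sumR (fun b : Z => gwave t al th (x + y + IZR b))).
  set (F := fun y => sumR (fun k : Z => fwave t al th k (x + y))).
  assert (HG : forall y, continuous G y)
    by (intros y; apply (normal_family_continuous (fun b y => gwave t al th (x + y + IZR b)));
        apply normal_family_gwave; assumption).
  assert (HF : forall y, continuous F y)
    by (intros y; apply (normal_family_continuous (fun k y => fwave t al th k (x + y)));
        apply normal_family_fwave; assumption).
  set (D := fun y => G y - K * F y).
  assert (D0 : D 0 = 0).
  { apply fourier_null_zero.
    - intros y. apply (continuous_minus (V := R_NormedModule) G); [auto|].
      apply (continuous_scal_r (V := R_NormedModule) K F); auto.
    - intros j phi. apply is_RInt_unique.
      set (c := fun y => cos (2 * PI * IZR j * y + phi)).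
      apply is_RInt_ext with (fun y => minus (G y * c y) (scal K (F y * c y))).
      { intros y _. unfold minus, plus, opp, scal; simpl; unfold mult; simpl.
        unfold D, c. ring. }
      assert (A : is_RInt (fun y => G y * c y) (- / 2) (/ 2)
        (RInt (fun y => G y * c y) (- / 2) (/ 2))).
      { apply (@RInt_correct R_CompleteNormedModule). apply RInt_ex_cont.
        intros y. apply (continuous_mult G); [auto|unfold c; cont]. }
      assert (B : is_RInt (fun y => F y * c y) (- / 2) (/ 2)
        (RInt (fun y => F y * c y) (- / 2) (/ 2))).
      { apply (@RInt_correct R_CompleteNormedModule). apply RInt_ex_cont.
        intros y. apply (continuous_mult F); [auto|unfold c; cont]. }
      assert (AB := is_RInt_minus (V := R_NormedModule) _ _ _ _ _ _ A
        (is_RInt_scal (V := R_NormedModule) _ _ _ K _ B)).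
      replace 0 with (minus (RInt (fun y => G y * c y) (- / 2) (/ 2))
        (scal K (RInt (fun y => F y * c y) (- / 2) (/ 2)))); [exact AB|].
      unfold G, F, c. rewrite (gwave_fourier_coef K), fwave_fourier_coef by assumption.
      unfold minus, plus, opp, scal; simpl; unfold mult; simpl. ring. }
  unfold D, G, F in D0. rewrite !Rplus_0_r in D0. lra.
Qed.

(* At [t = 1], [al = x = th = 0] both sides of the inversion formula are the same positive
   series, which evaluates the Gaussian integral. *)
Lemma Erf_lim : ErfLim 1.
Proof.
  destruct Erf_lim_ex as [K HK]. replace 1 with K; [exact HK|].
  pose proof (theta_inversion_K K 1 0 0 0 HK Rlt_0_1) as E.
  set (S := sumR (fun k : Z => fwave 1 0 0 k 0)) in E.
  assert (HS : hsR (fun k : Z => fwave 1 0 0 k 0) S).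
  { apply sumR_spec.
    destruct (proj2 (normal_family_fwave 1 0 0 0 Rlt_0_1) 0) as [M [HM HB]].
    apply asum_le with M; [|assumption]. intros k.
    specialize (HB k 0). rewrite Rplus_0_l, Rabs_R0 in HB. apply HB; lra. }
  assert (V : forall k : Z, fwave 1 0 0 k 0 = gwave 1 0 0 (0 + IZR k)).
  { intros k. unfold fwave, gwave. rewrite sqrt_1, Rplus_0_l, Rminus_0_r.
    replace (2 * PI * IZR k * 0 + 0) with 0 by ring.
    replace (2 * PI * 0 * IZR k + 0) with 0 by ring.
    replace (- PI * 1 * IZR k ^ 2) with (- PI * IZR k ^ 2 / 1) by field. ring. }
  rewrite (sumR_eq _ S) in E by (revert HS; apply hsR_ext; exact V).
  (* [E] now reads S = K S, so a positive S gives K = 1. The term k = 0 is 1 and the others are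
     nonnegative. *)
  assert (P : 1 <= S); [|nra].
  destruct (Rle_dec 1 S) as [h|h]; [assumption|exfalso].
  destruct (HS ((1 - S) / 2)) as [s0 H0]; [lra|].
  specialize (H0 (nodup eqd (0%Z :: s0)) (NoDup_nodup _ _)
    ltac:(intros y Hy; apply nodup_In; right; assumption)).
  assert (L : 1 <= lsum (fun k : Z => fwave 1 0 0 k 0) (nodup eqd (0%Z :: s0))).
  { apply Rle_trans with (lsum (fun k : Z => fwave 1 0 0 k 0) (0%Z :: nil)).
    - simpl. unfold fwave. rewrite sqrt_1.
      replace (- PI * 1 * (0 - 0) ^ 2) with 0 by ring.
      replace (2 * PI * 0 * 0 + 0) with 0 by ring. rewrite exp_0, cos_0. lra.
    - apply lsum_incl.
      + intros k. unfold fwave. rewrite sqrt_1.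
        replace (2 * PI * IZR k * 0 + 0) with 0 by ring. rewrite cos_0.
        pose proof (exp_pos (- PI * 1 * (IZR k - 0) ^ 2)). lra.
      + repeat constructor; intros [].
      + intros y [<-|[]]. apply nodup_In; left; reflexivity. }
  revert H0; unfold Rabs; destruct Rcase_abs; intros; lra.
Qed.

Lemma theta_inversion (t al th x : R) : 0 < t ->
  sumR (fun b : Z => gwave t al th (x + IZR b)) = sumR (fun k : Z => fwave t al th k x).
Proof. intros Ht. rewrite (theta_inversion_K 1) by (exact Erf_lim || assumption). ring. Qed.

(** * The one-variable identity *)

Lemma sin_cos_phase x : sin x = cos (x + - (PI / 2)).
Proof. rewrite <- cos_shift, <- cos_neg. f_equal. ring. Qed.

(** The sign occurring in [Rfun], as a function of k = r - s; the value at r = s is + 1. *)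
Definition erf_side (k : Z) : R := if Z_le_dec 0 k then 1 else -1.

(** The [al]-derivative of half of [erf_coef]. *)
Definition gauss_coef (t s al : R) (w : C) (k : Z) : C :=
  (RtoC (sqrt t * exp (- PI * t * (s + IZR k - al) ^ 2)) * cexp (twopii * RtoC (s + IZR k) * w))%C.

Definition erf_coef (t s al : R) (w : C) (k : Z) : C :=
  (RtoC (erf_side k - Erf ((s + IZR k - al) * sqrt t)) * cexp (twopii * RtoC (s + IZR k) * w))%C.

(** The dual side of the inversion. Its [al]-derivative carries the factor 2 pi i (w + b), which
    cancels the denominator w + b of the lattice sum. *)
Definition gauss_shift (t s al : R) (w : C) (b : Z) : C :=
  cexp (- (twopii * RtoC (s * IZR b)) - RtoC (PI / t) * ((w + RtoC (IZR b)) * (w + RtoC (IZR b)))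
        + RtoC al * (twopii * (w + RtoC (IZR b))))%C.

(** Completing the square: for w = x + i y the centre al moves to al - y / t - s, and the factor
    split off is independent of k. The same factor appears in [gauss_shift_parts]. *)
Lemma gauss_coef_parts t s al x y k th : 0 < t ->
  exp (PI * y ^ 2 / t - 2 * PI * al * y) * fwave t (al - y / t - s) (2 * PI * s * x + th) k x
  = sqrt t * exp (- PI * t * (s + IZR k - al) ^ 2) * (exp (- (2 * PI * (s + IZR k) * y))
    * cos (2 * PI * (s + IZR k) * x + th)).
Proof.
  intros Ht. unfold fwave.
  replace (2 * PI * IZR k * x + (2 * PI * s * x + th)) with (2 * PI * (s + IZR k) * x + th) by ring.
  transitivity (sqrt t * (exp (PI * y ^ 2 / t - 2 * PI * al * y)
    * exp (- PI * t * (IZR k - (al - y / t - s)) ^ 2)) * cos (2 * PI * (s + IZR k) * x + th)); [ring|].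
  transitivity (sqrt t * (exp (- PI * t * (s + IZR k - al) ^ 2) * exp (- (2 * PI * (s + IZR k) * y)))
    * cos (2 * PI * (s + IZR k) * x + th)); [|ring].
  rewrite <- !exp_plus. do 3 f_equal. field. lra.
Qed.

Lemma gauss_shift_parts t s al x y b th : 0 < t ->
  exp (PI * y ^ 2 / t - 2 * PI * al * y) * gwave t (al - y / t - s) (2 * PI * s * x + th) (x + IZR b)
  = exp (Re (- (twopii * RtoC (s * IZR b))
        - RtoC (PI / t) * (((x, y) + RtoC (IZR b)) * ((x, y) + RtoC (IZR b)))
        + RtoC al * (twopii * ((x, y) + RtoC (IZR b))))%C)
    * cos (Im (- (twopii * RtoC (s * IZR b))
        - RtoC (PI / t) * (((x, y) + RtoC (IZR b)) * ((x, y) + RtoC (IZR b)))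
        + RtoC al * (twopii * ((x, y) + RtoC (IZR b))))%C + th).
Proof.
  intros Ht. unfold gwave. rewrite <- Rmult_assoc, <- exp_plus, twopii_eq. simpl.
  f_equal; f_equal; field; lra.
Qed.

(** Both families carry the factor [E], so the real inversion formula applies, at phase 0 for the
    real part and at - pi / 2 for the imaginary part. *)
Lemma complex_theta_inversion t s al w : 0 < t ->
  exists L, hs (gauss_coef t s al w) L /\ hs (gauss_shift t s al w) L.
Proof.
  intros Ht. destruct w as [x y].
  set (E := exp (PI * y ^ 2 / t - 2 * PI * al * y)).
  set (F := fun th => sumR (fun k : Z => fwave t (al - y / t - s) (2 * PI * s * x + th) k x)).
  assert (HF : forall th, hsR (fun k => E * fwave t (al - y / t - s) (2 * PI * s * x + th) k x) (E * F th)).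
  { intros th. apply hsR_scal.
    pose proof (normal_family_hsR _ 0 (normal_family_fwave t (al - y / t - s) (2 * PI * s * x + th) x Ht)) as H.
    cbv beta in H. rewrite Rplus_0_r in H. exact H. }
  assert (HG : forall th, hsR (fun b => E * gwave t (al - y / t - s) (2 * PI * s * x + th) (x + IZR b)) (E * F th)).
  { intros th. apply hsR_scal. unfold F. rewrite <- theta_inversion by assumption.
    pose proof (normal_family_hsR _ 0 (normal_family_gwave t (al - y / t - s) (2 * PI * s * x + th) x Ht)) as H.
    cbv beta in H. rewrite Rplus_0_r in H. exact H. }
  exists (E * F 0, E * F (- (PI / 2))). split; split; cbv [Re Im fst snd].
  - eapply hsR_ext; [|exact (HF 0)]. intros k. cbv beta. unfold E. rewrite gauss_coef_parts by assumption.
    unfold gauss_coef, cexp. rewrite twopii_eq. simpl.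
    replace (2 * PI * (s + IZR k) * x + 0) with
      ((0 * (s + IZR k) - 2 * PI * 0) * y + (0 * 0 + 2 * PI * (s + IZR k)) * x) by ring.
    replace (- (2 * PI * (s + IZR k) * y)) with
      ((0 * (s + IZR k) - 2 * PI * 0) * x - (0 * 0 + 2 * PI * (s + IZR k)) * y) by ring.
    ring.
  - eapply hsR_ext; [|exact (HF (- (PI / 2)))]. intros k. cbv beta. unfold E. rewrite gauss_coef_parts by assumption.
    rewrite <- sin_cos_phase.
    unfold gauss_coef, cexp. rewrite twopii_eq. simpl.
    replace (2 * PI * (s + IZR k) * x) with
      ((0 * (s + IZR k) - 2 * PI * 0) * y + (0 * 0 + 2 * PI * (s + IZR k)) * x) by ring.
    replace (- (2 * PI * (s + IZR k) * y)) with
      ((0 * (s + IZR k) - 2 * PI * 0) * x - (0 * 0 + 2 * PI * (s + IZR k)) * y) by ring.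
    ring.
  - eapply hsR_ext; [|exact (HG 0)]. intros k. cbv beta. unfold E. rewrite gauss_shift_parts by assumption.
    rewrite Rplus_0_r. reflexivity.
  - eapply hsR_ext; [|exact (HG (- (PI / 2)))]. intros k. cbv beta. unfold E. rewrite gauss_shift_parts by assumption.
    rewrite <- sin_cos_phase. reflexivity.
Qed.

Lemma cexp_line_derive (c P Q : C) (a : R) :
  is_derive (fun a => Re (c * cexp (P + RtoC a * Q))%C) a (Re (c * Q * cexp (P + RtoC a * Q))%C) /\
  is_derive (fun a => Im (c * cexp (P + RtoC a * Q))%C) a (Im (c * Q * cexp (P + RtoC a * Q))%C).
Proof.
  destruct c as [c1 c2], P as [p1 p2], Q as [q1 q2]. unfold cexp. simpl.
  split; auto_derive; auto; unfold Rminus; ring.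
Qed.

Lemma gauss_coef_Cmod t s al w k :
  Cmod (gauss_coef t s al w k) =
  sqrt t * exp (- PI * t * (s + IZR k - al) ^ 2 + - (2 * PI * Im w) * IZR k) * exp (- (2 * PI * Im w) * s).
Proof.
  unfold gauss_coef. rewrite Cmod_mult, Cmod_R, Cmod_cexp, Rabs_right.
  - rewrite !Rmult_assoc. f_equal. rewrite <- !exp_plus. f_equal.
    rewrite twopii_eq. destruct w; simpl. ring.
  - apply Rle_ge, Rmult_le_pos; [apply sqrt_pos|left; apply exp_pos].
Qed.

Lemma gauss_shift_Cmod t s al w b : 0 < t ->
  Cmod (gauss_shift t s al w b) =
  exp (- (PI / t) * (Re w + IZR b) ^ 2) * exp (PI * Im w ^ 2 / t - 2 * PI * al * Im w).
Proof.
  intros Ht. unfold gauss_shift. rewrite Cmod_cexp, <- exp_plus. f_equal.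
  rewrite twopii_eq. destruct w; simpl. field. lra.
Qed.

Lemma normal_family_complex {I} (f : I -> R -> C) :
  (forall i x, continuous (fun y => Re (f i y)) x) ->
  (forall i x, continuous (fun y => Im (f i y)) x) ->
  (forall A, exists M, asum M /\ forall i x, Rabs x <= A -> Cmod (f i x) <= M i) ->
  normal_family (fun i x => Re (f i x)) /\ normal_family (fun i x => Im (f i x)).
Proof.
  intros H1 H2 H3. split; split; auto; intros A; destruct (H3 A) as [M [HM HB]];
    exists M; split; auto; intros i x Hx; eapply Rle_trans;
    [apply Rabs_Re_le|auto|apply Rabs_Im_le|auto].
Qed.

Lemma normal_family_gauss_coef t s w : 0 < t ->
  normal_family (fun k al => Re (gauss_coef t s al w k)) /\
  normal_family (fun k al => Im (gauss_coef t s al w k)).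
Proof.
  intros Ht. apply (normal_family_complex (fun k al => gauss_coef t s al w k)).
  - intros k al. unfold gauss_coef. simpl. cont.
  - intros k al. unfold gauss_coef. simpl. cont.
  - intros A. destruct (gauss_lin_le_exp (PI * t) (- (2 * PI * Im w)) (Rabs s + A)) as [C [HC1 HC2]].
    { apply Rmult_lt_0_compat; [apply PI_RGT_0|assumption]. }
    exists (fun b => sqrt t * exp (- (2 * PI * Im w) * s) * C * exp (- Rabs (IZR b))).
    split; [apply asum_scal, asum_expZ|].
    intros k al Hal. rewrite gauss_coef_Cmod.
    specialize (HC2 k (s - al) ltac:(unfold Rminus; eapply Rle_trans; [apply Rabs_triang|];
      rewrite Rabs_Ropp; lra)).
    replace (- (PI * t) * (s - al + IZR k) ^ 2) with (- PI * t * (s + IZR k - al) ^ 2) in HC2 by ring.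
    assert (0 <= sqrt t * exp (- (2 * PI * Im w) * s))
      by (apply Rmult_le_pos; [apply sqrt_pos|left; apply exp_pos]).
    nra.
Qed.

Lemma normal_family_gauss_shift t s w : 0 < t ->
  normal_family (fun b al => Re (gauss_shift t s al w b)) /\
  normal_family (fun b al => Im (gauss_shift t s al w b)).
Proof.
  intros Ht. apply (normal_family_complex (fun k al => gauss_shift t s al w k)).
  - intros k al. unfold gauss_shift, cexp. simpl. cont.
  - intros k al. unfold gauss_shift, cexp. simpl. cont.
  - intros A. destruct (gauss_le_exp (PI / t) (Rabs (Re w))) as [C [HC1 HC2]].
    { apply Rdiv_lt_0_compat; [apply PI_RGT_0|assumption]. }
    set (E := exp (PI * Im w ^ 2 / t + 2 * PI * A * Rabs (Im w))).
    exists (fun b => E * (C * exp (- Rabs (IZR b)))).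
    split; [apply asum_scal, asum_scal, asum_expZ|].
    intros k al Hal. rewrite gauss_shift_Cmod, Rmult_comm by assumption.
    apply Rmult_le_compat; try (left; apply exp_pos); [|apply HC2; apply Rle_refl].
    apply exp_le. unfold Rminus. apply Rplus_le_compat_l.
    assert (- (al * Im w) <= A * Rabs (Im w)).
    { eapply Rle_trans; [apply Rle_abs|]. rewrite Rabs_Ropp, Rabs_mult.
      apply Rmult_le_compat_r; [apply Rabs_pos|assumption]. }
    pose proof PI_RGT_0. nra.
Qed.

(** For u, x >= 0 one has (u + x)^2 >= u^2 + x^2, so the tail beyond x is at most exp(- pi x^2)
    times the integral from 0. *)
Lemma Erf_tail x : 0 <= x -> 1 - exp (- PI * x ^ 2) <= Erf x <= 1.
Proof.
  intros Hx. destruct Erf_lim as [H1 H2]. split; [|apply H1].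
  apply Rnot_lt_le. intros Hlt.
  destruct (H2 ((1 - exp (- PI * x ^ 2) - Erf x) / 2)) as [X HX]; [lra|].
  set (Y := Rmax X x). specialize (HX Y (Rmax_l _ _)).
  assert (HY : x <= Y) by apply Rmax_r.
  assert (A : is_RInt (fun u => 2 * exp (- PI * (1 * u + x) ^ 2)) 0 (Y - x) (Erf Y - Erf x)).
  { apply is_RInt_ext with (fun u => scal 1 (2 * exp (- PI * (1 * u + x) ^ 2))).
    - intros; unfold scal; simpl; unfold mult; simpl; ring.
    - apply (is_RInt_comp_lin (V := R_NormedModule) (fun u => 2 * exp (- PI * u ^ 2))).
      replace (1 * 0 + x) with x by ring. replace (1 * (Y - x) + x) with Y by ring.
      apply Erf_diff. }
  assert (B : is_RInt (fun u => scal (exp (- PI * x ^ 2)) (2 * exp (- PI * u ^ 2))) 0 (Y - x)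
    (scal (exp (- PI * x ^ 2)) (Erf (Y - x) - Erf 0))).
  { apply (is_RInt_scal (V := R_NormedModule)). apply Erf_diff. }
  unfold scal in B; simpl in B; unfold mult in B; simpl in B.
  assert (Q := is_RInt_le _ _ 0 (Y - x) _ _ ltac:(lra) A B).
  rewrite Erf_0, Rminus_0_r in Q.
  assert (P : Erf Y - Erf x <= exp (- PI * x ^ 2) * Erf (Y - x)).
  { apply Q. intros u Hu.
    transitivity (2 * (exp (- PI * x ^ 2) * exp (- PI * u ^ 2))); [|simpl; lra].
    apply Rmult_le_compat_l; [lra|].
    rewrite <- exp_plus. apply exp_le. pose proof PI_RGT_0.
    assert (0 <= PI * (x * u)) by (apply Rmult_le_pos; [lra|apply Rmult_le_pos; lra]). nra. }
  pose proof (H1 (Y - x)). pose proof (exp_pos (- PI * x ^ 2)). nra.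
Qed.

Lemma Erf_tail_shift x L : - L <= x -> Rabs (1 - Erf x) <= 2 * exp (PI * L ^ 2) * exp (- PI * x ^ 2).
Proof.
  intros HL. pose proof PI_RGT_0.
  assert (E1 : 1 <= exp (PI * L ^ 2)).
  { rewrite <- exp_0. apply exp_le. apply Rmult_le_pos; [lra|apply pow2_ge_0]. }
  pose proof (exp_pos (- PI * x ^ 2)).
  destruct (Rle_dec 0 x) as [h|h].
  - pose proof (Erf_tail x h). rewrite Rabs_right by lra. nra.
  - assert (E2 : 1 <= exp (PI * L ^ 2) * exp (- PI * x ^ 2)).
    { rewrite <- exp_plus, <- exp_0. apply exp_le. assert (x ^ 2 <= L ^ 2) by nra. nra. }
    pose proof (Erf_tail (- x) ltac:(lra)) as T. rewrite Erf_opp in T.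
    pose proof (exp_pos (- PI * (- x) ^ 2)).
    assert (exp (- PI * (- x) ^ 2) <= 1).
    { rewrite <- exp_0. apply exp_le. pose proof (pow2_ge_0 (- x)). nra. }
    pose proof (Erf_le x 0 ltac:(lra)) as T'. rewrite Erf_0 in T'.
    rewrite Rabs_right by lra. nra.
Qed.

(** The side of k and the sign of s + k - al disagree only while |s + k - al| <= |s| + |al|, and the
    constant absorbs these k. Elsewhere the difference is a Gaussian tail. *)
Lemma erf_side_bound t s al k : 0 < t ->
  Rabs (erf_side k - Erf ((s + IZR k - al) * sqrt t)) <=
  2 * exp (PI * t * (Rabs s + Rabs al) ^ 2) * exp (- PI * t * (s + IZR k - al) ^ 2).
Proof.
  intros Ht. set (L := (Rabs s + Rabs al) * sqrt t).
  pose proof (sqrt_lt_R0 t Ht).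
  replace (PI * t * (Rabs s + Rabs al) ^ 2) with (PI * L ^ 2).
  2: { unfold L. rewrite Rpow_mult_distr, pow2_sqrt by lra. ring. }
  set (v := (s + IZR k - al) * sqrt t).
  replace (- PI * t * (s + IZR k - al) ^ 2) with (- PI * v ^ 2).
  2: { unfold v. rewrite Rpow_mult_distr, pow2_sqrt by lra. ring. }
  unfold erf_side. destruct (Z_le_dec 0 k) as [h|h].
  - apply Erf_tail_shift. apply IZR_le in h. unfold L, v.
    rewrite <- Ropp_mult_distr_l_reverse. apply Rmult_le_compat_r; [lra|].
    unfold Rabs; repeat destruct Rcase_abs; lra.
  - replace (-1 - Erf v) with (- (1 - Erf (- v))) by (rewrite Erf_opp; ring).
    rewrite Rabs_Ropp. replace (v ^ 2) with ((- v) ^ 2) by ring.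
    apply Erf_tail_shift. assert (h' : (k <= -1)%Z) by lia. apply IZR_le in h'. unfold L, v.
    rewrite <- !Ropp_mult_distr_l_reverse. apply Rmult_le_compat_r; [lra|].
    unfold Rabs; repeat destruct Rcase_abs; lra.
Qed.

Lemma erf_coef_sum t s al w : 0 < t -> exists S, hs (erf_coef t s al w) S.
Proof.
  intros Ht. assert (Hs := sqrt_lt_R0 t Ht).
  destruct (complex_theta_inversion t s al w Ht) as [L [HL _]].
  apply hs_asum in HL.
  apply (hs_exists _ (fun k => 2 * exp (PI * t * (Rabs s + Rabs al) ^ 2) / sqrt t
    * Cmod (gauss_coef t s al w k))); [|apply asum_scal; assumption].
  intros k. unfold erf_coef, gauss_coef.
  rewrite !Cmod_mult, !Cmod_R, <- Rmult_assoc.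
  apply Rmult_le_compat_r; [apply Cmod_ge_0|].
  eapply Rle_trans; [apply erf_side_bound; assumption|].
  rewrite (Rabs_right (sqrt t * _)) by (apply Rle_ge, Rmult_le_pos; [lra|left; apply exp_pos]).
  right; field; lra.
Qed.

Lemma dist_Z_pos (x : R) : (forall b : Z, x + IZR b <> 0) ->
  exists d, 0 < d /\ forall b : Z, d <= Rabs (x + IZR b).
Proof.
  intros H. destruct (archimed x) as [A1 A2].
  assert (H1 := H (- (up x - 1))%Z). rewrite opp_IZR, minus_IZR in H1.
  exists (Rmin (x - (IZR (up x) - 1)) (IZR (up x) - x)). split.
  - apply Rmin_pos; lra.
  - intros b. pose proof (Rmin_l (x - (IZR (up x) - 1)) (IZR (up x) - x)).
    pose proof (Rmin_r (x - (IZR (up x) - 1)) (IZR (up x) - x)).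
    destruct (Z_le_dec (up x) (- b)) as [h|h].
    + apply IZR_le in h. rewrite opp_IZR in h. rewrite Rabs_left1; lra.
    + assert (h' : (- b <= up x - 1)%Z) by lia. apply IZR_le in h'.
      rewrite opp_IZR, minus_IZR in h'. rewrite Rabs_right; lra.
Qed.

Lemma gauss_shift_div_sum t s al w : 0 < t -> (forall b : Z, (w + RtoC (IZR b))%C <> 0) ->
  exists S, hs (fun b => gauss_shift t s al w b / (w + RtoC (IZR b)))%C S.
Proof.
  intros Ht Hw.
  assert (D : exists d, 0 < d /\ forall b : Z, d <= Cmod (w + RtoC (IZR b))).
  { destruct w as [x y]. destruct (Req_dec y 0) as [->|Hy].
    - destruct (dist_Z_pos x) as [d [H1 H2]].
      + intros b Hb. apply (Hw b). apply C_eq; simpl; lra.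
      + exists d; split; [assumption|]. intros b. eapply Rle_trans; [apply (H2 b)|].
        eapply Rle_trans; [|apply Rabs_Re_le]. simpl; lra.
    - exists (Rabs y). split; [apply Rabs_pos_lt; assumption|]. intros b.
      eapply Rle_trans; [|apply Rabs_Im_le]. simpl. rewrite Rplus_0_r; lra. }
  destruct D as [d [D1 D2]].
  destruct (complex_theta_inversion t s al w Ht) as [L [_ HL]].
  apply hs_asum in HL.
  apply (hs_exists _ (fun k => / d * Cmod (gauss_shift t s al w k))); [|apply asum_scal; assumption].
  intros k. rewrite Cmod_div by apply Hw. unfold Rdiv. rewrite Rmult_comm.
  apply Rmult_le_compat_r; [apply Cmod_ge_0|]. apply Rinv_le_contravar; auto.
Qed.

(** The fundamental theorem of calculus termwise: the increment of the sum is the integral of the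
    summed derivatives, so the sum itself is never differentiated. *)
Lemma hs_Cintegral {I} (f : I -> R -> C) (F : I -> R -> C) a b (Sa Sb : C) :
  a <= b ->
  normal_family (fun i x => Re (f i x)) -> normal_family (fun i x => Im (f i x)) ->
  (forall i x, is_derive (fun y => Re (F i y)) x (Re (f i x))) ->
  (forall i x, is_derive (fun y => Im (F i y)) x (Im (f i x))) ->
  hs (fun i => F i a) Sa -> hs (fun i => F i b) Sb ->
  (Sb - Sa)%C = (RInt (fun x => sumR (fun i => Re (f i x))) a b,
                 RInt (fun x => sumR (fun i => Im (f i x))) a b).
Proof.
  intros Hab N1 N2 D1 D2 Ha Hb.
  assert (H : hs (fun i => F i b + - (1) * F i a)%C (Sb + - (1) * Sa)%C)
    by (apply hs_plus; [|apply hs_scal]; assumption).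
  replace (Sb - Sa)%C with (Sb + - (1) * Sa)%C by ring.
  destruct H as [H1 H2]. apply C_eq.
  - eapply hsR_unique; [exact H1|]. simpl.
    eapply hsR_ext; [|apply (normal_family_RInt (fun i x => Re (f i x)) a b Hab N1)].
    intros i. simpl. apply is_RInt_unique.
    replace (_ + _) with (minus (Re (F i b)) (Re (F i a)))
      by (unfold minus, plus, opp, Re, Im; simpl; ring).
    apply (is_RInt_derive (fun y => Re (F i y))); intros; [apply D1|apply N1].
  - eapply hsR_unique; [exact H2|]. simpl.
    eapply hsR_ext; [|apply (normal_family_RInt (fun i x => Im (f i x)) a b Hab N2)].
    intros i. simpl. apply is_RInt_unique.
    replace (_ + _) with (minus (Im (F i b)) (Im (F i a)))
      by (unfold minus, plus, opp, Re, Im; simpl; ring).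
    apply (is_RInt_derive (fun y => Im (F i y))); intros; [apply D2|apply N2].
Qed.

Lemma twopii_neq0 : twopii <> 0%C.
Proof. rewrite twopii_eq. intros H. apply (f_equal snd) in H. simpl in H. pose proof PI_RGT_0; lra. Qed.

Lemma erf_coef_derive t s w k al : 0 < t ->
  is_derive (fun a => Re (RtoC (/ 2) * erf_coef t s a w k)%C) al (Re (gauss_coef t s al w k)) /\
  is_derive (fun a => Im (RtoC (/ 2) * erf_coef t s a w k)%C) al (Im (gauss_coef t s al w k)).
Proof.
  intros Ht. unfold erf_coef, gauss_coef.
  set (c := cexp (twopii * RtoC (s + IZR k) * w)). clearbody c.
  assert (E : is_derive (fun a => erf_side k - Erf ((s + IZR k - a) * sqrt t)) al
    (2 * (sqrt t * exp (- PI * t * (s + IZR k - al) ^ 2)))).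
  { replace (2 * (sqrt t * exp (- PI * t * (s + IZR k - al) ^ 2)))
      with (minus 0 (scal (- sqrt t) (2 * exp (- PI * ((s + IZR k - al) * sqrt t) ^ 2)))).
    - apply (is_derive_minus (V := R_NormedModule)); [auto_derive; auto|].
      apply (is_derive_comp Erf); [apply Erf_derive|]. auto_derive; [auto|ring].
    - unfold minus, plus, opp, scal; simpl; unfold mult; simpl.
      replace (- PI * ((s + IZR k - al) * sqrt t * ((s + IZR k - al) * sqrt t * 1)))
        with (- PI * (sqrt t * sqrt t) * ((s + IZR k - al) * ((s + IZR k - al) * 1))) by ring.
      rewrite sqrt_sqrt by lra. ring. }
  set (g := sqrt t * exp (- PI * t * (s + IZR k - al) ^ 2)) in *. clearbody g.
  split.
  - apply is_derive_ext with (fun a => / 2 * Re c * (erf_side k - Erf ((s + IZR k - a) * sqrt t))).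
    { intros a. unfold Re, Im. simpl. ring. }
    replace (Re (RtoC g * c)%C) with (/ 2 * Re c * (2 * g))
      by (unfold Re, Im; simpl; field).
    apply (is_derive_scal (fun a => erf_side k - Erf ((s + IZR k - a) * sqrt t))); exact E.
  - apply is_derive_ext with (fun a => / 2 * Im c * (erf_side k - Erf ((s + IZR k - a) * sqrt t))).
    { intros a. unfold Re, Im. simpl. ring. }
    replace (Im (RtoC g * c)%C) with (/ 2 * Im c * (2 * g))
      by (unfold Re, Im; simpl; field).
    apply (is_derive_scal (fun a => erf_side k - Erf ((s + IZR k - a) * sqrt t))); exact E.
Qed.

(* The difference of the two sides is constant in [al] because its derivative is the theta
   inversion formula, and [al -> al + 1] multiplies it by [exp(2 pi i w) <> 1]. *)
Lemma appell_term_expansion t s al w SA SB :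
  0 < t -> cexp (twopii * w) <> 1%C ->
  hs (erf_coef t s al w) SA ->
  hs (fun b => gauss_shift t s al w b / (w + RtoC (IZR b)))%C SB ->
  (cexp (twopii * RtoC s * w) / (1 - cexp (twopii * w)) - RtoC (/ 2) * SA = - (SB / twopii))%C.
Proof.
  intros Ht Hx HA HB.
  assert (Hw : forall b : Z, (w + RtoC (IZR b))%C <> 0).
  { intros b Hb. apply Hx. replace w with (RtoC (IZR (- b))); [apply cexp_twopii_int|].
    rewrite opp_IZR, RtoC_opp. replace w with ((w + RtoC (IZR b)) - RtoC (IZR b))%C by ring.
    rewrite Hb; ring. }
  set (x := cexp (twopii * w)) in *.
  (* Moving al by 1 shifts the index by 1. The single term that crosses the jump of [erf_side]
     contributes 2 exp(2 pi i s w). *)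
  assert (HA1 : hs (erf_coef t s (al + 1) w) (x * SA + 2 * cexp (twopii * RtoC s * w))%C).
  { assert (H := hs_shift (-1) (fun k => x * erf_coef t s al w k
      + (if eqd k (-1)%Z then 2 * cexp (twopii * RtoC s * w) else 0))%C
      (x * SA + 2 * cexp (twopii * RtoC s * w))%C).
    eapply hs_ext; [|apply H; apply hs_plus; [apply hs_scal; exact HA|]].
    - intros k. cbv beta. unfold erf_coef.
      replace (s + IZR (k + -1) - al) with (s + IZR k - (al + 1)) by (rewrite plus_IZR; ring).
      replace (cexp (twopii * RtoC (s + IZR k) * w)) with
        (x * cexp (twopii * RtoC (s + IZR (k + -1)) * w))%C.
      2: { unfold x. rewrite <- cexp_plus. f_equal. rewrite plus_IZR, !RtoC_plus. ring. }
      unfold erf_side.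
      destruct (eqd (k + -1)%Z (-1)%Z) as [h|h].
      + rewrite h. destruct (Z_le_dec 0 (-1)); [lia|]. destruct (Z_le_dec 0 k); [|lia].
        replace (cexp (twopii * RtoC s * w)) with (x * cexp (twopii * RtoC (s + -1) * w))%C.
        2: { unfold x. rewrite <- cexp_plus. f_equal. rewrite !RtoC_plus. ring. }
        rewrite !RtoC_minus. replace (RtoC (-1)) with (- (1))%C by (rewrite <- RtoC_opp; reflexivity).
        ring.
      + destruct (Z_le_dec 0 (k + -1)), (Z_le_dec 0 k); try lia; ring.
    - split; apply (hsR_single (-1)%Z); intros i; destruct (eqd i (-1)%Z); reflexivity. }
  (* Each term is multiplied by exp(2 pi i (w + b)), which is x because b is an integer. *)
  assert (HB1 : hs (fun b => gauss_shift t s (al + 1) w b / (w + RtoC (IZR b)))%C (x * SB)%C).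
  { eapply hs_ext; [|apply hs_scal; exact HB]. intros b. cbv beta. unfold Cdiv.
    rewrite Cmult_assoc. f_equal. unfold x, gauss_shift. rewrite <- cexp_plus.
    symmetry; apply (cexp_period _ _ b). rewrite RtoC_plus. ring. }
  assert (HA' : forall a S, hs (erf_coef t s a w) S ->
    hs (fun k => RtoC (/ 2) * erf_coef t s a w k)%C (RtoC (/ 2) * S)%C) by (intros; apply hs_scal; assumption).
  assert (HB' : forall a S, hs (fun b => gauss_shift t s a w b / (w + RtoC (IZR b)))%C S ->
    hs (fun b => / (twopii * (w + RtoC (IZR b))) * gauss_shift t s a w b)%C (/ twopii * S)%C).
  { intros a S H. eapply hs_ext; [|apply hs_scal; exact H]. intros b. simpl.
    field. split; [apply Hw|apply twopii_neq0]. }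
  pose proof (normal_family_gauss_coef t s w Ht) as [NA1 NA2].
  pose proof (normal_family_gauss_shift t s w Ht) as [NB1 NB2].
  assert (EA := hs_Cintegral (fun k a => gauss_coef t s a w k)
    (fun k a => RtoC (/ 2) * erf_coef t s a w k)%C al (al + 1) _ _ ltac:(lra) NA1 NA2
    (fun k a => proj1 (erf_coef_derive t s w k a Ht))
    (fun k a => proj2 (erf_coef_derive t s w k a Ht)) (HA' _ _ HA) (HA' _ _ HA1)).
  assert (DB : forall b a,
    is_derive (fun a => Re (/ (twopii * (w + RtoC (IZR b))) * gauss_shift t s a w b)%C) a
      (Re (gauss_shift t s a w b)) /\
    is_derive (fun a => Im (/ (twopii * (w + RtoC (IZR b))) * gauss_shift t s a w b)%C) a
      (Im (gauss_shift t s a w b))).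
  { intros b a.
    pose proof (cexp_line_derive (/ (twopii * (w + RtoC (IZR b))))
      (- (twopii * RtoC (s * IZR b)) - RtoC (PI / t) * ((w + RtoC (IZR b)) * (w + RtoC (IZR b))))
      (twopii * (w + RtoC (IZR b))) a) as H.
    replace (/ (twopii * (w + RtoC (IZR b))) * (twopii * (w + RtoC (IZR b))))%C with (RtoC 1) in H
      by (field; split; [apply Hw|apply twopii_neq0]).
    rewrite Cmult_1_l in H. exact H. }
  assert (EB := hs_Cintegral (fun b a => gauss_shift t s a w b)
    (fun b a => / (twopii * (w + RtoC (IZR b))) * gauss_shift t s a w b)%C al (al + 1) _ _
    ltac:(lra) NB1 NB2 (fun b a => proj1 (DB b a)) (fun b a => proj2 (DB b a))
    (HB' _ _ HB) (HB' _ _ HB1)).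
  (* Both increments over [al, al + 1] are integrals of the same function, by theta inversion at
     every point of the interval. *)
  assert (E : (RtoC (/ 2) * (x * SA + 2 * cexp (twopii * RtoC s * w)) - RtoC (/ 2) * SA
     = / twopii * (x * SB) - / twopii * SB)%C).
  { rewrite EA, EB. f_equal; apply RInt_ext; intros a _;
      destruct (complex_theta_inversion t s a w Ht) as [L [L1 L2]];
      rewrite (sumR_eq _ _ (proj1 L1)) || rewrite (sumR_eq _ _ (proj2 L1));
      symmetry; apply sumR_eq; [exact (proj1 L2)|exact (proj2 L2)]. }
  assert (Hx1 : (1 - x)%C <> 0).
  { intro h. apply Hx. replace x with (1 - (1 - x))%C by ring. rewrite h; ring. }
  set (e := cexp (twopii * RtoC s * w)) in *.
  assert (F : ((1 - x) * (RtoC (/ 2) * SA - / twopii * SB) = e)%C).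
  { replace ((1 - x) * (RtoC (/ 2) * SA - / twopii * SB))%C with
      (/ twopii * (x * SB) - / twopii * SB - (RtoC (/ 2) * (x * SA + 2 * e) - RtoC (/ 2) * SA) + RtoC (/ 2) * 2 * e)%C by ring.
    rewrite E. rewrite <- RtoC_mult. replace (/ 2 * 2) with 1 by field. ring. }
  rewrite <- F. field. split; [apply twopii_neq0|assumption].
Qed.

(** * The Gaussian lattice sum *)

Definition off_lattice (tau z : C) : Prop :=
  forall k n : Z, z <> (RtoC (IZR k) + RtoC (IZR n) * tau)%C.

(** Turns the sign (+-1)^n into exp(2 pi i pmshift n), a character of the same kind as exp(- 2 pi i
    s b). *)
Definition pmshift (pm : bool) : R := if pm then 0 else / 2.

Lemma pmpow_cexp pm n : pmpow pm n = cexp (twopii * RtoC (pmshift pm * IZR n)).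
Proof.
  destruct pm; simpl.
  - rewrite Rmult_0_l, Cmult_0_r, cexp_0. reflexivity.
  - destruct (Z.even n) eqn:E.
    + apply Z.even_spec in E. destruct E as [k ->].
      rewrite mult_IZR. replace (/ 2 * (2 * IZR k)) with (IZR k) by field.
      rewrite cexp_twopii_int; reflexivity.
    + assert (O : Z.odd n = true) by (rewrite <- Z.negb_even, E; reflexivity).
      apply Z.odd_spec in O. destruct O as [k ->].
      rewrite plus_IZR, mult_IZR. replace (/ 2 * (2 * IZR k + 1)) with (IZR k + / 2) by field.
      rewrite RtoC_plus, Cmult_plus_distr_l, cexp_plus, cexp_twopii_int.
      rewrite twopii_eq. unfold cexp; simpl.
      replace (0 * 0 + 2 * PI * / 2) with PI by field.
      replace (0 * / 2 - 2 * PI * 0) with 0 by ring.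
      rewrite exp_0, cos_PI, sin_PI. apply C_eq; simpl; ring.
Qed.

Definition lattice_pt (tau : C) (p : Z * Z) : C :=
  (RtoC (IZR (fst p)) * tau + RtoC (IZR (snd p)))%C.

Definition lattice_term (pm : bool) (m s : R) (tau z1 z2 : C) (p : Z * Z) : C :=
  (cexp (twopii * RtoC (pmshift pm * IZR (fst p) - (s + m * IZR (fst p)) * IZR (snd p))
     + RtoC (PI * m / Im tau) *
       (- ((z1 + lattice_pt tau p) * Cconj (z1 + lattice_pt tau p))
        - (z2 - Cconj z2) * z1
        + lattice_pt tau p * Cconj z2 - Cconj (lattice_pt tau p) * z2))
   / (z1 + lattice_pt tau p))%C.

(** At most one row of z + L is real. On it the distance is governed by the distance of a real
    number to Z, and on all other rows by Im tau. If there is no such row, the imaginary parts alone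
    stay away from 0. *)
Lemma lattice_dist (tau z : C) : 0 < Im tau -> off_lattice tau z ->
  exists d, 0 < d /\ forall p, d <= Cmod (z + lattice_pt tau p).
Proof.
  intros Hv Hz. destruct tau as [u v], z as [x y]. simpl in Hv.
  assert (HI : forall p, Im ((x, y) + lattice_pt (u, v) p) = v * (y / v + IZR (fst p))).
  { intros [n b]. simpl. field. lra. }
  destruct (classic (exists n : Z, y / v + IZR n = 0)) as [[n0 Hn0]|H].
  - destruct (dist_Z_pos (x + IZR n0 * u)) as [d [D1 D2]].
    + intros b Hb. apply (Hz (- b)%Z (- n0)%Z). apply C_eq; simpl; rewrite !opp_IZR; [lra|].
      apply (Rmult_eq_reg_r (/ v)); [|apply Rinv_neq_0_compat; lra].
      field_simplify; [|lra|lra]. lra.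
    + exists (Rmin d v). split; [apply Rmin_pos; lra|]. intros p.
      destruct (Z.eq_dec (fst p) n0) as [h|h].
      * eapply Rle_trans; [apply Rmin_l|]. eapply Rle_trans; [apply (D2 (snd p))|].
        eapply Rle_trans; [|apply Rabs_Re_le]. right. f_equal. simpl. rewrite h. ring.
      * eapply Rle_trans; [apply Rmin_r|]. eapply Rle_trans; [|apply Rabs_Im_le].
        rewrite HI, Rabs_mult, (Rabs_right v) by lra.
        replace (y / v) with (- IZR n0) by lra. rewrite <- opp_IZR, <- plus_IZR, <- abs_IZR.
        assert (1 <= IZR (Z.abs (- n0 + fst p))) by (apply IZR_le; lia). nra.
  - destruct (dist_Z_pos (y / v)) as [d [D1 D2]].
    + intros b Hb. apply H; exists b; assumption.
    + exists (v * d). split; [apply Rmult_lt_0_compat; lra|]. intros p.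
      eapply Rle_trans; [|apply Rabs_Im_le].
      rewrite HI, Rabs_mult, (Rabs_right v) by lra. apply Rmult_le_compat_l; [lra|apply D2].
Qed.

Lemma lattice_sum_exists pm m s tau z1 z2 : 0 < m -> 0 < Im tau -> off_lattice tau z1 ->
  exists L, hs (lattice_term pm m s tau z1 z2) L.
Proof.
  intros Hm Hv Hz. destruct (lattice_dist tau z1 Hv Hz) as [d [D1 D2]].
  destruct tau as [u v], z1 as [x1 y1], z2 as [x2 y2]. simpl in Hv.
  pose proof PI_RGT_0 as Hpi.
  set (c := PI * m / v).
  assert (Hc : 0 < c) by (apply Rdiv_lt_0_compat; [apply Rmult_lt_0_compat|]; lra).
  (* With X + i Y = z1 + L this is the slope in |n| + |b| <= |X| + |x1| + e (|Y| + |y1|). [C0]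
     collects the constants left after completing the squares in |X| and |Y|. *)
  set (e := (1 + Rabs u) / v).
  assert (He : 0 < e) by (apply Rdiv_lt_0_compat; [pose proof (Rabs_pos u)|]; lra).
  set (C0 := exp (2 * c * y1 * y2 + / (4 * c) + e ^ 2 / (4 * c) + Rabs x1 + e * Rabs y1)).
  apply (hs_exists _ (fun p => C0 / d * (exp (- Rabs (IZR (fst p))) * exp (- Rabs (IZR (snd p))))));
    [|apply asum_scal; exact (asum_prod _ _ asum_expZ asum_expZ)].
  intros p. unfold lattice_term.
  assert (H0 : ((x1, y1) + lattice_pt (u, v) p)%C <> 0).
  { intro h. specialize (D2 p). rewrite h, Cmod_0 in D2. lra. }
  rewrite Cmod_div, Cmod_cexp by exact H0.
  replace (C0 / d * _) with ((C0 * (exp (- Rabs (IZR (fst p))) * exp (- Rabs (IZR (snd p))))) * / d)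
    by (unfold Rdiv; ring).
  apply Rmult_le_compat; [left; apply exp_pos|left; apply Rinv_0_lt_compat; specialize (D2 p); lra| |
    apply Rinv_le_contravar; auto].
  unfold C0. rewrite <- !exp_plus. apply exp_le. rewrite twopii_eq.
  destruct p as [n b]. unfold lattice_pt. simpl. fold c.
  set (X := x1 + (IZR n * u - 0 * v + IZR b)). set (Y := y1 + (IZR n * v + 0 * u + 0)).
  (* The real part of the exponent is - c |z1 + L|^2 plus a constant, as L conj(z2) - conj(L) z2 is
     imaginary. *)
  match goal with |- ?l <= _ => replace l with (2 * c * y1 * y2 - c * X ^ 2 - c * Y ^ 2)
    by (unfold X, Y; ring) end.
  assert (B1 : Rabs (IZR n) <= (Rabs Y + Rabs y1) / v).
  { apply Rmult_le_reg_r with v; [lra|]. unfold Rdiv. rewrite Rmult_assoc, Rinv_l, Rmult_1_r by lra.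
    rewrite <- (Rabs_right v) at 1 by lra. rewrite <- Rabs_mult.
    replace (IZR n * v) with (Y + - y1) by (unfold Y; ring).
    eapply Rle_trans; [apply Rabs_triang|]. rewrite Rabs_Ropp; lra. }
  assert (B2 : Rabs (IZR b) <= Rabs X + Rabs x1 + Rabs (IZR n) * Rabs u).
  { rewrite <- Rabs_mult. replace (IZR b) with (X + - x1 + - (IZR n * u)) by (unfold X; ring).
    eapply Rle_trans; [apply Rabs_triang|]. rewrite Rabs_Ropp. apply Rplus_le_compat_r.
    eapply Rle_trans; [apply Rabs_triang|]. rewrite Rabs_Ropp. lra. }
  assert (B3 : Rabs (IZR n) + Rabs (IZR b) <= Rabs X + Rabs x1 + e * (Rabs Y + Rabs y1)).
  { assert (Rabs (IZR n) * (1 + Rabs u) <= (Rabs Y + Rabs y1) / v * (1 + Rabs u))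
      by (apply Rmult_le_compat_r; [pose proof (Rabs_pos u); lra|assumption]).
    unfold e. replace ((1 + Rabs u) / v * (Rabs Y + Rabs y1)) with
      ((Rabs Y + Rabs y1) / v * (1 + Rabs u)) by (field; lra). lra. }
  rewrite <- (pow2_abs X), <- (pow2_abs Y).
  assert (Q1 : 0 <= c * (Rabs X - / (2 * c)) ^ 2) by (apply Rmult_le_pos; [lra|apply pow2_ge_0]).
  replace (c * (Rabs X - / (2 * c)) ^ 2) with (c * Rabs X ^ 2 - Rabs X + / (4 * c)) in Q1 by (field; lra).
  assert (Q2 : 0 <= c * (Rabs Y - e / (2 * c)) ^ 2) by (apply Rmult_le_pos; [lra|apply pow2_ge_0]).
  replace (c * (Rabs Y - e / (2 * c)) ^ 2) with (c * Rabs Y ^ 2 - e * Rabs Y + e ^ 2 / (4 * c)) in Q2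
    by (field; lra).
  simpl in *. lra.
Qed.

(** What row n of the lattice sum, term n of [Phi] and the terms of [Phi_add] collected at n have in
    common; dividing by it leaves the one-variable identity at w = z1 + n tau. *)
Definition row_factor (pm : bool) (m : R) (tau z1 z2 : C) (n : Z) : C :=
  (pmpow pm n * cexp (twopii * RtoC (m * IZR n) * (z1 + RtoC (IZR n) * tau + z2)))%C.

Definition add_center (m : R) (tau z1 z2 : C) : R := m * (Im z1 - Im z2) / Im tau.

Lemma lattice_term_row pm m s tau z1 z2 n b : 0 < m -> 0 < Im tau ->
  lattice_term pm m s tau z1 z2 (n, b) =
  (row_factor pm m tau z1 z2 n *
   (gauss_shift (Im tau / m) s (add_center m tau z1 z2) (z1 + RtoC (IZR n) * tau) b
    / ((z1 + RtoC (IZR n) * tau) + RtoC (IZR b))))%C.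
Proof.
  intros Hm Hv. unfold lattice_term, row_factor, gauss_shift, lattice_pt, add_center, Cdiv.
  rewrite pmpow_cexp, Cmult_assoc, <- !cexp_plus. cbv [fst snd].
  f_equal; [|f_equal; ring]. f_equal. rewrite twopii_eq.
  destruct tau as [u v], z1 as [x1 y1], z2 as [x2 y2]. simpl in Hv.
  apply C_eq; simpl; field; lra.
Qed.

(** * The modifier as a double sum *)

Definition add_term (pm : bool) (m s : R) (tau z1 z2 : C) (p : Z * Z) : C :=
  (row_factor pm m tau z1 z2 (fst p) *
   erf_coef (Im tau / m) s (add_center m tau z1 z2) (z1 + RtoC (IZR (fst p)) * tau) (snd p))%C.

Definition R_term (pm : bool) (j m : R) (tau z : C) (k : Z) : C :=
  let n := j + 2 * m * IZR k in
    (pmpow pm k * RtoC (sgn (n - /2 - j + 2 * m) - Erf (psi m n tau z))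
     * cexp (- (RtoC (PI * n ^ 2 / (2 * m)) * Ci * tau) + twopii * RtoC n * z))%C.

Definition Theta_term (pm : bool) (j m : R) (tau z : C) (n : Z) : C :=
  (pmpow pm n * cexp (twopii * RtoC (m * (IZR n + j / (2 * m))) * z)
     * qpow tau (m * (IZR n + j / (2 * m)) ^ 2))%C.

Lemma Cmod_pmpow pm n : Cmod (pmpow pm n) = 1.
Proof.
  rewrite pmpow_cexp, Cmod_cexp, twopii_eq. simpl.
  rewrite <- exp_0. f_equal. ring.
Qed.

Lemma Theta_sum pm j m tau z : 0 < m -> 0 < Im tau -> hs (Theta_term pm j m tau z) (Theta pm j m tau z).
Proof.
  intros Hm Hv. assert (E : exists l, hs (Theta_term pm j m tau z) l).
  { destruct (gauss_lin_le_exp (2 * PI * m * Im tau) (- (2 * PI * m * Im z)) (Rabs (j / (2 * m))))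
      as [C [HC1 HC2]].
    { pose proof PI_RGT_0. apply Rmult_lt_0_compat; [apply Rmult_lt_0_compat|]; lra. }
    apply (hs_exists _ (fun n => exp (- (PI * j * Im z)) * C * exp (- Rabs (IZR n))));
      [|apply asum_scal, asum_expZ].
    intros n. unfold Theta_term, qpow.
    rewrite !Cmod_mult, Cmod_pmpow, !Cmod_cexp, Rmult_1_l, <- exp_plus.
    rewrite Rmult_assoc.
    eapply Rle_trans; [|apply Rmult_le_compat_l; [left; apply exp_pos|apply (HC2 n (j / (2 * m))), Rle_refl]].
    rewrite <- exp_plus. apply exp_le. right. rewrite twopii_eq.
    destruct tau, z; simpl. field. lra. }
  destruct E as [l Hl]. change (Theta pm j m tau z) with (zsum (Theta_term pm j m tau z)).
  rewrite (zsum_hs _ l Hl). exact Hl.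
Qed.

(** The argument is M (k + 1) - 1/2, which is never 0 for an integer k, so [sgn] takes only the
    values 1 and -1 here. *)
Lemma sgn_erf_side (M : nat) (k : Z) (j : R) : (0 < M)%nat ->
  sgn (j + INR M * IZR k - / 2 - j + INR M) = erf_side k.
Proof.
  intros HM. unfold sgn, erf_side.
  assert (h1 : 1 <= INR M) by (apply (le_INR 1); lia).
  replace (j + INR M * IZR k - / 2 - j + INR M) with (INR M * (IZR k + 1) - / 2) by ring.
  destruct (Z_le_dec 0 k) as [h|h].
  - apply IZR_le in h. destruct (Rlt_dec 0 (INR M * (IZR k + 1) - / 2)) as [|n]; [reflexivity|].
    exfalso; apply n. nra.
  - assert (h' : (k <= -1)%Z) by lia. apply IZR_le in h'.
    destruct (Rlt_dec 0 (INR M * (IZR k + 1) - / 2)) as [n|_]; [exfalso; nra|].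
    destruct (Rlt_dec (INR M * (IZR k + 1) - / 2) 0) as [|n]; [reflexivity|].
    exfalso; apply n; nra.
Qed.

Lemma Im_half_diff (z1 z2 : C) : Im ((z1 - z2) / RtoC 2)%C = (Im z1 - Im z2) / 2.
Proof. destruct z1, z2; simpl. field. Qed.

Lemma erf_side_class (M j' : nat) (k : Z) : (j' < M)%nat ->
  erf_side (Z.of_nat j' + Z.of_nat M * k) = erf_side k.
Proof.
  intros H. unfold erf_side.
  destruct (Z_le_dec 0 k), (Z_le_dec 0 (Z.of_nat j' + Z.of_nat M * k)); try reflexivity; exfalso; nia.
Qed.

Lemma R_term_eq pm (M j' : nat) s tau z1 z2 k : (j' < M)%nat -> 0 < Im tau ->
  let m := INR M / 2 in
  let l := (Z.of_nat j' + Z.of_nat M * k)%Z in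
  R_term pm (s + INR j') m tau ((z1 - z2) / RtoC 2) k =
  (pmpow pm k *
   RtoC (erf_side l - Erf ((s + IZR l - add_center m tau z1 z2) * sqrt (Im tau / m)))
   * cexp (- (RtoC (PI * (s + IZR l) ^ 2 / (2 * m)) * Ci * tau)
           + twopii * RtoC (s + IZR l) * ((z1 - z2) / RtoC 2)))%C.
Proof.
  intros Hj Hv m l. unfold R_term.
  assert (h1 : 1 <= INR M) by (apply (le_INR 1); lia).
  assert (E2 : 2 * m = INR M) by (unfold m; field).
  assert (E : s + INR j' + 2 * m * IZR k = s + IZR l).
  { unfold l. rewrite plus_IZR, mult_IZR, <- !INR_IZR_INZ, E2. ring. }
  assert (S : sgn (s + INR j' + 2 * m * IZR k - / 2 - (s + INR j') + 2 * m) = erf_side l).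
  { rewrite E2, sgn_erf_side by lia. symmetry; apply erf_side_class; assumption. }
  rewrite S, E. unfold psi, add_center. rewrite Im_half_diff.
  replace (s + IZR l - 2 * m * ((Im z1 - Im z2) / 2) / Im tau)
    with (s + IZR l - m * (Im z1 - Im z2) / Im tau) by (field; lra).
  reflexivity.
Qed.

(** With t = Im tau / m the exponential grows like exp(pi t n^2 / 2), up to a linear term, while the
    bracket decays like exp(- pi t (n - al)^2). The product keeps half of the Gaussian decay. *)
Lemma R_sum pm (M j' : nat) s tau z1 z2 : (j' < M)%nat -> 0 < Im tau ->
  let m := INR M / 2 in
  hs (R_term pm (s + INR j') m tau ((z1 - z2) / RtoC 2))
     (Rfun pm (s + INR j') m tau ((z1 - z2) / RtoC 2)).
Proof.
  intros Hj Hv m.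
  assert (h1 : 1 <= INR M) by (apply (le_INR 1); lia).
  assert (Hm : 0 < m) by (unfold m; lra).
  assert (Ht : 0 < Im tau / m) by (apply Rdiv_lt_0_compat; lra).
  pose proof PI_RGT_0 as Hpi.
  assert (E : exists l, hs (R_term pm (s + INR j') m tau ((z1 - z2) / RtoC 2)) l).
  { set (al := add_center m tau z1 z2). set (t := Im tau / m) in *.
    destruct (gauss_lin_le_exp (PI * t / 2) (PI * (Im z1 - Im z2)) (Rabs s)) as [C [HC1 HC2]].
    { apply Rdiv_lt_0_compat; [apply Rmult_lt_0_compat|]; lra. }
    set (C1 := 2 * exp (PI * t * (Rabs s + Rabs al) ^ 2)
      * exp (PI * s * (Im z1 - Im z2) - PI * t * al ^ 2)).
    apply (hs_exists _ (fun k => C1 * C * exp (- Rabs (IZR (Z.of_nat j' + Z.of_nat M * k))))).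
    2: { apply asum_scal. apply (asum_inj (fun k => Z.of_nat j' + Z.of_nat M * k)%Z
           (fun l => exp (- Rabs (IZR l)))); [intros; nia|apply asum_expZ]. }
    intros k. unfold m. rewrite R_term_eq by assumption. fold m. fold al. fold t.
    set (l := (Z.of_nat j' + Z.of_nat M * k)%Z).
    rewrite !Cmod_mult, Cmod_pmpow, Cmod_R, Cmod_cexp, Rmult_1_l.
    eapply Rle_trans; [apply Rmult_le_compat_r; [left; apply exp_pos|apply erf_side_bound; exact Ht]|].
    unfold C1.
    rewrite !Rmult_assoc. apply Rmult_le_compat_l; [lra|].
    apply Rmult_le_compat_l; [left; apply exp_pos|].
    eapply Rle_trans; [|apply Rmult_le_compat_l; [left; apply exp_pos|apply (HC2 l s), Rle_refl]].
    rewrite <- !exp_plus. apply exp_le. right. rewrite twopii_eq.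
    unfold al, t, add_center. destruct tau as [u v], z1, z2; simpl in *. field. lra. }
  destruct E as [l Hl].
  change (Rfun ?pm ?j ?m ?tau ?z) with (zsum (R_term pm j m tau z)).
  rewrite (zsum_hs _ l Hl). exact Hl.
Qed.

(** Put r = s + l, n = n' - k and j = s + j'. Then n' + j / (2m) = n + r / (2m), so the terms in r^2
    tau / (4m) of the two factors cancel and r occurs only linearly in the exponent. *)
Lemma add_term_eq pm (M j' : nat) s tau z1 z2 k n' : (j' < M)%nat -> 0 < Im tau ->
  let m := INR M / 2 in
  (R_term pm (s + INR j') m tau ((z1 - z2) / RtoC 2) k
    * Theta_term pm (s + INR j') m tau (z1 + z2) n' =
   add_term pm m s tau z1 z2 (n' - k, Z.of_nat j' + Z.of_nat M * k)%Z)%C.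
Proof.
  intros Hj Hv m.
  assert (h1 : 1 <= INR M) by (apply (le_INR 1); lia).
  unfold m. rewrite R_term_eq by assumption. fold m.
  unfold add_term, Theta_term, row_factor, erf_coef, qpow. cbv [fst snd].
  set (l := (Z.of_nat j' + Z.of_nat M * k)%Z).
  set (c := RtoC (_ - Erf _)).
  rewrite !pmpow_cexp.
  match goal with |- (?a * c * ?b * (?d * ?e * ?f) = ?g * ?h * (c * ?i))%C =>
    transitivity (c * (a * b * (d * e * f)))%C; [ring|];
    transitivity (c * (g * h * i))%C; [|ring] end.
  f_equal. rewrite <- !cexp_plus.
  (* For the minus sign the phases (k + n') / 2 and (n' - k) / 2 differ by the integer k. *)
  apply (cexp_period _ _ (if pm then 0 else k)).
  assert (E1 : IZR l = INR j' + INR M * IZR k).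
  { unfold l. rewrite plus_IZR, mult_IZR, <- !INR_IZR_INZ. reflexivity. }
  assert (E2 : pmshift pm * IZR k + pmshift pm * IZR n' =
     pmshift pm * IZR (n' - k) + IZR (if pm then 0 else k)).
  { rewrite minus_IZR. destruct pm; simpl; field. }
  rewrite E1, minus_IZR in *.
  replace (pmshift pm * IZR k) with
    (pmshift pm * (IZR n' - IZR k) + IZR (if pm then 0 else k) - pmshift pm * IZR n') by lra.
  rewrite twopii_eq. unfold m. destruct tau as [u v], z1, z2; simpl in *.
  apply C_eq; simpl; field; lra.
Qed.

Lemma hs_zero {I : Type} : hs (fun _ : I => RtoC 0) 0.
Proof.
  split; simpl; intros eps He; exists nil; intros s _ _;
    rewrite lsum_zero by auto; rewrite Rminus_0_r, Rabs_R0; lra.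
Qed.

(** The map (k, n') -> (n' - k, j' + M k) is a bijection onto the pairs whose second entry is j'
    modulo M; the M classes together exhaust the lattice. *)
Lemma class_sum pm (M j' : nat) s tau z1 z2 : (j' < M)%nat -> 0 < Im tau ->
  let m := INR M / 2 in
  hs (fun p : Z * Z => if (snd p mod Z.of_nat M =? Z.of_nat j')%Z
                       then add_term pm m s tau z1 z2 p else RtoC 0)
     (Rfun pm (s + INR j') m tau ((z1 - z2) / RtoC 2) * Theta pm (s + INR j') m tau (z1 + z2))%C.
Proof.
  intros Hj Hv m.
  assert (h1 : 1 <= INR M) by (apply (le_INR 1); lia).
  assert (Hm : 0 < m) by (unfold m; lra).
  assert (P := hs_prod _ _ _ _ (R_sum pm M j' s tau z1 z2 Hj Hv)
    (Theta_sum pm (s + INR j') m tau (z1 + z2)%C Hm Hv)).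
  apply (hs_inj (fun q : Z * Z => (snd q - fst q, Z.of_nat j' + Z.of_nat M * fst q)%Z)).
  - intros [a b] [a' b'] E. simpl in E. injection E as E1 E2.
    assert (a = a') by nia. subst. f_equal. lia.
  - intros [n l] H. cbv [snd fst] in *.
    destruct (Z.eqb_spec (l mod Z.of_nat M) (Z.of_nat j')) as [e|]; [|reflexivity].
    exfalso. apply (H (l / Z.of_nat M, n + l / Z.of_nat M)%Z).
    pose proof (Z.div_mod l (Z.of_nat M) ltac:(lia)) as D. simpl. f_equal; lia.
  - revert P. apply hs_ext. intros [k n']. cbv [fst snd].
    replace ((Z.of_nat j' + Z.of_nat M * k) mod Z.of_nat M)%Z with (Z.of_nat j').
    2: { rewrite Z.mul_comm, Z.mod_add by lia. symmetry. apply Z.mod_small. lia. }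
    rewrite Z.eqb_refl. apply add_term_eq; assumption.
Qed.

Lemma Phi_add_sum pm (M : nat) s tau z1 z2 : (0 < M)%nat -> 0 < Im tau ->
  hs (add_term pm (INR M / 2) s tau z1 z2) (Phi_add pm (INR M / 2) s tau z1 z2).
Proof.
  intros HM Hv. set (m := INR M / 2).
  assert (E2 : 2 * m = INR M) by (unfold m; field).
  set (T := fun k : nat =>
    match Rlt_dec (INR k) (2 * m) with
    | left _ => (Rfun pm (s + INR k) m tau ((z1 - z2) / RtoC 2)
                 * Theta pm (s + INR k) m tau (z1 + z2))%C
    | right _ => RtoC 0
    end).
  assert (S : forall N, (N <= M)%nat ->
    hs (fun p : Z * Z => if (snd p mod Z.of_nat M <? Z.of_nat N)%Z
                         then add_term pm m s tau z1 z2 p else RtoC 0) (csum N T)).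
  { induction N as [|N IH]; intros HN.
    - simpl. eapply hs_ext; [|apply hs_zero]. intros p. simpl.
      pose proof (Z.mod_pos_bound (snd p) (Z.of_nat M) ltac:(lia)).
      destruct (Z.ltb_spec (snd p mod Z.of_nat M) 0); [lia|reflexivity].
    - simpl csum. assert (HT : T N = (Rfun pm (s + INR N) m tau ((z1 - z2) / RtoC 2)
                 * Theta pm (s + INR N) m tau (z1 + z2))%C).
      { unfold T. destruct (Rlt_dec (INR N) (2 * m)) as [|n]; [reflexivity|].
        exfalso; apply n. rewrite E2. apply lt_INR. lia. }
      rewrite HT.
      eapply hs_ext; [|apply hs_plus; [apply IH; lia|apply (class_sum pm M N s tau z1 z2); [lia|assumption]]].
      intros p. cbv beta. fold m.
      destruct (Z.ltb_spec (snd p mod Z.of_nat M) (Z.of_nat N)),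
        (Z.eqb_spec (snd p mod Z.of_nat M) (Z.of_nat N)),
        (Z.ltb_spec (snd p mod Z.of_nat M) (Z.of_nat (S N))); try lia; ring. }
  (* [up] lies strictly above its argument, so [csum] runs up to k = M, one step past the range k <
     2m, and the extra term is 0. *)
  assert (U : Z.to_nat (up (2 * m)) = Datatypes.S M).
  { rewrite E2. rewrite <- (tech_up (INR M) (Z.of_nat (Datatypes.S M))); [lia| |];
      rewrite <- INR_IZR_INZ, S_INR; lra. }
  unfold Phi_add. rewrite U. change (hs (add_term pm m s tau z1 z2) (csum M T + T M)%C).
  assert (HT : T M = 0%C).
  { unfold T. destruct (Rlt_dec (INR M) (2 * m)) as [h|]; [lra|reflexivity]. }
  rewrite HT, Cplus_0_r. eapply hs_ext; [|apply S; lia].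
  intros p. cbv beta.
  pose proof (Z.mod_pos_bound (snd p) (Z.of_nat M) ltac:(lia)).
  destruct (Z.ltb_spec (snd p mod Z.of_nat M) (Z.of_nat M)); [reflexivity|lia].
Qed.

(** * The lattice expansion and its reindexing *)

Lemma Phi_t_lattice pm m s tau z1 z2 :
  (exists M : nat, (0 < M)%nat /\ m = INR M / 2) -> 0 < Im tau -> off_lattice tau z1 ->
  hs (lattice_term pm m s tau z1 z2) (- (twopii * Phi_t pm m s tau z1 z2))%C.
Proof.
  intros [M [HM ->]] Hv Hz.
  assert (h1 : 1 <= INR M) by (apply (le_INR 1); lia).
  assert (Hadd := Phi_add_sum pm M s tau z1 z2 HM Hv).
  set (m := INR M / 2) in *. assert (Hm : 0 < m) by (unfold m; lra).
  assert (Ht : 0 < Im tau / m) by (apply Rdiv_lt_0_compat; lra).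
  set (w := fun n => (z1 + RtoC (IZR n) * tau)%C). set (al := add_center m tau z1 z2).
  set (SA := fun n => epsilon (inhabits (RtoC 0)) (hs (erf_coef (Im tau / m) s al (w n)))).
  assert (HA : forall n, hs (erf_coef (Im tau / m) s al (w n)) (SA n))
    by (intros n; apply epsilon_spec, erf_coef_sum; assumption).
  assert (Hw : forall n b, (w n + RtoC (IZR b))%C <> 0).
  { intros n b H. apply (Hz (- b)%Z (- n)%Z). unfold w in H. rewrite !opp_IZR, !RtoC_opp.
    replace z1 with ((z1 + RtoC (IZR n) * tau + RtoC (IZR b)) - RtoC (IZR n) * tau - RtoC (IZR b))%C by ring.
    rewrite H. ring. }
  set (SB := fun n => epsilon (inhabits (RtoC 0))
    (hs (fun b => gauss_shift (Im tau / m) s al (w n) b / (w n + RtoC (IZR b)))%C)).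
  assert (HB : forall n, hs (fun b => gauss_shift (Im tau / m) s al (w n) b / (w n + RtoC (IZR b)))%C (SB n)).
  { intros n. apply epsilon_spec. apply gauss_shift_div_sum; auto. }
  destruct (lattice_sum_exists pm m s tau z1 z2 Hm Hv Hz) as [L HL].
  set (p := row_factor pm m tau z1 z2).
  assert (SumB : hs (fun n => p n * SB n)%C L).
  { apply (hs_fubini _ _ _ HL). intros n.
    eapply hs_ext; [|apply hs_scal; apply HB]. intros b. symmetry. apply lattice_term_row; assumption. }
  assert (SumA : hs (fun n => p n * SA n)%C (Phi_add pm m s tau z1 z2)).
  { apply (hs_fubini _ _ _ Hadd). intros n.
    exact (hs_scal (p n) _ _ (HA n)). }
  assert (Hx : forall n, cexp (twopii * w n) <> 1%C).
  { intros n h. apply cexp_eq1 in h. destruct h as [b Hb]. apply (Hw n (- b)%Z).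
    rewrite Hb, opp_IZR, RtoC_opp. ring. }
  (* The series of [Phi] needs no estimate of its own: termwise it is a combination of two families
     already known to be summable. *)
  assert (HPhi : Phi pm m s tau z1 z2 =
    (RtoC (/ 2) * Phi_add pm m s tau z1 z2 + - / twopii * L)%C).
  { apply zsum_hs. eapply hs_ext; [|apply hs_plus; apply hs_scal; [exact SumA|exact SumB]].
    intros n. cbv beta.
    assert (E := appell_term_expansion _ s al (w n) _ _ Ht (Hx n) (HA n) (HB n)).
    transitivity (p n * (cexp (twopii * RtoC s * w n) / (1 - cexp (twopii * w n))))%C.
    - replace (cexp (twopii * RtoC s * w n) / (1 - cexp (twopii * w n)))%C with
        (- (SB n / twopii) + RtoC (/ 2) * SA n)%C by (rewrite <- E; ring).
      unfold Cdiv. ring.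
    - unfold p, row_factor, qpow, Cdiv. rewrite !Cmult_assoc. f_equal.
      + rewrite <- !Cmult_assoc. f_equal. rewrite <- !cexp_plus. f_equal. unfold w.
        rewrite !RtoC_plus, !RtoC_mult, RtoC_pow. ring.
      + do 2 f_equal. rewrite <- cexp_plus. f_equal. unfold w. ring. }
  replace (- (twopii * Phi_t pm m s tau z1 z2))%C with L; [assumption|].
  unfold Phi_t. rewrite HPhi. field. apply twopii_neq0.
Qed.

(** Reduces each transformation law to a bijection of the index lattice and an identity between
    single terms. *)
Lemma Phi_t_transfer pm m s tau z1 z2 pm' s' tau' z1' z2' (c : C) (h g : Z * Z -> Z * Z) :
  (exists M : nat, (0 < M)%nat /\ m = INR M / 2) ->
  0 < Im tau -> off_lattice tau z1 -> 0 < Im tau' -> off_lattice tau' z1' ->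
  (forall p, g (h p) = p) -> (forall p, h (g p) = p) ->
  (forall p, lattice_term pm m s tau z1 z2 p = (c * lattice_term pm' m s' tau' z1' z2' (h p))%C) ->
  Phi_t pm m s tau z1 z2 = (c * Phi_t pm' m s' tau' z1' z2')%C.
Proof.
  intros HM Hv Hz Hv' Hz' Hgh Hhg E.
  assert (H := Phi_t_lattice pm m s tau z1 z2 HM Hv Hz).
  assert (H' := Phi_t_lattice pm' m s' tau' z1' z2' HM Hv' Hz').
  apply (hs_bij h g _ _ Hgh Hhg) in H'. apply (hs_scal c) in H'.
  assert (Q : (- (twopii * Phi_t pm m s tau z1 z2))%C
     = (c * - (twopii * Phi_t pm' m s' tau' z1' z2'))%C).
  { apply (hs_unique _ _ _ H). revert H'. apply hs_ext. intros p. symmetry; apply E. }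
  replace (Phi_t pm m s tau z1 z2) with (- / twopii * - (twopii * Phi_t pm m s tau z1 z2))%C
    by (field; apply twopii_neq0).
  rewrite Q. field. apply twopii_neq0.
Qed.

(** [d] rescales the denominator (by tau for the inversion, by 1 otherwise), [cexp e] is the rest of
    the automorphy factor, and [N] is the integer by which the phases may differ. *)
Lemma lattice_term_scal pm m s tau z1 z2 pm' s' tau' z1' z2' p p' (e d : C) (N : Z) :
  (z1' + lattice_pt tau' p' = (z1 + lattice_pt tau p) * d)%C ->
  d <> 0%C -> (z1 + lattice_pt tau p)%C <> 0%C ->
  (twopii * RtoC (pmshift pm * IZR (fst p) - (s + m * IZR (fst p)) * IZR (snd p))
     + RtoC (PI * m / Im tau) *
       (- ((z1 + lattice_pt tau p) * Cconj (z1 + lattice_pt tau p))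
        - (z2 - Cconj z2) * z1
        + lattice_pt tau p * Cconj z2 - Cconj (lattice_pt tau p) * z2)
   = e + (twopii * RtoC (pmshift pm' * IZR (fst p') - (s' + m * IZR (fst p')) * IZR (snd p'))
     + RtoC (PI * m / Im tau') *
       (- ((z1' + lattice_pt tau' p') * Cconj (z1' + lattice_pt tau' p'))
        - (z2' - Cconj z2') * z1'
        + lattice_pt tau' p' * Cconj z2' - Cconj (lattice_pt tau' p') * z2')) + twopii * RtoC (IZR N))%C ->
  lattice_term pm m s tau z1 z2 p = (d * cexp e * lattice_term pm' m s' tau' z1' z2' p')%C.
Proof.
  intros Hd Hd0 Hp0 He. unfold lattice_term. rewrite (cexp_period _ _ N He), cexp_plus.
  rewrite Hd. set (x := cexp (_ + _)). field. split; [assumption|]. exact Hp0.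
Qed.

Lemma off_lattice_neq0 tau z p : off_lattice tau z -> (z + lattice_pt tau p)%C <> 0%C.
Proof.
  destruct p as [n b]. unfold lattice_pt; simpl. intros Hz H.
  apply (Hz (- b)%Z (- n)%Z). rewrite !opp_IZR, !RtoC_opp.
  replace z with ((z + (RtoC (IZR n) * tau + RtoC (IZR b))) - (RtoC (IZR n) * tau + RtoC (IZR b)))%C by ring.
  rewrite H. ring.
Qed.

(** * The transformation laws *)

Lemma Cconj_RtoC (x : R) : Cconj (RtoC x) = RtoC x.
Proof. apply C_eq; simpl; ring. Qed.

(** The link between the Gaussian weight and the characters: it turns the non-holomorphic
    contributions of a translation into phases. *)
Lemma scale_Im_tau (m : R) (tau : C) : 0 < Im tau ->
  (RtoC (PI * m / Im tau) * (tau - Cconj tau) = twopii * RtoC m)%C.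
Proof. intros H. rewrite twopii_eq. destruct tau as [u v]. simpl in H. apply C_eq; simpl; field; lra. Qed.

Lemma Phi_t_translate_tau pm m s s' (a b q : Z) tau z1 z2 :
  (exists M : nat, (0 < M)%nat /\ m = INR M / 2) ->
  0 < Im tau -> off_lattice tau z1 ->
  m * (IZR a - IZR b) + (s' - s) = IZR q ->
  Phi_t pm m s tau (z1 + RtoC (IZR a) * tau)%C (z2 + RtoC (IZR b) * tau)%C
  = (pmpow pm a * cexp (- (twopii * RtoC m * (RtoC (IZR b) * z1 + RtoC (IZR a) * z2)))
      * qpow tau (- (m * IZR a * IZR b)) * Phi_t pm m s' tau z1 z2)%C.
Proof.
  intros HM Hv Hz Hq.
  assert (Hz' : off_lattice tau (z1 + RtoC (IZR a) * tau)%C).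
  { intros k n H. apply (Hz k (n - a)%Z). rewrite minus_IZR, RtoC_minus.
    replace z1 with (z1 + RtoC (IZR a) * tau - RtoC (IZR a) * tau)%C by ring. rewrite H. ring. }
  apply (Phi_t_transfer _ _ _ _ _ _ _ _ _ _ _ _ (fun p => (fst p + a, snd p)%Z)
    (fun p => (fst p - a, snd p)%Z)); try assumption.
  { intros [n k]; simpl; f_equal; lia. }
  { intros [n k]; simpl; f_equal; lia. }
  intros [n k]. cbv [fst snd].
  set (e := (twopii * RtoC (pmshift pm * IZR a)
    + - (twopii * RtoC m * (RtoC (IZR b) * z1 + RtoC (IZR a) * z2))
    + twopii * tau * RtoC (- (m * IZR a * IZR b)))%C).
  replace (pmpow pm a * _ * _)%C with (1 * cexp e)%C.
  2: { unfold e, qpow. rewrite pmpow_cexp, !cexp_plus. ring. }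
  assert (HL : lattice_pt tau (n + a, k)%Z = (lattice_pt tau (n, k) + RtoC (IZR a) * tau)%C).
  { unfold lattice_pt; simpl. rewrite plus_IZR, RtoC_plus. ring. }
  (* The part - a expresses that (-1)^a is its own inverse. The part q k is the change of the
     character in k, trivial by [Hq]; the leftover m b k is produced by the conjugate terms. *)
  apply lattice_term_scal with (N := ((if pm then 0 else - a) + q * k)%Z).
  - rewrite HL. ring.
  - apply C1_nz.
  - apply off_lattice_neq0; assumption.
  - rewrite HL. cbv [fst snd].
    set (c := RtoC (PI * m / Im tau)).
    set (l := lattice_pt tau (n, k)).
    rewrite !Cplus_conj, !Cmult_conj, !Cconj_RtoC.
    replace (pmshift pm * IZR n - (s + m * IZR n) * IZR k) with
      (pmshift pm * IZR a + (pmshift pm * IZR (n + a) - (s' + m * IZR (n + a)) * IZR k)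
       + IZR ((if pm then 0 else - a) + q * k) + m * (IZR b * IZR k)).
    2: { rewrite !plus_IZR, mult_IZR, <- Hq. destruct pm; simpl; [|rewrite opp_IZR]; field. }
    rewrite !RtoC_plus, (RtoC_mult m), (RtoC_mult (IZR b)).
    assert (K : (c * (tau - Cconj tau) = twopii * RtoC m)%C) by (apply scale_Im_tau; assumption).
    assert (HLc : (l * Cconj tau - Cconj l * tau = - (RtoC (IZR k) * (tau - Cconj tau)))%C).
    { unfold l, lattice_pt; simpl. rewrite !Cplus_conj, !Cmult_conj, !Cconj_RtoC. ring. }
    unfold e. rewrite RtoC_opp, !RtoC_mult.
    set (A := RtoC (IZR a)). set (B := RtoC (IZR b)). set (k' := RtoC (IZR k)) in *.
    set (lb := Cconj l) in *. set (tb := Cconj tau) in *.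
    match goal with |- (_ + c * ?X1 = _ + (_ + c * ?X2) + _)%C =>
      replace X1 with (X2 + (tau - tb) * (- (A * z2) - B * z1 - A * B * tau - B * k'))%C end.
    + rewrite (Cmult_plus_distr_l c), (Cmult_assoc c (tau - tb)), K. ring.
    + transitivity (- ((z1 + A * tau + l) * (Cconj z1 + A * tb + lb)) -
        (z2 + B * tau - (Cconj z2 + B * tb)) * (z1 + A * tau) + l * Cconj z2 - lb * z2
        + B * (l * tb - lb * tau))%C; [rewrite HLc; ring|ring].
Qed.

(** Adding a to z1 moves the second index by a. The character left over in n is exp(2 pi i q n),
    which is 1 by the integrality hypothesis. *)
Lemma Phi_t_translate_one pm pm' m s (a b q : Z) tau z1 z2 :
  (exists M : nat, (0 < M)%nat /\ m = INR M / 2) ->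
  0 < Im tau -> off_lattice tau z1 ->
  m * (IZR a + IZR b) + (pmshift pm - pmshift pm') = IZR q ->
  Phi_t pm m s tau (z1 + RtoC (IZR a))%C (z2 + RtoC (IZR b))%C
  = (cexp (twopii * RtoC (s * IZR a)) * Phi_t pm' m s tau z1 z2)%C.
Proof.
  intros HM Hv Hz Hq.
  assert (Hz' : off_lattice tau (z1 + RtoC (IZR a))%C).
  { intros k n H. apply (Hz (k - a)%Z n). rewrite minus_IZR, RtoC_minus.
    replace z1 with (z1 + RtoC (IZR a) - RtoC (IZR a))%C by ring. rewrite H. ring. }
  apply (Phi_t_transfer _ _ _ _ _ _ _ _ _ _ _ _ (fun p => (fst p, snd p + a)%Z)
    (fun p => (fst p, snd p - a)%Z)); try assumption.
  { intros [n k]; simpl; f_equal; lia. }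
  { intros [n k]; simpl; f_equal; lia. }
  intros [n k]. cbv [fst snd].
  rewrite <- (Cmult_1_l (cexp _)).
  assert (HL : lattice_pt tau (n, k + a)%Z = (lattice_pt tau (n, k) + RtoC (IZR a))%C).
  { unfold lattice_pt; simpl. rewrite plus_IZR, RtoC_plus. ring. }
  apply lattice_term_scal with (N := (q * n)%Z).
  - rewrite HL. ring.
  - apply C1_nz.
  - apply off_lattice_neq0; assumption.
  - rewrite HL. cbv [fst snd].
    set (c := RtoC (PI * m / Im tau)).
    set (l := lattice_pt tau (n, k)).
    rewrite !Cplus_conj, !Cconj_RtoC.
    replace (pmshift pm * IZR n - (s + m * IZR n) * IZR k) with
      (s * IZR a + (pmshift pm' * IZR n - (s + m * IZR n) * IZR (k + a))
       + IZR (q * n) - m * (IZR b * IZR n)).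
    2: { rewrite plus_IZR, mult_IZR, <- Hq. ring. }
    rewrite RtoC_minus, !RtoC_plus, (RtoC_mult m), (RtoC_mult (IZR b)).
    assert (K : (c * (tau - Cconj tau) = twopii * RtoC m)%C) by (apply scale_Im_tau; assumption).
    assert (HLc : (l - Cconj l = RtoC (IZR n) * (tau - Cconj tau))%C).
    { unfold l, lattice_pt; simpl. rewrite !Cplus_conj, !Cmult_conj, !Cconj_RtoC. ring. }
    set (A := RtoC (IZR a)). set (B := RtoC (IZR b)). set (n' := RtoC (IZR n)) in *.
    set (lb := Cconj l) in *. set (tb := Cconj tau) in *.
    match goal with |- (_ + c * ?X1 = _ + (_ + c * ?X2) + _)%C =>
      replace X1 with (X2 + (tau - tb) * (B * n'))%C end.
    + rewrite (Cmult_plus_distr_l c), (Cmult_assoc c (tau - tb)), K. ring.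
    + transitivity (- ((z1 + A + l) * (Cconj z1 + A + lb)) -
        (z2 + B - (Cconj z2 + B)) * (z1 + A) + l * Cconj z2 - lb * z2
        + B * (l - lb))%C; [rewrite HLc; ring|ring].
Qed.

(** Reindexing by (n, b) -> (n, n + b) leaves the phase s n + m n^2. Since 2m is an integer and n (n
    - 1) is even, m n^2 is m n modulo 1, whence the combination m + s in the hypothesis. *)
Lemma Phi_t_modular_T pm pm' m s (q : Z) tau z1 z2 :
  (exists M : nat, (0 < M)%nat /\ m = INR M / 2) ->
  0 < Im tau -> off_lattice tau z1 ->
  m + s + (pmshift pm - pmshift pm') = IZR q ->
  Phi_t pm m s (tau + RtoC 1)%C z1 z2 = Phi_t pm' m s tau z1 z2.
Proof.
  intros HM Hv Hz Hq.
  assert (HI : Im (tau + RtoC 1)%C = Im tau) by (destruct tau; simpl; ring).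
  assert (Hz' : off_lattice (tau + RtoC 1)%C z1).
  { intros k n H. apply (Hz (k + n)%Z n). rewrite plus_IZR, RtoC_plus, H. ring. }
  rewrite <- (Cmult_1_l (Phi_t pm' m s tau z1 z2)).
  apply (Phi_t_transfer _ _ _ _ _ _ _ _ _ _ _ _ (fun p => (fst p, fst p + snd p)%Z)
    (fun p => (fst p, snd p - fst p)%Z)); try assumption.
  { rewrite HI; assumption. }
  { intros [n k]; simpl; f_equal; lia. }
  { intros [n k]; simpl; f_equal; lia. }
  intros [n k]. cbv [fst snd].
  replace (RtoC 1) with (1 * cexp 0)%C at 2 by (rewrite cexp_0; ring).
  assert (HL : lattice_pt tau (n, n + k)%Z = lattice_pt (tau + RtoC 1)%C (n, k)).
  { unfold lattice_pt; simpl. rewrite plus_IZR, RtoC_plus. ring. }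
  destruct HM as [M [HM Hm]].
  assert (Hj : exists j, (n * (n - 1) = 2 * j)%Z).
  { destruct (Z.Even_or_Odd n) as [[i ->]|[i ->]]; [exists (i * (2 * i - 1))%Z|exists ((2 * i + 1) * i)%Z]; ring. }
  destruct Hj as [j Hj].
  apply lattice_term_scal with (N := (q * n + Z.of_nat M * j)%Z).
  - rewrite HL. ring.
  - apply C1_nz.
  - apply off_lattice_neq0; assumption.
  - rewrite HL, HI. cbv [fst snd].
    replace (pmshift pm * IZR n - (s + m * IZR n) * IZR k) with
      ((pmshift pm' * IZR n - (s + m * IZR n) * IZR (n + k)) + IZR (q * n + Z.of_nat M * j)).
    { rewrite RtoC_plus. ring. }
    apply (f_equal IZR) in Hj. rewrite !mult_IZR, minus_IZR in Hj.
    rewrite !plus_IZR, !mult_IZR, <- INR_IZR_INZ, <- Hq.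
    assert (Hm2 : INR M * IZR j = m * (IZR n * (IZR n - 1))) by (rewrite Hj, Hm; field).
    rewrite Hm2. ring.
Qed.

(** Since n (- 1 / tau) + b = (b tau - n) / tau, the index pair becomes (b, - n) and the two
    characters change places: s' must match the sign [pm] modulo 1, and s the sign [pm']. The cross
    terms m n b differ by 2 m n b, an integer. *)
Lemma Phi_t_modular_S pm pm' m s s' (k1 k2 : Z) tau z1 z2 :
  (exists M : nat, (0 < M)%nat /\ m = INR M / 2) ->
  0 < Im tau -> off_lattice tau z1 ->
  s' = pmshift pm + IZR k1 -> s = pmshift pm' + IZR k2 ->
  Phi_t pm m s (- / tau)%C (z1 / tau)%C (z2 / tau)%C
  = (tau * cexp (twopii * RtoC m / tau * z1 * z2) * Phi_t pm' m s' tau z1 z2)%C.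
Proof.
  intros HM Hv Hz Hs' Hs.
  assert (Ht0 : tau <> 0%C) by (intros ->; simpl in Hv; lra).
  assert (Htb0 : Cconj tau <> 0%C).
  { intros h. apply Ht0. rewrite <- (Cconj_conj tau), h. apply Cconj_RtoC. }
  assert (Hsq : 0 < Re tau ^ 2 + Im tau ^ 2) by (pose proof (pow2_ge_0 (Re tau)); nra).
  assert (HI : Im (- / tau)%C = Im tau / (Re tau ^ 2 + Im tau ^ 2)).
  { destruct tau; simpl in *. field. lra. }
  assert (Hv' : 0 < Im (- / tau)%C) by (rewrite HI; apply Rdiv_lt_0_compat; lra).
  assert (Hc : RtoC (PI * m / Im (- / tau)%C) = (RtoC (PI * m / Im tau) * (tau * Cconj tau))%C).
  { rewrite HI. destruct tau as [u v]. simpl in *. apply C_eq; simpl; field; lra. }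
  assert (Hz' : off_lattice (- / tau)%C (z1 / tau)%C).
  { intros k n H. apply (Hz (- n)%Z k). rewrite opp_IZR, RtoC_opp.
    replace z1 with (z1 / tau * tau)%C by (field; assumption). rewrite H. field. assumption. }
  apply (Phi_t_transfer _ _ _ _ _ _ _ _ _ _ _ _ (fun p => (snd p, - fst p)%Z)
    (fun p => (- snd p, fst p)%Z)); try assumption.
  { intros [n k]; simpl; f_equal; lia. }
  { intros [n k]; simpl; f_equal; lia. }
  intros [n k]. cbv [fst snd]. destruct HM as [M [HM Hm]].
  assert (HL : lattice_pt (- / tau)%C (n, k) = (lattice_pt tau (k, - n)%Z / tau)%C).
  { unfold lattice_pt; simpl. rewrite opp_IZR, RtoC_opp. field. assumption. }
  apply lattice_term_scal with
    (N := (- k2 * k - (if pm' then 0 else k) - k1 * n - Z.of_nat M * n * k)%Z).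
  - rewrite HL. field. assumption.
  - assumption.
  - apply off_lattice_neq0; assumption.
  - rewrite HL, Hc. cbv [fst snd].
    set (c := RtoC (PI * m / Im tau)).
    set (l := lattice_pt tau (k, - n)%Z).
    replace (pmshift pm * IZR n - (s + m * IZR n) * IZR k) with
      ((pmshift pm' * IZR k - (s' + m * IZR k) * IZR (- n)) +
       IZR (- k2 * k - (if pm' then 0 else k) - k1 * n - Z.of_nat M * n * k)).
    2: { rewrite !minus_IZR, !mult_IZR, !opp_IZR, <- INR_IZR_INZ, Hs', Hs, Hm.
         destruct pm, pm'; simpl; field. }
    rewrite RtoC_plus, Cmult_plus_distr_l.
    assert (K : (c * (tau - Cconj tau) = twopii * RtoC m)%C) by (apply scale_Im_tau; assumption).
    rewrite <- K, !Cplus_conj, !Cdiv_conj by assumption.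
    set (lb := Cconj l). set (tb := Cconj tau) in *. clearbody c l lb tb. clear K.
    set (d1 := (twopii * _)%C). set (d2 := (twopii * _)%C). clearbody d1 d2.
    field. split; assumption.
Qed.

Theorem theorem1p3 :
  forall m : R, (exists M : nat, (0 < M)%nat /\ m = INR M / 2) ->
  (* (a) *)
  (forall (s s1 s' s1' : R) (tau z1 z2 : C),
     is_int s -> is_int s1 -> is_half_odd s' -> is_half_odd s1' ->
     0 < Im tau ->
     (forall k n : Z, z1 <> (RtoC (IZR k) + RtoC (IZR n) * tau)%C) ->
     let tau' := (- / tau)%C in
     let w1 := (z1 / tau)%C in
     let w2 := (z2 / tau)%C in
     let fac := (tau * cexp (twopii * RtoC m / tau * z1 * z2))%C in
     Phi_t true m s tau' w1 w2 = (fac * Phi_t true m s1 tau z1 z2)%C /\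
     Phi_t false m s tau' w1 w2 = (fac * Phi_t true m s' tau z1 z2)%C /\
     Phi_t true m s' tau' w1 w2 = (fac * Phi_t false m s tau z1 z2)%C /\
     Phi_t false m s' tau' w1 w2 = (fac * Phi_t false m s1' tau z1 z2)%C) /\
  (* (b) *)
  (forall (pm : bool) (s s' : R) (tau z1 z2 : C),
     is_half_int s -> is_half_int s' -> is_int (m + s) -> is_half_odd (m + s') ->
     0 < Im tau ->
     (forall k n : Z, z1 <> (RtoC (IZR k) + RtoC (IZR n) * tau)%C) ->
     Phi_t pm m s (tau + RtoC 1)%C z1 z2 = Phi_t pm m s tau z1 z2 /\
     Phi_t pm m s' (tau + RtoC 1)%C z1 z2 = Phi_t (negb pm) m s' tau z1 z2) /\
  (* (c) *)
  (forall (pm : bool) (s : R) (a b : Z) (tau z1 z2 : C),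
     is_half_int s ->
     (Z.even a = Z.even b \/ is_int m) ->
     0 < Im tau ->
     (forall k n : Z, z1 <> (RtoC (IZR k) + RtoC (IZR n) * tau)%C) ->
     Phi_t pm m s tau (z1 + RtoC (IZR a) * tau)%C (z2 + RtoC (IZR b) * tau)%C
       = (pmpow pm a * cexp (- (twopii * RtoC m * (RtoC (IZR b) * z1 + RtoC (IZR a) * z2)))
          * qpow tau (- (m * IZR a * IZR b)) * Phi_t pm m s tau z1 z2)%C /\
     Phi_t pm m s tau (z1 + RtoC (IZR a))%C (z2 + RtoC (IZR b))%C
       = (cexp (twopii * RtoC (s * IZR a)) * Phi_t pm m s tau z1 z2)%C) /\
  (* (d) *)
  (forall (pm : bool) (s : R) (a b : Z) (tau z1 z2 : C),
     ~ is_int m -> is_half_int s ->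
     Z.even a <> Z.even b ->
     0 < Im tau ->
     (forall k n : Z, z1 <> (RtoC (IZR k) + RtoC (IZR n) * tau)%C) ->
     Phi_t pm m s tau (z1 + RtoC (IZR a) * tau)%C (z2 + RtoC (IZR b) * tau)%C
       = (pmpow pm a * cexp (- (twopii * RtoC m * (RtoC (IZR b) * z1 + RtoC (IZR a) * z2)))
          * qpow tau (- (m * IZR a * IZR b)) * Phi_t pm m (s + /2) tau z1 z2)%C /\
     Phi_t pm m s tau (z1 + RtoC (IZR a))%C (z2 + RtoC (IZR b))%C
       = (cexp (twopii * RtoC (s * IZR a)) * Phi_t (negb pm) m s tau z1 z2)%C).
Proof.
  intros m HM. split; [|split; [|split]].
  - intros s s1 s' s1' tau z1 z2 [k Hk] [k1 Hk1] [k' Hk'] [k1' Hk1'] Hv Hz.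
    simpl; repeat split; eapply Phi_t_modular_S; try eassumption; simpl;
      rewrite ?Hk, ?Hk1, ?Hk', ?Hk1'; rewrite ?Rplus_0_l; try reflexivity; apply Rplus_comm.
  - intros pm s s' tau z1 z2 _ _ [k Hk] [k' Hk'] Hv Hz. split.
    + apply (Phi_t_modular_T pm pm m s k); try assumption. rewrite Hk; ring.
    (* Flipping the sign changes the phase by - 1/2 or + 1/2, hence k' or k' + 1. *)
    + apply (Phi_t_modular_T pm (negb pm) m s' (if pm then k' else k' + 1)%Z); try assumption.
      rewrite Hk'. destruct pm; simpl; [|rewrite plus_IZR]; field.
  - intros pm s a b tau z1 z2 _ Hab Hv Hz.
    (* Equal parity makes a - b and a + b even, which clears the denominator of m. *)
    assert (Q : exists q1 q2, m * (IZR a - IZR b) = IZR q1 /\ m * (IZR a + IZR b) = IZR q2).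
    { destruct Hab as [E|[q ->]].
      - destruct HM as [M [_ ->]].
        assert (F : exists i j, (a - b = 2 * i /\ a + b = 2 * j)%Z).
        { destruct (Z.Even_or_Odd a) as [[i Hi]|[i Hi]], (Z.Even_or_Odd b) as [[j Hj]|[j Hj]];
            subst; rewrite ?Z.even_add, ?Z.even_mul in E; simpl in E; try discriminate E.
          - exists (i - j)%Z, (i + j)%Z; lia.
          - exists (i - j)%Z, (i + j + 1)%Z; lia. }
        destruct F as [i [j [F1 F2]]]. exists (Z.of_nat M * i)%Z, (Z.of_nat M * j)%Z.
        rewrite <- minus_IZR, <- plus_IZR, F1, F2, !mult_IZR, <- INR_IZR_INZ. split; field.
      - exists (q * (a - b))%Z, (q * (a + b))%Z.
        rewrite !mult_IZR, minus_IZR, plus_IZR. split; ring. }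
    destruct Q as [q1 [q2 [Q1 Q2]]]. split.
    + apply (Phi_t_translate_tau pm m s s a b q1); try assumption. rewrite Q1; ring.
    + apply (Phi_t_translate_one pm pm m s a b q2); try assumption. rewrite Q2; ring.
  - intros pm s a b tau z1 z2 Hm _ Hab Hv Hz.
    (* Here 2m and a - b, a + b are all odd, so both products are half-odd. The missing 1/2 is
       supplied by s + 1/2 in the first law and by the change of sign in the second. *)
    assert (Q : exists q1 q2, m * (IZR a - IZR b) = IZR q1 + / 2 /\ m * (IZR a + IZR b) = IZR q2 + / 2).
    { destruct HM as [M [_ ->]].
      assert (F : exists i j, (a - b = 2 * i + 1 /\ a + b = 2 * j + 1)%Z).
      { destruct (Z.Even_or_Odd a) as [[i Hi]|[i Hi]], (Z.Even_or_Odd b) as [[j Hj]|[j Hj]];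
          subst; rewrite ?Z.even_add, ?Z.even_mul in Hab; simpl in Hab; try (exfalso; apply Hab; reflexivity).
        - exists (i - j - 1)%Z, (i + j)%Z; lia.
        - exists (i - j)%Z, (i + j)%Z; lia. }
      assert (G : exists r, (Z.of_nat M = 2 * r + 1)%Z).
      { destruct (Z.Even_or_Odd (Z.of_nat M)) as [[r Hr]|[r Hr]]; [|exists r; exact Hr].
        exfalso. apply Hm. exists r. rewrite INR_IZR_INZ, Hr, mult_IZR. field. }
      destruct F as [i [j [F1 F2]]]. destruct G as [r Hr].
      exists (2 * r * i + r + i)%Z, (2 * r * j + r + j)%Z.
      rewrite <- minus_IZR, <- plus_IZR, F1, F2, INR_IZR_INZ, Hr, !plus_IZR, !mult_IZR. split; field. }
    destruct Q as [q1 [q2 [Q1 Q2]]]. split.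
    + apply (Phi_t_translate_tau pm m s (s + / 2) a b (q1 + 1)); try assumption.
      rewrite Q1, plus_IZR; field.
    + apply (Phi_t_translate_one pm (negb pm) m s a b (if pm then q2 else q2 + 1)%Z); try assumption.
      rewrite Q2. destruct pm; simpl; [|rewrite plus_IZR]; field.
Qed.
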